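(* For every $p\in(0,1]$ there exists a continuous function $F:2^{\mathbb{N}\times\mathbb{N}}\to\mathbf{K}([0,1])$ such that for every $x\in 2^{\mathbb{N}\times\mathbb{N}}$, $F(x)$ is a Salem set and $\dim(F(x))\ge p$ if and only if $x\in P_3$. Moreover, letting $$X_1:=\{A\in\mathbf{K}([0,1]) : \dim_{\mathcal H}(A)\ge p\},\qquad X_2:=\{A\in\mathbf{K}([0,1]) : \dim_{\mathrm F}(A)\ge p\},$$ every set $X$ such that $X_2\subset X\subset X_1$ is $\boldsymbol\Pi^0_3$-hard. In particular, $X_1$ and $X_2$ are $\boldsymbol\Pi^0_3$-complete.
   Context: $P_3:=\{x\in 2^{\mathbb{N}\times\mathbb{N}} : (\forall m)(\exists N)(\forall n\ge N)\ x(m,n)=0\}$, where $2^{\mathbb{N}\times\mathbb{N}}$ has the product topology. $\mathbf{K}([0,1])$ is the space of compact subsets of $[0,1]$ (including $\emptyset$) with the Vietoris topology, i.e. the topology generated by the sets $\{F : F\cap C=\emptyset\}$ ($C$ closed) and $\{F: F\cap U\neq\emptyset\}$ ($U$ open); it is Polish. For $A\subset\mathbb{R}$, the Hausdorff dimension is $\dim_{\mathcal H}(A)=\sup\{s\ge 0:\mathcal H^s(A)>0\}$, where $\mathcal H^s$ is $s$-dimensional Hausdorff measure. $\mathbb{P}(A)$ denotes the set of Borel probability measures on $\mathbb{R}$ with support included in $A$; $\widehat\mu(\xi)=\int e^{-i\xi x}\,d\mu(x)$. The Fourier dimension is $\dim_{\mathrm F}(A)=\sup\{s\in[0,1] : (\exists\mu\in\mathbb{P}(A))(\exists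 c>0)(\forall x\in\mathbb{R}, x\ne 0)\ |\widehat\mu(x)|\le c|x|^{-s/2}\}$. Convention: $\sup\emptyset=0$ in both definitions. $A$ is a Salem set if $\dim_{\mathcal H}(A)=\dim_{\mathrm F}(A)$; in that case the common value is written $\dim(A)$. Borel hierarchy: $\boldsymbol\Sigma^0_1$ are the open sets, $\boldsymbol\Pi^0_1$ the closed sets; $\boldsymbol\Sigma^0_\xi$ sets ($\xi>1$) are countable unions of sets each in some $\boldsymbol\Pi^0_{\eta}$ with $\eta<\xi$; $\boldsymbol\Pi^0_\xi$ sets are complements of $\boldsymbol\Sigma^0_\xi$ sets. For $A\subset X$, $B\subset Y$ write $A\le_W B$ if there is a continuous $f:X\to Y$ with $x\in A\iff f(x)\in B$. For $Y$ Polish, $B\subset Y$ is $\boldsymbol\Gamma$-hard if $A\le_W B$ for every $A\in\boldsymbol\Gamma(X)$ and every Polish $X$ having a basis of clopen sets; it is $\boldsymbol\Gamma$-complete if it is $\boldsymbol\Gamma$-hard and $B\in\boldsymbol\Gamma(Y)$. *)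

(* Defs.v *)
From HB Require Import structures.
From mathcomp Require Import all_boot all_order all_algebra.
From mathcomp Require Import all_classical all_reals all_analysis.
From mathcomp Require Import complex.

Set Implicit Arguments.
Unset Strict Implicit.
Unset Printing Implicit Defensive.

Import Order.TTheory GRing.Theory Num.Theory.
Import numFieldNormedType.Exports.

Local Open Scope classical_set_scope.
Local Open Scope ring_scope.
Local Open Scope complex_scope.

(* 2^(N x N), where bool carries the discrete topology. *)
Definition cantor2 : topologicalType :=
  prod_topology (fun _ : nat * nat => bool).

Definition P3 : set cantor2 :=
  [set x | forall m : nat, exists N : nat,
     forall n : nat, (N <= n)%N -> x (m, n) = false].

(* Compact subsets of T contained in D; the empty set is one of them. *)
Record compacts (T : topologicalType) (D : set T) := Compacts {
  cset :> set T ;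
  cset_compact : compact cset ;
  cset_sub : cset `<=` D }.

HB.instance Definition _ (T : topologicalType) (D : set T) :=
  gen_eqMixin (compacts D).
HB.instance Definition _ (T : topologicalType) (D : set T) :=
  gen_choiceMixin (compacts D).

(* As the members of compacts D are subsets of D, a closed (resp. open) set of T
   and its trace on D define the same set of compacts: ranging over the closed
   and open sets of T is the same as ranging over those of D. *)
Definition vietoris_subbase (T : topologicalType) (D : set T) :
    set (set (compacts D)) :=
  [set [set F : compacts D | F `&` C = set0] | C in [set C : set T | closed C]]
  `|`
  [set [set F : compacts D | F `&` U !=set0] | U in [set U : set T | open U]].

HB.instance Definition _ (T : topologicalType) (D : set T) :=
  isSubBaseTopological.Build (compacts D) (@vietoris_subbase T D) id.

Definition K01 (R : realType) : topologicalType :=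
  @compacts R [set` `[0%R, 1%R]].

Section dimensions.
Variable R : realType.
Implicit Types (A U : set R) (s : R).

(* The supremum in [0, +oo] of a set of nonnegative reals, so that the supremum
   of the empty set is 0 (ereal_sup set0 is -oo). *)
Definition sup_ge0 (S : set R) : \bar R := maxe 0%E (ereal_sup (EFin @` S)).

Definition ediam U : \bar R :=
  ereal_sup [set (`|z.1 - z.2|)%:E | z in U `*` U].

(* diam(U)^s, with 0^0 = 1, except that the empty set has weight 0 even for
   s = 0: H^0 is the counting measure. *)
Definition diam_pow s U : \bar R :=
  if U == set0 then 0%E else poweR (ediam U) s.

Definition hausdorff_premeasure s (delta : R) A : \bar R :=
  ereal_inf [set (\sum_(0 <= i <oo) diam_pow s (V i))%E
            | V in [set V : nat -> set R |
                (forall i, (ediam (V i) <= delta%:E)%E) /\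
                A `<=` \bigcup_i V i]].

Definition hausdorff_measure s A : \bar R :=
  ereal_sup [set hausdorff_premeasure s delta A
            | delta in [set delta : R | 0 < delta]].

Definition hausdorff_dim A : \bar R :=
  sup_ge0 [set s | 0 <= s /\ (0 < hausdorff_measure s A)%E].

Definition measure_support (mu : probability (measurableTypeR R) R) : set R :=
  [set x : R | forall U : set R, open U -> U x -> (0 < mu U)%E].

(* The integral of e^(-i xi x) = cos (xi x) - i sin (xi x). *)
Definition fourier_transform (mu : probability (measurableTypeR R) R) (xi : R) :
    R[i] :=
  (\int[mu]_x cos (xi * x)) -i* (\int[mu]_x sin (xi * x)).

Definition fourier_dim A : \bar R :=
  sup_ge0 [set s | 0 <= s <= 1 /\
    exists mu : probability (measurableTypeR R) R,
      measure_support mu `<=` A /\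
      exists c : R, 0 < c /\
        forall x : R, x != 0 ->
          `|fourier_transform mu x| <= (c * `|x| `^ (- s / 2))%:C].

Definition salem A : Prop := hausdorff_dim A = fourier_dim A.

End dimensions.

(* The finite levels of the Borel hierarchy; Sigma0 0 is empty. In the second
   constructor A i is the complement of a Sigma0 set of level e i, i.e. a Pi0 set
   of level e i < n. *)
Inductive Sigma0 (X : topologicalType) : nat -> set X -> Prop :=
| Sigma0_open (A : set X) : open A -> Sigma0 1 A
| Sigma0_bigcup (n : nat) (e : nat -> nat) (A : nat -> set X) :
    (1 < n)%N ->
    (forall i, (0 < e i < n)%N) ->
    (forall i, Sigma0 (e i) (~` A i)) ->
    Sigma0 n (\bigcup_i A i).

Definition Pi0 (n : nat) (X : topologicalType) (A : set X) : Prop :=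
  Sigma0 n (~` A).

Definition wadge_le (X Y : topologicalType) (A : set X) (B : set Y) : Prop :=
  exists f : X -> Y, continuous f /\ forall x, A x <-> B (f x).

Definition separable (X : topologicalType) : Prop :=
  exists S : set X, countable S /\ dense S.

(* d is a complete metric inducing the topology of X; nonnegativity of d follows
   from the first three clauses. *)
Definition complete_metric (R : realType) (X : topologicalType)
    (d : X -> X -> R) : Prop :=
  [/\ forall x y, d x y = 0 <-> x = y,
      forall x y, d x y = d y x,
      forall x y z, d x z <= d x y + d y z,
      forall x : X, nbhs x =
        filter_from [set r : R | 0 < r] (fun r => [set y | d x y < r]) &
      forall u : nat -> X,
        (forall r : R, 0 < r -> exists N : nat, forall m n : nat,
           (N <= m)%N -> (N <= n)%N -> d (u m) (u n) < r) ->
        exists l : X, u @ \oo --> l].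

Definition polish (R : realType) (X : topologicalType) : Prop :=
  separable X /\ exists d : X -> X -> R, complete_metric d.

(* This is not the library's zero_dimensional, which only asks that clopen sets
   separate points. *)
Definition has_clopen_basis (X : topologicalType) : Prop :=
  exists B : set (set X), basis B /\ B `<=` clopen.

Definition pointclass := forall X : topologicalType, set X -> Prop.

(* R only serves as the value type of the metrics witnessing Polishness. *)
Definition Gamma_hard (R : realType) (Gamma : pointclass) (Y : topologicalType)
    (B : set Y) : Prop :=
  forall X : topologicalType, polish R X -> has_clopen_basis X ->
  forall A : set X, Gamma X A -> wadge_le A B.

Definition Gamma_complete (R : realType) (Gamma : pointclass) (Y : topologicalType)
    (B : set Y) : Prop :=
  Gamma_hard R Gamma B /\ Gamma Y B.

(* Main.v *)
Require Import Defs.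
From HB Require Import structures.
From mathcomp Require Import all_boot all_order all_algebra.
From mathcomp Require Import all_classical all_reals all_analysis.
From mathcomp Require Import measurable_realfun complex.
From mathcomp Require Import ring lra zify.

Set Implicit Arguments.
Unset Strict Implicit.
Unset Printing Implicit Defensive.

Import Order.TTheory GRing.Theory Num.Theory.
Import numFieldNormedType.Exports.

Local Open Scope classical_set_scope.
Local Open Scope ring_scope.

(** For a closed set A of Salem dimension q, a Cantor scheme driven by a bit
    sequence z keeps an affine copy of A while zeros are read and, at each one,
    replaces the current set by tiny copies of itself around a finite net.  The
    limit f_A(z) depends continuously on z; it is a finite union of copies of A
    when z is eventually 0 and has Hausdorff dimension 0 otherwise.

    Take Salem sets A_m of rational dimension q_m < p with q_m -> p, and let z_m be
    the pointwise maximum of the rows of x of index at most m.  The set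
    F(x) = {0} u U_m (2^-(m+1) + 2^-(m+2) f_(A_m)(z_m)) accumulates only at 0, hence
    depends continuously on x.  If x is in P3 all pieces have full dimension q_m and
    dim F(x) = p; otherwise all but finitely many pieces have dimension 0, and
    dim F(x) is 0 or the maximum of finitely many q_m, hence less than p.

    A Salem set of dimension a/b is the intersection of sets made of 4^(ak)
    intervals of length 4^-(bk).  The subintervals kept at each step are chosen by
    derandomization of a Chernoff bound: a sum of exponentials over a fine net of
    frequencies is used as a potential, so that the Fourier transforms of two
    consecutive uniform measures differ by an almost optimal amount.  The inequality
    dim_F <= dim_H comes from integrating the Fejer kernel against mu x mu.

    For the upper bounds, A |-> "A is H^q-null" is a countable intersection of open
    conditions by compactness, and the existence of a measure on A with Fourier decay
    c |xi|^(-q/2), for fixed c and q, is a closed condition by weak compactness. *)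

(** Both dimensions are suprema, so only exponents strictly below them matter. Hence every estimate
    may lose a factor polynomial in the scale number k: a geometric factor swallows it at the price
    of an arbitrarily small exponent. This is why a Chernoff bound with its logarithmic loss is good
    enough, and why dyadic scales and rational dimensions suffice. The powers of 4 make the number
    4^(ak) of choices a perfect square, so that the square-root cancellation 2^(ak) is again an
    integer. The frequency range of a Chernoff step must be finite; it is cut at 4^(4bk), beyond
    which the oscillation over a single cell already gives the decay. The Fejer kernel is a
    trigonometric polynomial, so the energy of a measure is a finite sum of squared Fourier
    coefficients at integer frequencies and no integrals have to be exchanged. Weak compactness
    comes from writing a measure on [0,1] as the image of Lebesgue measure under its quantile
    function: a cluster point of monotone functions in [0,1]^R, controlled on finer and finer grids,
    gives the limit measure. *)

Section trig.
Variable R : realType.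
Implicit Types x y z t : R.

Lemma sin_lip x y : `|sin x - sin y| <= `|x - y|.
Proof.
wlog xy : x y / x <= y.
  move=> H; have [/H//|/ltW/H] := leP x y.
  by rewrite distrC (distrC y x).
have [c _ ] : exists2 c, c \in `[x, y]%R & sin y - sin x = cos c * (y - x).
  apply: MVT_segment => //.
  by apply: continuous_subspaceT; exact: continuous_sin.
rewrite distrC (distrC x y) => ->; rewrite normrM ler_piMl//.
exact: cos_max.
Qed.

Lemma cos_lip x y : `|cos x - cos y| <= `|x - y|.
Proof.
rewrite -2!sinDpihalf (le_trans (sin_lip _ _))//.
by rewrite opprD addrACA subrr addr0.
Qed.

End trig.

Notation prob R := (probability (measurableTypeR R) R).

Definition bounded_abs (R : realType) (f : R -> R) :=
  exists C : R, forall x, `|f x| <= C.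

Definition lip (R : realType) (L : R) (f : R -> R) :=
  forall x y, `|f x - f y| <= L * `|x - y|.

(** * Integrals of bounded measurable functions against a probability *)

Section bounded_integrals.
Variables (R : realType) (P : prob R).
Implicit Types f g : R -> R.

(** Stable under all the operations used below and integrable for every probability, so
    integrability never needs a separate argument. *)
Definition bmeas f := measurable_fun setT f /\ bounded_abs f.

Lemma bmeas_integrable f : bmeas f -> P.-integrable setT (EFin \o f).
Proof.
move=> [mf [C bC]]; apply: measurable_bounded_integrable => //.
  by rewrite -ge0_fin_numE// fin_num_measure.
exists C; split; first exact: num_real.
by move=> M CM x _; apply: (le_trans (bC x)); exact: ltW.
Qed.

Lemma bmeas_cst c : bmeas (fun=> c).
Proof. by split => //; exists `|c|. Qed.

Lemma bmeasD f g : bmeas f -> bmeas g -> bmeas (fun x => f x + g x).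
Proof.
move=> [mf [C bC]] [mg [D bD]]; split; first exact: measurable_funD.
by exists (C + D) => x; rewrite (le_trans (ler_normD _ _))// lerD.
Qed.

Lemma bmeasM f g : bmeas f -> bmeas g -> bmeas (fun x => f x * g x).
Proof.
move=> [mf [C bC]] [mg [D bD]]; split; first exact: measurable_funM.
by exists (C * D) => x; rewrite normrM ler_pM.
Qed.

Lemma bmeasZ c f : bmeas f -> bmeas (fun x => c * f x).
Proof. by move=> ?; apply: bmeasM => //; exact: bmeas_cst. Qed.

Lemma bmeasB f g : bmeas f -> bmeas g -> bmeas (fun x => f x - g x).
Proof.
move=> ? /(@bmeasZ (-1)); under [X in bmeas X]eq_fun do rewrite mulN1r.
exact: bmeasD.
Qed.

Lemma bmeas_norm f : bmeas f -> bmeas (fun x => `|f x|).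
Proof.
move=> [mf [C bC]]; split; first exact: measurableT_comp.
by exists C => x; rewrite normr_id.
Qed.

Lemma bmeas_sum (I : Type) (r : seq I) (p : pred I) (F : I -> R -> R) :
  (forall i, p i -> bmeas (F i)) -> bmeas (fun x => \sum_(i <- r | p i) F i x).
Proof.
move=> bF; elim: r => [|i r ih].
  under [X in bmeas X]eq_fun do rewrite big_nil; exact: bmeas_cst.
under [X in bmeas X]eq_fun do rewrite big_cons.
by have [pi|pi] := boolP (p i); [apply: bmeasD => //; exact: bF|].
Qed.

Lemma bmeas_comp f (g : R -> R) : bmeas f -> measurable_fun setT g ->
  bmeas (f \o g).
Proof.
by move=> [mf [C bC]] mg; split; [exact: measurableT_comp|exists C => x /=].
Qed.

Lemma bmeas_continuous f : continuous f -> bounded_abs f ->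
  bmeas f.
Proof. by move=> cf bf; split => //; exact: continuous_measurable_fun. Qed.

Lemma bmeas_indic (A : set R) : measurable A -> bmeas (\1_A : R -> R).
Proof.
move=> mA; split; first exact: measurable_indic.
by exists 1 => x; rewrite indicE; case: (_ \in _); rewrite ?normr1 ?normr0.
Qed.

Lemma bintD f g : bmeas f -> bmeas g ->
  \int[P]_x (f x + g x) = \int[P]_x f x + \int[P]_x g x.
Proof. by move=> bf bg; apply: RintegralD => //; exact: bmeas_integrable. Qed.

Lemma bintB f g : bmeas f -> bmeas g ->
  \int[P]_x (f x - g x) = \int[P]_x f x - \int[P]_x g x.
Proof. by move=> bf bg; apply: RintegralB => //; exact: bmeas_integrable. Qed.

Lemma bintZ c f : bmeas f -> \int[P]_x (c * f x) = c * \int[P]_x f x.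
Proof. by move=> bf; apply: RintegralZl => //; exact: bmeas_integrable. Qed.

Lemma bint_cst (c : R) : \int[P]_x c = c.
Proof.
rewrite Rintegral_cst// -[RHS]mulr1; congr (_ * _).
by rewrite (_ : 1 = fine 1%E)//; congr fine; exact: probability_setT.
Qed.

Lemma bint_sum (I : Type) (r : seq I) (p : pred I) (F : I -> R -> R) :
  (forall i, p i -> bmeas (F i)) ->
  \int[P]_x (\sum_(i <- r | p i) F i x) = \sum_(i <- r | p i) \int[P]_x F i x.
Proof.
move=> bF; elim: r => [|i r ih].
  under eq_Rintegral do rewrite big_nil; by rewrite big_nil bint_cst.
under eq_Rintegral do rewrite big_cons.
rewrite big_cons; have [pi|//] := boolP (p i).
by rewrite bintD ?ih//; [exact: bF|exact: bmeas_sum].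
Qed.

Lemma ler_bint f g : bmeas f -> bmeas g -> (forall x, f x <= g x) ->
  \int[P]_x f x <= \int[P]_x g x.
Proof.
by move=> bf bg fg; apply: le_Rintegral => //; exact: bmeas_integrable.
Qed.

Lemma bint_norm f : bmeas f -> `|\int[P]_x f x| <= \int[P]_x `|f x|.
Proof. by move=> bf; apply: le_normr_Rintegral => //; exact: bmeas_integrable. Qed.

Lemma bint_bound f C : bmeas f -> (forall x, `|f x| <= C) ->
  `|\int[P]_x f x| <= C.
Proof.
move=> bf fC; rewrite (le_trans (bint_norm bf))// -[leRHS]bint_cst.
by apply: ler_bint; [exact: bmeas_norm|exact: bmeas_cst|].
Qed.

Lemma bint_indic (A : set R) : measurable A ->
  \int[P]_x \1_A x = fine (P A).
Proof.
by move=> mA; rewrite /Rintegral integral_indic// setIT.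
Qed.

Lemma bint_EFin f : bmeas f ->
  ((\int[P]_x f x)%:E = \int[P]_x (f x)%:E)%E.
Proof.
move=> bf; rewrite /Rintegral fineK//.
by have := integrable_fin_num measurableT (bmeas_integrable bf).
Qed.

Lemma ae_eq_bint f g : bmeas f -> bmeas g ->
  (exists A, [/\ measurable A, P A = 0%E & forall x, ~ A x -> f x = g x]) ->
  \int[P]_x f x = \int[P]_x g x.
Proof.
move=> [mf _] [mg _] [A [mA PA fg]]; congr fine; apply: ae_eq_integral => //.
- exact/measurable_EFinP.
- exact/measurable_EFinP.
- exists A; split => // x /= h; apply: contrapT => nA.
  by apply: h => _; rewrite fg.
Qed.

Lemma bint_eq0 f : bmeas f -> (forall x, 0 <= f x) -> \int[P]_x f x = 0 ->
  P [set x | 0 < f x] = 0%E.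
Proof.
move=> bf f0 If0.
have mf : measurable_fun setT (EFin \o f) by apply/measurable_EFinP; case: bf.
have : (\int[P]_x `|(EFin \o f) x| = 0)%E.
  rewrite (_ : 0 = (\int[P]_x f x)%:E)%E; last by rewrite If0.
  by rewrite bint_EFin//; apply: eq_integral => x _ /=; rewrite ger0_norm.
move/(ae_eq_integral_abs P measurableT mf) => [A [mA PA sA]].
apply/eqP; rewrite eq_le measure_ge0 andbT -PA le_measure ?inE//.
  rewrite (_ : [set x | 0 < f x] = f @^-1` `]0, +oo[).
    by rewrite -[X in measurable X]setTI; case: bf => + _; apply.
  by apply/seteqP; split => x /=; rewrite in_itv/= andbT.
move=> x /= fx0; apply: sA => /= /(_ I) [] fx; by rewrite fx ltxx in fx0.
Qed.

End bounded_integrals.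

Section pushforward_probability.
Variable R : realType.

Definition pushprob (P : prob R) (h : R -> R) (mh : measurable_fun setT h) :
    prob R :=
  distribution P (HB.pack_for {mfun measurableTypeR R >-> measurableTypeR R} h
    (isMeasurableFun.Build _ _ (measurableTypeR R) (measurableTypeR R) h mh)).

Lemma pushprobE (P : prob R) (h : R -> R) (mh : measurable_fun setT h) A :
  pushprob P mh A = P (h @^-1` A).
Proof. by []. Qed.

Lemma bint_push (P : prob R) (h : R -> R) (mh : measurable_fun setT h) f :
  bmeas f -> \int[pushprob P mh]_x f x = \int[P]_x f (h x).
Proof.
move=> bf; rewrite /Rintegral; congr fine; rewrite integral_pushforward//.
  by apply/measurable_EFinP; case: bf.
exact/bmeas_integrable/(bmeas_comp bf).
Qed.

End pushforward_probability.

(** * Null sets and Hausdorff dimension *)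

Section null_sets.
Variable R : realType.
Implicit Types (A B : set R) (s t e : R).

(* For [0 < s] this is the vanishing of the s-dimensional Hausdorff measure; in
   covers by balls of total s-weight at most [e] the radii are automatically
   small, so that no bound on the diameters is needed. *)
Definition null s A := forall e : R, 0 < e -> exists c r : nat -> R,
  [/\ forall i, 0 <= r i, A `<=` \bigcup_i ball (c i) (r i) &
      forall n, \sum_(i < n) r i `^ s <= e].

Lemma nullS s A B : A `<=` B -> null s B -> null s A.
Proof.
move=> AB nB e e0; have [c [r [r0 Bc sr]]] := nB e e0.
by exists c, r; split => //; exact: subset_trans Bc.
Qed.

Lemma term_le_sum (F : nat -> R) (e : R) i : (forall j, 0 <= F j) ->
  (forall n, \sum_(j < n) F j <= e) -> F i <= e.
Proof.
move=> F0 /(_ i.+1); apply: le_trans.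
by rewrite big_ord_recr/= lerDr sumr_ge0.
Qed.

Lemma null_le s t A : 0 < s -> s <= t -> null s A -> null t A.
Proof.
move=> s0 st nA e e0.
(* Total weight at most 1 forces every radius below 1, where raising the exponent decreases the
   power. *)
have [|c [r [r0 Ac sr]]] := nA (Num.min e 1); first by rewrite lt_min e0 ltr01.
exists c, r; split => // n.
have r1 i : r i <= 1.
  rewrite leNgt; apply/negP => r1.
  have : r i `^ s <= 1.
    rewrite (@le_trans _ _ (Num.min e 1)) ?ge_min ?lexx ?orbT//.
    by apply: (@term_le_sum (fun j => r j `^ s)) => // j; exact: powR_ge0.
  rewrite leNgt => /negP; apply.
  have : 1 `^ s < r i `^ s by rewrite gt0_ltr_powR// nnegrE ?ler01.
  by rewrite powR1.
apply: (@le_trans _ _ (\sum_(i < n) r i `^ s)); last first.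
  by rewrite (le_trans (sr n))// ge_min lexx.
apply: ler_sum => i _; have [->|ri0] := eqVneq (r i) 0.
  by rewrite !powR0// gt_eqF// (lt_le_trans s0).
by apply: ger_powR => //; rewrite lt0r ri0 r0 r1.
Qed.

Lemma ler_sum_uniq_sub (I : eqType) (l1 l2 : seq I) (F : I -> R) :
  (forall i, 0 <= F i) -> uniq l1 -> {subset l1 <= l2} ->
  \sum_(i <- l1) F i <= \sum_(i <- l2) F i.
Proof.
move=> F0; elim: l1 l2 => [|x l1 ih] l2 /=.
  by rewrite big_nil sumr_ge0.
move=> /andP[xl1 u1] s12.
have xl2 : x \in l2 by apply: s12; rewrite mem_head.
rewrite big_cons (perm_big _ (perm_to_rem xl2))/= big_cons lerD2l.
apply: ih => // y yl1.
have : y \in x :: rem x l2.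
  by rewrite -(perm_mem (perm_to_rem xl2)); apply: s12; rewrite inE yl1 orbT.
by rewrite inE => /predU1P[yx|//]; rewrite -yx yl1 in xl1.
Qed.

Lemma sum_half_pow (e : R) n : \sum_(i < n) e / 2 ^+ i.+1 = e * (1 - 2 ^- n).
Proof.
elim: n => [|n ih]; first by rewrite big_ord0 expr0 invr1 subrr mulr0.
rewrite big_ord_recr/= ih exprS invfM.
have := mulr1 (2^-1 : R); move: (2 ^- n) => u _; lra.
Qed.

Lemma sum_half_pow_le (e : R) n : 0 <= e -> \sum_(i < n) e / 2 ^+ i.+1 <= e.
Proof.
by move=> e0; rewrite sum_half_pow ler_piMr// lerBlDr lerDl invr_ge0 exprn_ge0.
Qed.

Lemma null_bigcup s (A : nat -> set R) : 0 < s -> (forall k, null s (A k)) ->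
  null s (\bigcup_k A k).
Proof.
move=> s0 nA e e0.
have /choice[c /choice[r cr]] k : exists c, exists r : nat -> R,
    [/\ forall i, 0 <= r i, A k `<=` \bigcup_i ball (c i) (r i) &
      forall n, \sum_(i < n) r i `^ s <= e / 2 ^+ k.+1].
  have [|c [r H]] := nA k (e / 2 ^+ k.+1); last by exists c, r.
  by rewrite divr_gt0// exprn_gt0.
pose F (kj : nat * nat) := r kj.1 kj.2 `^ s.
pose pinv : nat -> option (nat * nat) := pickle_inv.
exists (fun i => if pinv i is Some kj then c kj.1 kj.2 else 0).
exists (fun i => if pinv i is Some kj then r kj.1 kj.2 else 0); split.
- by move=> i; case: (pinv i) => [kj|//]; case: (cr kj.1).
- move=> x [k _ Akx]; have [_ /(_ x Akx)[j _ xj] _] := cr k.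
  have [i ui] : exists i, pinv i = Some (k, j).
    by exists (pickle (k, j)); exact: pickleK_inv.
  by exists i; [by []|rewrite ui].
move=> n; pose l : seq (nat * nat) := pmap pinv (iota 0 n).
have -> : \sum_(i < n) (if pinv i is Some kj then r kj.1 kj.2 else 0) `^ s =
    \sum_(kj <- l) F kj.
  rewrite -(big_mkord xpredT (fun i => (if pinv i is Some kj
    then r kj.1 kj.2 else 0) `^ s)) /index_iota subn0 /l.
  elim: (iota 0 n) => [|i t ih]; first by rewrite !big_nil.
  rewrite big_cons ih /=; case: (pinv i) => [kj|]/=; first by rewrite big_cons.
  by rewrite powR0 ?add0r// gt_eqF.
have ul : uniq l by apply: (pmap_uniq (@pickle_invK _)); exact: iota_uniq.
(* A rectangle containing all listed pairs; it is summed row by row, row k having the budget e /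
   2^(k+1). *)
pose K := (\sum_(kj <- l) kj.1).+1; pose J := (\sum_(kj <- l) kj.2).+1.
pose l2 := [seq (k, j) | k <- iota 0 K, j <- iota 0 J].
have bnd (g : nat * nat -> nat) kj : kj \in l -> (g kj <= \sum_(x <- l) g x)%N.
  by move=> kjl; rewrite (big_rem kj)//= leq_addr.
have sub : {subset l <= l2}.
  move=> [k j] kjl; apply/allpairsP; exists (k, j).
  split=> [||//]; rewrite mem_iota add0n ltnS.
    exact: (bnd fst _ kjl).
  exact: (bnd snd _ kjl).
rewrite (le_trans (ler_sum_uniq_sub (fun kj => powR_ge0 _ _) ul sub))//.
rewrite /l2 big_allpairs.
rewrite (@le_trans _ _ (\sum_(k <- iota 0 K) e / 2 ^+ k.+1))//.
  apply: ler_sum => k _; have [_ _ /(_ J)] := cr k.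
  by rewrite -(big_mkord xpredT (fun j => r k j `^ s)) /index_iota subn0.
have -> : iota 0 K = index_iota 0 K by rewrite /index_iota subn0.
by rewrite big_mkord sum_half_pow_le// ltW.
Qed.

Lemma nullU s A B : 0 < s -> null s A -> null s B -> null s (A `|` B).
Proof.
move=> s0 nA nB; rewrite (_ : A `|` B = \bigcup_k (if k is 0%N then A else B)).
  by apply: null_bigcup => // -[|k].
apply/seteqP; split => x; first by case=> H; [exists 0%N|exists 1%N].
by case=> -[|k] _ H; [left|right].
Qed.

Lemma null_affine s A (a rho : R) : 0 < rho ->
  null s A -> null s [set a + rho * x | x in A].
Proof.
move=> rho0 nA e e0.
have rs0 : 0 < rho `^ s by exact: powR_gt0.
have [c [r [r0 Ac sr]]] := nA (e / rho `^ s) (divr_gt0 e0 rs0).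
exists (fun i => a + rho * c i), (fun i => rho * r i); split.
- by move=> i; rewrite mulr_ge0// ltW.
- move=> _ [x Ax <-]; have [i _ xi] := Ac x Ax; exists i => //.
  rewrite /ball/= opprD addrACA subrr add0r -mulrBr normrM gtr0_norm//.
  by rewrite ltr_pM2l.
- move=> n; under eq_bigr do rewrite powRM ?(ltW rho0)//.
  by rewrite -mulr_sumr -ler_pdivlMl// mulrC.
Qed.

Lemma null1 s x : 0 < s -> null s [set x].
Proof.
move=> s0 e e0; pose r := e `^ s^-1.
exists (fun=> x), (fun i => if i is 0%N then r else 0); split.
- by case=> //; exact: powR_ge0.
- by move=> _ ->; exists 0%N => //; apply: ballxx; exact: powR_gt0.
- case=> [|n]; first by rewrite big_ord0 ltW.
  rewrite big_ord_recl/= big1 ?addr0 => [|i _]; last by rewrite powR0// gt_eqF.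
  by rewrite /r -powRrM mulVf ?gt_eqF// powRr1// ltW.
Qed.

Lemma null_finite_covers s A : 0 < s ->
  (forall e : R, 0 < e -> exists (l : seq R) (r : R),
    [/\ 0 <= r, (size l)%:R * r `^ s <= e &
      forall x, A x -> exists2 c, c \in l & `|c - x| < r]) -> null s A.
Proof.
move=> s0 H e e0; have [l [r [r0 lr Al]]] := H e e0.
exists (nth 0 l), (fun i => if (i < size l)%N then r else 0); split.
- by move=> i; case: ifP.
- move=> x /Al[c /(nthP 0)[i il <-] xc]; exists i => //.
  by rewrite il.
- move=> n; apply: le_trans lr.
  rewrite (eq_bigr (fun i : 'I_n => if (i < size l)%N then r `^ s else 0)).
    rewrite -big_mkcond/= sumr_const -[leLHS]mulr_natl ler_wpM2r ?powR_ge0// ler_nat.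
    have : (#|[pred i : 'I_n | (i < size l)%N]| <= size (iota 0 (size l)))%N.
      rewrite cardE -(size_map val); apply: uniq_leq_size.
        by rewrite map_inj_uniq ?enum_uniq//; exact: val_inj.
      move=> _ /mapP[i + ->]; rewrite mem_enum inE => il.
      by rewrite mem_iota.
    by rewrite size_iota.
  by move=> i _; case: ifP => // _; rewrite powR0// gt_eqF.
Qed.

End null_sets.

(** * Null sets and the Hausdorff measure *)

Section hausdorff.
Variable R : realType.
Implicit Types (A U : set R) (s e : R).

Lemma ediam_ge U x y : U x -> U y -> (`|x - y|%:E <= ediam U)%E.
Proof. by move=> Ux Uy; apply: ereal_sup_ubound; exists (x, y). Qed.

Lemma ediam_ball (c r : R) : (ediam (ball c r) <= (r *+ 2)%:E)%E.
Proof.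
apply: ge_ereal_sup => _ [[x y] [/= cx cy] <-]; rewrite lee_fin/= mulr2n.
have : ball x (r + r) y by apply: ball_triangle cy; exact: ball_sym.
by rewrite /ball/= => /ltW.
Qed.

Lemma ediam_ge0 U : U !=set0 -> (0 <= ediam U)%E.
Proof. by move=> [x Ux]; rewrite (le_trans _ (ediam_ge Ux Ux))// lee_fin. Qed.

Lemma diam_pow_ge0 s U : (0 <= diam_pow s U)%E.
Proof. by rewrite /diam_pow; case: ifP => // _; exact: poweR_ge0. Qed.

Lemma null_hausdorff s A : 0 < s -> null s A -> (hausdorff_measure s A <= 0)%E.
Proof.
move=> s0 nA; apply: ge_ereal_sup => _ [delta /= d0 <-].
apply/lee_addgt0Pr => e e0; rewrite add0e.
(* The first bound absorbs the factor 2^s between radius and diameter; the second keeps each single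
   radius at most delta / 2. *)
pose e' := Num.min (e / 2 `^ s) ((delta / 2) `^ s).
have e'0 : 0 < e' by rewrite lt_min divr_gt0 ?powR_gt0// divr_gt0.
have [c [r [r0 Ac sr]]] := nA e' e'0.
apply: ge_ereal_inf; exists (\sum_(0 <= i <oo) diam_pow s (ball (c i) (r i)))%E.
  exists (fun i => ball (c i) (r i)) => //; split=> // i.
  rewrite (le_trans (ediam_ball _ _))// lee_fin -mulr_natr -ler_pdivlMr//.
  rewrite leNgt; apply/negP => dr.
  have : r i `^ s <= (delta / 2) `^ s.
    rewrite (@le_trans _ _ e') ?ge_min ?lexx ?orbT//.
    by apply: (@term_le_sum _ (fun j => r j `^ s)) => // j; exact: powR_ge0.
  by rewrite leNgt gt0_ltr_powR// nnegrE ?r0// divr_ge0// ltW.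
apply: lime_le.
  by apply: is_cvg_nneseries => i _ _; exact: diam_pow_ge0.
apply: nearW => n.
apply: (@le_trans _ _ (\sum_(0 <= i < n) ((r i *+ 2) `^ s)%:E)%E).
  apply: lee_sum => i _; rewrite /diam_pow; case: ifPn => [_|/eqP/eqP/set0P ne].
    by rewrite lee_fin powR_ge0.
  rewrite -poweR_EFin gt0_ler_poweR ?ediam_ball ?ltW//.
  - by rewrite in_itv/= ediam_ge0// leey.
  - by rewrite in_itv/= lee_fin leey mulrn_wge0.
rewrite sumEFin lee_fin big_mkord.
under eq_bigr do rewrite -mulr_natl powRM//.
rewrite -mulr_sumr -ler_pdivlMl ?powR_gt0// mulrC (le_trans (sr n))//.
by rewrite ge_min lexx.
Qed.

Lemma hausdorff_null s A : 0 < s -> (hausdorff_measure s A <= 0)%E -> null s A.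
Proof.
move=> s0 HA e e0.
pose K := 4 `^ s; have K0 : 0 < K by exact: powR_gt0.
pose e' := e / K / 2; have e'0 : 0 < e' by rewrite !divr_gt0.
have : (hausdorff_premeasure s 1 A < e'%:E)%E.
  apply: (@le_lt_trans _ _ 0%E); last by rewrite lte_fin.
  by apply: le_trans HA; apply: ereal_sup_ubound; exists 1 => //=.
move=> /ereal_inf_lt[_ [V [dV AV] <-] sV].
(* A set of the cover may be a single point, whereas balls are open: radii are padded with [eta i],
   whose s-th powers sum to at most [e']. *)
pose eta (i : nat) := (e' / 2 ^+ i.+1) `^ s^-1.
have ei0 i : 0 < e' / 2 ^+ i.+1 by rewrite divr_gt0// exprn_gt0.
have eta0 i : 0 < eta i by exact: powR_gt0.
have etas i : eta i `^ s = e' / 2 ^+ i.+1.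
  by rewrite /eta -powRrM mulVf ?gt_eqF// powRr1// ltW.
have /choice[c cP] i : exists c, V i !=set0 -> V i c.
  by have [[x Vx]|nV] := pselect (V i !=set0); [exists x|exists 0].
pose d i := fine (ediam (V i)).
have dE i : V i !=set0 -> ediam (V i) = (d i)%:E.
  move=> ne; rewrite /d fineK// fin_numElt (lt_le_trans _ (ediam_ge0 ne))//=.
  by rewrite (le_lt_trans (dV i))// ltry.
have d0 i : V i !=set0 -> 0 <= d i.
  by move=> ne; rewrite -lee_fin -dE//; exact: ediam_ge0.
pose r i := if `[< V i !=set0 >] then 2 * Num.max (d i) (eta i) else 0.
exists c, r; split.
- move=> i; rewrite /r; case: ifP => // _.
  by rewrite mulr_ge0// le_max (ltW (eta0 i)) orbT.
- move=> x /AV[i _ Vx]; exists i => //.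
  have ne : V i !=set0 by exists x.
  rewrite /ball/= /r asboolT//.
  have h1 : `|c i - x| <= d i by rewrite -lee_fin -dE// ediam_ge//; exact: cP.
  have h2 : d i <= Num.max (d i) (eta i) by rewrite le_max lexx.
  have h3 : 0 < Num.max (d i) (eta i) by rewrite lt_max eta0 orbT.
  by rewrite (le_lt_trans (le_trans h1 h2))// mulr_natl mulr2n ltrDl.
move=> n.
have sVn : (\sum_(i < n) diam_pow s (V i) <= e'%:E)%E.
  apply: le_trans (ltW sV).
  rewrite -(big_mkord xpredT (fun i => diam_pow s (V i))).
  by apply: nneseries_lim_ge => i _ _; exact: diam_pow_ge0.
have ri i : ((r i `^ s)%:E <= K%:E * (diam_pow s (V i) + (e' / 2 ^+ i.+1)%:E))%E.
  rewrite /r; have [ne|nV] := pselect (V i !=set0); last first.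
    rewrite asboolF// powR0 ?gt_eqF//; apply: mule_ge0.
      by rewrite lee_fin ltW.
    by rewrite adde_ge0 ?diam_pow_ge0// lee_fin ltW.
  rewrite asboolT// /diam_pow ifF; last by apply/negP => /eqP V0; case: ne; rewrite V0.
  rewrite dE// poweR_EFin -EFinD -EFinM lee_fin -etas.
  rewrite powRM ?le_max ?(ltW (eta0 i)) ?orbT//.
  apply: ler_pM; rewrite ?powR_ge0//.
    by apply: ge0_ler_powR; rewrite ?nnegrE ?ler_nat ?(ltW s0).
  by case: (leP (d i) (eta i)) => _; rewrite ?lerDl ?lerDr powR_ge0.
have -> : e = K * (e' + e') by rewrite -splitr mulrC divfK ?gt_eqF.
rewrite -lee_fin -sumEFin.
apply: (@le_trans _ _ (\sum_(i < n)
    K%:E * (diam_pow s (V i) + (e' / 2 ^+ i.+1)%:E))%E).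
  by apply: lee_sum => i _; exact: ri.
rewrite -ge0_sume_distrr; last first.
  by move=> i _; rewrite adde_ge0 ?diam_pow_ge0// lee_fin ltW.
rewrite EFinM lee_pmul2l//.
rewrite big_split/= EFinD leeD// sumEFin lee_fin.
by rewrite sum_half_pow_le// ltW.
Qed.

Lemma sup_ge0_ge (S : set R) s : S s -> (s%:E <= sup_ge0 S)%E.
Proof.
move=> Ss; rewrite /sup_ge0 le_max; apply/orP; right.
by apply: ereal_sup_ubound; exists s.
Qed.

Lemma sup_ge0_le (S : set R) (d : \bar R) : (0 <= d)%E ->
  (forall s, S s -> (s%:E <= d)%E) -> (sup_ge0 S <= d)%E.
Proof.
move=> d0 Sd; rewrite /sup_ge0 ge_max d0/=.
by apply: ge_ereal_sup => _ [s Ss <-]; exact: Sd.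
Qed.

Lemma hausdorff_dim_ge s A : 0 < s -> ~ null s A -> (s%:E <= hausdorff_dim A)%E.
Proof.
move=> s0 nA; apply: sup_ge0_ge; split; first exact: ltW.
by rewrite ltNge; apply/negP => /(hausdorff_null s0).
Qed.

Lemma hausdorff_dim_le (d : \bar R) A : (0 <= d)%E ->
  (forall s, 0 < s -> (d < s%:E)%E -> null s A) -> (hausdorff_dim A <= d)%E.
Proof.
move=> d0 nA; apply: sup_ge0_le => // s [s0 Hs]; rewrite leNgt; apply/negP => ds.
have s1 : 0 < s by rewrite -lte_fin (le_lt_trans d0).
by have := null_hausdorff s1 (nA s s1 ds); rewrite leNgt Hs.
Qed.

(** The exponents p(k+1)/(k+2) stand in for all exponents below p; this makes the outer
    intersections in the complexity bounds countable. *)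
Lemma lim_from_below (p : R) (d : \bar R) : 0 < p ->
  (forall k : nat, ((p * (k.+1%:R / k.+2%:R))%:E <= d)%E) -> (p%:E <= d)%E.
Proof.
move=> p0 H; apply/lee_subgt0Pr => e e0.
(* The gap p - p(k+1)/(k+2) equals p/(k+2), which is below e for this k. *)
pose k := Num.truncn (p / e).
apply: le_trans (H k); rewrite -EFinB lee_fin lerBlDr -lerBlDl.
have -> : p - p * (k.+1%:R / k.+2%:R) = p / k.+2%:R.
  have k2 : k.+2%:R != 0 :> R by rewrite pnatr_eq0.
  rewrite -[X in X - _]mulr1 -mulrBr; congr (_ * _).
  apply: (mulIf k2).
  by rewrite mulrBl mul1r divfK// mulVf// -natrB// subSnn.
rewrite ler_pdivrMr// mulrC -ler_pdivrMr// ltW//.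
by rewrite (lt_trans (Num.Theory.truncnS_gt _))// ltr_nat.
Qed.

Lemma frac_lt1 (k : nat) : 0 < (k.+1%:R / k.+2%:R : R) < 1.
Proof. by rewrite divr_gt0//= ltr_pdivrMr// mul1r ltr_nat. Qed.

Lemma hausdorff_dim_geP (p : R) A : 0 < p ->
  ((p%:E <= hausdorff_dim A)%E <->
  forall k : nat, ~ null (p * (k.+1%:R / k.+2%:R)) A).
Proof.
move=> p0; split=> [pA k nA|nA].
  have /andP[k0 k1] := frac_lt1 k.
  have q0 : 0 < p * (k.+1%:R / k.+2%:R) by rewrite mulr_gt0.
  have : (hausdorff_dim A <= (p * (k.+1%:R / k.+2%:R))%:E)%E.
    apply: hausdorff_dim_le; first by rewrite lee_fin ltW.
    by move=> s s0; rewrite lte_fin => qs; apply: null_le nA => //; exact: ltW.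
  move/(le_trans pA); rewrite lee_fin leNgt => /negP; apply.
  by rewrite gtr_pMr.
apply: lim_from_below => // k; apply: hausdorff_dim_ge => //.
by have /andP[k0 _] := frac_lt1 k; rewrite mulr_gt0.
Qed.

End hausdorff.

(** * Hardness of P3 *)

Section clopen_pointer.
Variable X : topologicalType.
Implicit Types (U C : set X).

(* At stage [k] the pointer designates the closed set currently believed to
   contain the point; it moves on once the point is seen to leave that set. *)
Fixpoint pointer (D : nat -> nat -> set X) (x : X) (k : nat) : nat :=
  if k is k'.+1 then
    pointer D x k' + `[< exists2 j, (j <= k')%N & D (pointer D x k') j x >]
  else 0%N.

Definition pointer_moves D x k : bool :=
  `[< exists2 j, (j <= k)%N & D (pointer D x k) j x >].

Lemma pointerS D x k : pointer D x k.+1 = (pointer D x k + pointer_moves D x k)%N.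
Proof. by []. Qed.

Lemma pointer_mono D x k l : (k <= l)%N -> (pointer D x k <= pointer D x l)%N.
Proof.
move=> /subnK <-; elim: (l - k)%N => // i ih.
by rewrite addSn pointerS (leq_trans ih)// leq_addr.
Qed.

(** The sets [D n j] are to exhaust the complement of the n-th closed set. The pointer never passes
    an index whose closed set contains the point, and cannot rest forever on an index that some
    [D n j] refutes. *)
Lemma pointerP D x : (exists n, forall j, ~ D n j x) <->
  (exists N, forall k, (N <= k)%N -> pointer_moves D x k = false).
Proof.
split=> [[n nD]|[N HN]].
  have le_n k : (pointer D x k <= n)%N.
    elim: k => // k ih; rewrite pointerS.
    move: ih; rewrite leq_eqVlt => /orP[/eqP e|]; last first.
      by move=> kn; rewrite (leq_trans _ kn)// -addn1 leq_add2l leq_b1.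
    have -> : pointer_moves D x k = false; last by rewrite addn0 e.
    by apply/asboolPn => -[j _]; rewrite e => /nD.
  apply: contrapT => nN.
  have big m : exists k, (m <= pointer D x k)%N.
    elim: m => [|m [k mk]]; first by exists 0%N.
    apply: contrapT => nk; apply: nN; exists k => l kl.
    apply/negbTE/negP => ml; apply: nk; exists l.+1.
    by rewrite pointerS ml addn1 ltnS (leq_trans mk)// pointer_mono.
  have [k] := big n.+1; by rewrite ltnNge le_n.
exists (pointer D x N) => j Dj.
have cst k : (N <= k)%N -> pointer D x k = pointer D x N.
  move=> /subnK <-; elim: (k - N)%N => // i ih.
  by rewrite addSn pointerS HN ?addn0// leq_addl.
(* At this stage the pointer has stabilized and the piece of index j is already among those
   inspected. *)
have := HN (maxn N j) (leq_maxl _ _); rewrite /pointer_moves cst ?leq_maxl//.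
by move=> /asboolPn; apply; exists j => //; exact: leq_maxr.
Qed.

(** Stage k consults finitely many clopen sets, hence is locally constant in the point. *)
Lemma pointer_near D x : (forall n j, clopen (D n j)) ->
  forall k, \forall y \near x, pointer D y k = pointer D x k /\
    pointer_moves D y k = pointer_moves D x k.
Proof.
move=> cD.
have near_D n j : \forall y \near x, D n j y <-> D n j x.
  have [oD cl] := cD n j; have [Dx|nDx] := pselect (D n j x).
    by apply: filterS (open_nbhs_nbhs (conj oD Dx)) => y Dy.
  have /open_nbhs_nbhs : open_nbhs x (~` D n j) by split => //; exact: closed_openC.
  by apply: filterS => y Dy.
have near_m n k : \forall y \near x,
    (exists2 j, (j <= k)%N & D n j y) <-> (exists2 j, (j <= k)%N & D n j x).
  have : \forall y \near x, forall j : 'I_k.+1, D n j y <-> D n j x.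
    by apply: filter_forall => j; exact: near_D.
  apply: filterS => y H; split=> -[j jk Dj]; exists j => //.
    by have /= <- := H (Ordinal (jk : (j < k.+1)%N)).
  by have /= -> := H (Ordinal (jk : (j < k.+1)%N)).
elim=> [|k ih].
  have := near_m 0%N 0%N; apply: filterS => y H; split => //.
  by rewrite /pointer_moves /=; apply: asbool_equiv_eq.
have := near_m (pointer D x k.+1) k.+1; apply: filterS2 ih => y [e1 e2] H.
have e : pointer D y k.+1 = pointer D x k.+1 by rewrite !pointerS e1 e2.
by split => //; rewrite /pointer_moves e; apply: asbool_equiv_eq.
Qed.

End clopen_pointer.

(** * Reducing Pi^0_3 subsets of zero-dimensional Polish spaces to [P3] *)

Section zero_dimensional_polish.
Variables (R : realType) (X : topologicalType).
Hypotheses (polX : polish R X) (zX : has_clopen_basis X).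

(** The clopen basis may be uncountable. Separability cuts it down: for each centre in a countable
    dense set and each radius 1/(n+1), one clopen set between that ball and U is chosen if there is
    one, and these already exhaust U. *)
Lemma open_bigcup_clopen (U : set X) : open U ->
  exists D : nat -> set X, (forall n, clopen (D n)) /\ U = \bigcup_n D n.
Proof.
case: polX => -[S [cS dS]] [d [d0 dsym dtri dnbhs _]] oU.
case: zX => B [[Bo Bb] Bc].
have /countable_injP[f injf] := cS.
pose bl s (n : nat) : set X := [set y | d s y < n.+1%:R^-1].
have /choice[D DP] (kn : nat * nat) : exists D : set X, [/\ clopen D, D `<=` U &
    forall s V, S s -> f s = kn.1 -> clopen V -> V `<=` U -> bl s kn.2 `<=` V ->
      bl s kn.2 `<=` D].
  case: kn => k n /=.
  have [[s [V [Ss fs cV VU bV]]]|nE] := pselect (exists s V,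
    [/\ S s, f s = k, clopen V, V `<=` U & bl s n `<=` V]).
    exists V; split => // s' V' Ss' fs' _ _ _.
    by rewrite (_ : s' = s)//; apply: injf; rewrite ?inE// fs fs'.
  exists set0; split => //; first exact: clopen0.
  by move=> s V Ss fs cV VU bV; exfalso; apply: nE; exists s, V.
exists (fun n => if unpickle n is Some kn then D kn else set0); split.
  by move=> n; case: unpickle => [kn|]; [case: (DP kn)|exact: clopen0].
apply/seteqP; split => x; last first.
  by case=> n _; case: unpickle => [kn|//]; case: (DP kn) => _ + _; apply.
move=> Ux.
have [V [BV Vx] VU] : exists2 V, B V /\ V x & V `<=` U.
  have /(Bb x) [V BV VU] : nbhs x U by apply: open_nbhs_nbhs.
  by exists V.
have : nbhs x V by apply: open_nbhs_nbhs; split => //; exact: Bo.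
rewrite dnbhs => -[r /= r0 rV].
(* With 1/(n+1) < r/2, the ball of this radius around a centre s near x contains x and stays inside
   the r-ball of x. *)
pose n := Num.truncn (2 / r); have nr : n.+1%:R^-1 < r / 2.
  by rewrite -[ltRHS]invrK ltf_pV2 ?posrE ?invr_gt0 ?divr_gt0// invf_div Num.Theory.truncnS_gt.
have nx : nbhs x [set y | d x y < n.+1%:R^-1].
  by rewrite dnbhs; exists n.+1%:R^-1 => //=; rewrite invr_gt0.
have [s [sx Ss]] : [set y | d x y < n.+1%:R^-1]° `&` S !=set0.
  by apply: (dS _ _ (@open_interior _ _)); exists x.
have {}sx : d x s < n.+1%:R^-1 := interior_subset sx.
exists (pickle (f s, n)) => //; rewrite pickleK.
case: (DP (f s, n)) => _ _ /(_ s V); apply => //; first exact: Bc.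
- move=> y sy; apply: rV => /=; rewrite (le_lt_trans (dtri _ s _))//.
  by rewrite (splitr r) ltrD// (lt_trans _ nr).
- by rewrite /bl /= dsym.
Qed.

(** [Sigma0] levels are not cumulative by definition, and a level 3 union mixes complements of
    levels 1 and 2; open sets join level 2 because they are countable unions of clopen sets. *)
Lemma Sigma02_closed (n : nat) (A : set X) : (0 < n < 3)%N -> Sigma0 n A ->
  exists C : nat -> set X, (forall n, closed (C n)) /\ A = \bigcup_n C n.
Proof.
move=> n03 SA; case: SA n03 => {n A} [A oA _|n e A n1 en SA n03].
  by have [D [cD ->]] := open_bigcup_clopen oA; exists D; split => // k; case: (cD k).
exists A; split => // i; rewrite -[A i]setCK; apply: open_closedC.
have e1 : e i = 1%N by have := en i; lia.
have := SA i; rewrite e1 => s1; move: e1.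
by inversion s1 => // ?; lia.
Qed.

Lemma P3_hard (A : set X) : Pi0 3 A -> wadge_le A P3.
Proof.
rewrite /Pi0 => S3.
have [B [SB AB]] : exists B : nat -> set X,
    (forall i, exists2 n, (0 < n < 3)%N & Sigma0 n (B i)) /\ A = \bigcap_i B i.
  have gen n (C : set X) : Sigma0 n C -> (1 < n)%N -> exists (e : nat -> nat) (B : nat -> set X),
      (forall i, (0 < e i < n)%N) /\ (forall i, Sigma0 (e i) (~` B i)) /\
      C = \bigcup_i B i.
    by case=> [//|m e B m1 em SB _]; exists e, B.
  have [e [B [e3 [SB AB]]]] := gen _ _ S3 isT.
  exists (fun i => ~` B i); split; last by rewrite -setC_bigcup -AB setCK.
  by move=> i; exists (e i).
have /choice[D DP] i : exists D : nat -> nat -> set X,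
    (forall n j, clopen (D n j)) /\
    forall x, B i x <-> exists n, forall j, ~ D n j x.
  have [n n03 SBi] := SB i.
  have [C [cC BC]] := Sigma02_closed n03 SBi.
  have /choice[D DP] n' : exists D : nat -> set X,
      (forall j, clopen (D j)) /\ ~` C n' = \bigcup_j D j.
    by apply: open_bigcup_clopen; exact: closed_openC.
  exists D; split => [k j|x]; first by case: (DP k).
  rewrite BC; split=> [[k _ Ck]|[k nD]]; exists k => //.
    by move=> j Dj; have [_] := DP k => /seteqP[_ /(_ x)]; apply => //; exists j.
  apply: contrapT => nC; have [_] := DP k => /seteqP[/(_ x nC)] [j _ Dj] _.
  exact: nD Dj.
(* Row m records the moves of the pointer attached to [B m]: it is eventually 0 exactly when the
   point lies in [B m]. *)
exists (fun x => (fun mn => pointer_moves (D mn.1) x mn.2) : cantor2); split.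
  move=> x; apply/cvg_sup => mn U [V] [[W] oW <-] Wx /filterS; apply.
  have [cD _] := DP mn.1.
  have := pointer_near x cD mn.2; apply: filterS => y [_ e].
  by rewrite /= /preimage/= e.
move=> x; rewrite AB; split.
  by move=> Bx m; apply/(pointerP (D m) x)/(DP m).2/Bx.
by move=> Px m _; apply/(DP m).2/(pointerP (D m) x)/Px.
Qed.

End zero_dimensional_polish.

(** * Weak limits of probability measures *)

Section quantile.
Variable R : realType.

Definition unif01 : prob R := uniform_prob (@ltr01 R).

Lemma unif01E (U : set R) : measurable U ->
  unif01 U = lebesgue_measure (U `&` `[0, 1]).
Proof.
move=> mU; rewrite /unif01/= /uniform_prob integral_uniform_pdf.
rewrite (eq_integral (fun=> 1%E)); last first.
  move=> x; rewrite inE/= in_itv/= => -[_ x01].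
  by rewrite /uniform_pdf x01 subr0 invr1.
rewrite integral_cst/= ?mul1e//.
exact: measurableI.
Qed.

(** Right-continuity of the distribution function, in the form needed for the infimum that defines a
    quantile. *)
Lemma prob_itvNy_right (P : prob R) (x t : R) :
  (forall y, x < y -> (t%:E <= P `]-oo, y]%classic)%E) -> (t%:E <= P `]-oo, x]%classic)%E.
Proof.
move=> H.
have cv : P `]-oo, (x + n.+1%:R^-1)]%classic @[n --> \oo] --> P `]-oo, x]%classic.
  pose F n : set R := `]-oo, (x + n.+1%:R^-1)]%classic.
  suff : P (F n) @[n --> \oo] --> P (\bigcap_n F n).
    by rewrite [in X in _ --> X -> _]/F -itvNycEbigcap.
  apply: nonincreasing_cvg_mu => [| | |m n mn].
  - by rewrite -ge0_fin_numE// fin_num_measure//; exact: measurable_itv.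
  - by move=> k; exact: measurable_itv.
  - by apply: bigcap_measurable => // k _; exact: measurable_itv.
  - apply/subsetPset; apply: subset_itvl.
    by rewrite bnd_simp lerD2l lef_pV2 ?posrE// ler_nat.
apply: (cvge_to_ge cv); apply: nearW => n; apply: H.
by rewrite ltrDl invr_gt0.
Qed.

(** Turns weak compactness of measures into pointwise compactness of monotone functions. *)
Lemma quantile (P : prob R) : P (~` `[0, 1]%classic) = 0%E ->
  exists h : R -> R, [/\ {homo h : s t / s <= t}, forall t, 0 <= h t <= 1 &
    forall f, bmeas f -> \int[P]_x f x = \int[unif01]_x f (h x)].
Proof.
move=> P01.
(* The alternative x = 1 keeps [Q t] nonempty when t > 1, so the quantile function is monotone and
   [0,1]-valued on the whole line. *)
pose Q t := [set x : R | 0 <= x <= 1 /\ (x = 1 \/ (t%:E <= P `]-oo, x]%classic)%E)].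
have Q1 t : Q t 1 by split; [rewrite ler01 lexx|left].
have Qlb t : has_inf (Q t).
  by split; [exists 1|exists 0 => x [] /andP[]].
pose h t := inf (Q t).
have hle t x : Q t x -> h t <= x by move=> Qx; apply: ge_inf => //; case: (Qlb t).
have h0 t : 0 <= h t.
  by apply: lb_le_inf; [exists 1|move=> x [] /andP[]].
have hlt t x : x < 1 -> h t <= x -> (t%:E <= P `]-oo, x]%classic)%E.
  move=> x1 hx; apply: prob_itvNy_right => y xy.
  have [z Qz zy] : exists2 z, Q t z & z < Num.min y 1.
    by apply: (@inf_lt _ _ (Num.min y 1)); [by exists 1|]; rewrite lt_min !(le_lt_trans hx).
  case: Qz => _ [z1|]; first by move: zy; rewrite z1 lt_min ltxx andbF.
  move/le_trans; apply; apply: le_measure; rewrite ?inE//.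
  by apply: subset_itvl; rewrite bnd_simp ltW// (lt_le_trans zy)// ge_min lexx.
have hnd : {homo h : s t / s <= t}.
  move=> s t st; apply: lb_le_inf; first by exists 1.
  move=> x [x01 [x1|tx]]; apply: hle; split => //; first by left.
  by right; rewrite (le_trans _ tx)// lee_fin.
have mh : measurable_fun setT h by apply: nondecreasing_measurable.
have h01 t : 0 <= h t <= 1 by rewrite h0 hle.
exists h; split => // f bf.
have PN (A : set R) : measurable A -> A `<=` ~` `[0, 1] -> P A = 0%E.
  move=> mA sA; apply/eqP; rewrite eq_le measure_ge0 andbT -P01.
  by rewrite le_measure ?inE//; exact: measurableC.
(* Both measures are compared on the half-lines ]x, +oo[, where the equivalence of [h t <= x] and t
   <= P(]-oo, x]) for 0 <= x < 1 settles the matter. *)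
have PE (A : set R) : measurable A -> P A = pushprob unif01 mh A.
  have := @measure_unique _ R (measurableTypeR R) (@RGenOInfty.G R)
    (fun n => `](- n%:R), +oo[%classic) _ _ _ _ P (pushprob unif01 mh).
  move=> H; apply: H.
  - exact: RGenOInfty.measurableE.
  - move=> _ _ [x ->] [y ->]; exists (Num.max x y).
    by apply/seteqP; split => z /=; rewrite !in_itv/= !andbT gt_max => /andP.
  - by move=> i; exists (- i%:R).
  - rewrite -subTset => x _; exists (Num.truncn `|x|).+1 => //=.
    rewrite in_itv/= andbT ltrNl (le_lt_trans (ler_norm _))// normrN.
    exact: Num.Theory.truncnS_gt.
  - move=> _ [x ->].
    change (P `]x, +oo[%classic = unif01 (h @^-1` `]x, +oo[%classic)).
    have [x0|x0] := ltP x 0.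
      rewrite (_ : _ @^-1` _ = setT); last first.
        apply/seteqP; split => // t _ /=; rewrite in_itv/= andbT.
        by rewrite (lt_le_trans x0).
      rewrite probability_setT -setCitvl probability_setC// PN ?sube0//.
      move=> y /=; rewrite !in_itv/= => yx /andP[y0 _].
      by have := le_lt_trans (le_trans y0 yx) x0; rewrite ltxx.
    have [x1|x1] := leP 1 x.
      rewrite PN//; last first.
        move=> y /=; rewrite !in_itv/= andbT => xy /andP[_ y1].
        by have := le_lt_trans (le_trans y1 x1) xy; rewrite ltxx.
      rewrite (_ : _ @^-1` _ = set0) ?measure0//.
      apply/seteqP; split => // t /=; rewrite in_itv/= andbT.
      by rewrite ltNge; case/andP: (h01 t) => _ /le_trans ->.
    rewrite -setCitvl probability_setC//.
    set Fx := P `]-oo, x]%classic.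
    have FxE : Fx = (fine Fx)%:E.
      by rewrite fineK// fin_num_measure//; exact: measurable_itv.
    have Fx0 : 0 <= fine Fx by rewrite fine_ge0// /Fx measure_ge0.
    have Fx1 : fine Fx <= 1.
      by rewrite -lee_fin -FxE; apply: probability_le1; exact: measurable_itv.
    rewrite unif01E; last first.
      by rewrite -[X in measurable X]setTI; apply: mh => //; exact: measurableC.
    rewrite (_ : _ `&` _ = `](fine Fx), 1]%classic); last first.
      apply/seteqP; split => t /=; rewrite !in_itv/=.
        move=> [/negP]; rewrite -ltNge => hx /andP[t0 t1].
        rewrite t1 andbT ltNge; apply/negP => tF.
        move: hx; rewrite ltNge => /negP; apply; apply: hle; split.
          by rewrite x0 ltW.
        by right; rewrite -/Fx FxE lee_fin.
      move=> /andP[tF t1]; split; last by rewrite (le_trans Fx0 (ltW tF)).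
      move=> hx; move: tF; rewrite ltNge => /negP; apply.
      by rewrite -lee_fin -FxE; exact: hlt.
    rewrite lebesgue_measure_itv/= lte_fin [in LHS]FxE.
    case: ltgtP Fx1 => // F1 _.
    by rewrite -EFinB F1 subrr.
  - move=> k; apply: (le_lt_trans (probability_le1 P _)); last exact: ltry.
    exact: (measurable_itv `](- k%:R), +oo[).
rewrite -(bint_push _ mh bf) /Rintegral; congr fine.
by apply: eq_measure_integral => A mA _; exact: PE.
Qed.

End quantile.

(** * Prokhorov's theorem on the unit interval *)

Section prokhorov.
Variable R : realType.

(** A weak Helly theorem: Tychonoff gives a cluster point in [0,1]^R. Closeness on one finite set at
    a time is enough, as monotone functions are controlled by their values on a grid. *)
Lemma monotone_cluster (h : nat -> R -> R) :
  (forall n, {homo h n : s t / s <= t}) -> (forall n t, 0 <= h n t <= 1) ->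
  exists G : R -> R, [/\ {homo G : s t / s <= t}, forall t, 0 <= G t <= 1 &
    forall (s : seq R) (e : R) N, 0 < e -> exists2 n, (N <= n)%N &
      forall t, t \in s -> `|h n t - G t| < e].
Proof.
move=> hnd h01.
pose T : topologicalType := prod_topology (fun _ : R => R).
have cA : @compact T
    [set f | forall i, `[0, 1]%classic (f i)].
  exact: (@tychonoff R (fun _ => R) (fun _ => `[0, 1]%classic)
    (fun _ => @segment_compact R 0 1)).
have hA : (h @ \oo) [set f | forall i, `[0, 1]%classic (f i)].
  by exists 0%N => // n _ t /=; rewrite in_itv/=.
have [G [G01 clG]] := cA (h @ \oo) (fmap_proper_filter h _) hA.
have near_G (s : seq R) (e : R) : 0 < e ->
    @nbhs T T G [set f | forall t, t \in s -> `|f t - G t| < e].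
  have FG : Filter (@nbhs T T G) := nbhs_filter (G : T).
  move=> e0; elim: s => [|t s ih].
    by apply: (@filterS T _ FG setT); [move=> f _ t|exact: (@filterT T _ FG)].
  have nt : @nbhs T T G [set f | `|G t - f t| < e].
    have := @proj_continuous R (fun _ => R) t G (ball (G t) e).
    by apply; exact: nbhsx_ballx.
  apply: (@filterS2 T _ FG _ _ _ _ ih nt) => f fs ft u; rewrite inE => /predU1P[->|/fs//].
  by rewrite distrC.
have hG (s : seq R) (e : R) N : 0 < e -> exists2 n, (N <= n)%N &
    forall t, t \in s -> `|h n t - G t| < e.
  move=> e0.
  have hN : (h @ \oo) [set f | exists2 n, (N <= n)%N & f = h n].
    by exists N => // n /= Nn; exists n.
  have [f [[n Nn ->] Bf]] := clG _ _ hN (near_G s e e0).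
  by exists n.
exists G; split => //.
- move=> s t st; apply/ler_addgt0Pr => e e0.
  have [n _ H] := hG [:: s; t] (e / 2) 0%N (divr_gt0 e0 (ltr0Sn _ _)).
  have := H s; have := H t; rewrite !inE !eqxx orbT => /(_ isT) + /(_ isT).
  have := hnd n _ _ st; rewrite !ltr_norml; lra.
Qed.

Lemma lip_continuous (f : R -> R) L : lip L f -> continuous f.
Proof.
move=> fL x; apply/cvgrPdist_le => /= e e0.
near=> y; rewrite (le_trans (fL _ _))//.
have L1 : 0 < `|L| + 1 by rewrite ltr_pwDr.
rewrite (@le_trans _ _ ((`|L| + 1) * `|x - y|))//.
  by rewrite ler_wpM2r// (le_trans (ler_norm L))// lerDl.
rewrite -ler_pdivlMl// mulrC.
near: y; apply: cvgr_dist_le; [exact: cvg_id|exact: divr_gt0].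
Unshelve. all: by end_near. Qed.

Lemma bmeas_lip (f : R -> R) L : bounded_abs f ->
  lip L f -> bmeas f.
Proof. by move=> bf /lip_continuous cf; exact: bmeas_continuous. Qed.

Lemma bmeas_homo01 (h : R -> R) : {homo h : s t / s <= t} ->
  (forall t, 0 <= h t <= 1) -> bmeas h.
Proof.
move=> hnd h01; split; first exact: nondecreasing_measurable.
by exists 1 => x; have := h01 x; rewrite ler_norml; lra.
Qed.

Lemma unif01_step (N i : nat) : (i < N.+1)%N ->
  unif01 R `[i%:R / N.+1%:R, i.+1%:R / N.+1%:R[%classic = (N.+1%:R^-1)%:E.
Proof.
move=> iN; rewrite unif01E; last exact: measurable_itv.
rewrite setIidl; last first.
  move=> t /=; rewrite !in_itv/= => /andP[it ti].
  rewrite (le_trans _ it)//= (le_trans (ltW ti))//.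
  by rewrite ler_pdivrMr// mul1r ler_nat.
rewrite lebesgue_measure_itv/= lte_fin ltr_pM2r ?invr_gt0// ltr_nat ltnSn.
by rewrite -EFinB -mulrBl -natrB// subSnn mul1r.
Qed.

Lemma squeeze_dist (a b c1 c2 d1 d2 m : R) : c1 <= a -> a <= c2 -> d1 <= b ->
  b <= d2 -> `|d1 - c1| < m -> `|d2 - c2| < m -> `|b - a| <= c2 - c1 + m.
Proof. rewrite !ltr_norml ler_norml; lra. Qed.

(* On each cell of the partition [i/N, (i+1)/N[ both functions lie between the
   values of [g] at the end points (up to 1/N), and these gaps telescope. *)
Lemma homo01_dist (h g : R -> R) (N : nat) :
  {homo h : s t / s <= t} -> (forall t, 0 <= h t <= 1) ->
  {homo g : s t / s <= t} -> (forall t, 0 <= g t <= 1) ->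
  (forall i, (i <= N.+1)%N ->
    `|h (i%:R / N.+1%:R) - g (i%:R / N.+1%:R)| < (N.+1%:R^-1 : R)) ->
  \int[unif01 R]_t `|h t - g t| <= 2 / N.+1%:R.
Proof.
move=> hnd h01 gnd g01 hg; set M : R := N.+1%:R.
pose c (i : nat) := g (i.+1%:R / M) - g (i%:R / M) + M^-1.
pose I (i : nat) : set R := `[i%:R / M, i.+1%:R / M[%classic.
have M0 : 0 < M by rewrite ltr0n.
have c0 i : 0 <= c i.
  rewrite addr_ge0 ?invr_ge0 ?ler0n// subr_ge0; apply: gnd.
  by rewrite ler_wpM2r ?invr_ge0 ?ler0n// ler_nat.
have mI i : measurable (I i) by exact: measurable_itv.
(* Outside [0,1[ the crude bound 1 on the integrand suffices, since this set is null for the uniform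
   law. *)
have mJ : measurable (~` `[0, 1[%classic : set R) by apply: measurableC.
have bI i : bmeas (fun t : R => c i * \1_(I i) t).
  exact/bmeasZ/bmeas_indic.
have bS : bmeas (fun t : R => \sum_(i < N.+1) c i * \1_(I i) t).
  by apply: bmeas_sum => i _.
have bJ := bmeas_indic mJ.
have bhg : bmeas (fun t => `|h t - g t|).
  by apply: bmeas_norm; apply: bmeasB; exact: bmeas_homo01.
apply: (@le_trans _ _ (\int[unif01 R]_t
    (\sum_(i < N.+1) c i * \1_(I i) t + \1_(~` `[0, 1[%classic) t))).
  apply: ler_bint => //; first exact: bmeasD.
  move=> t; have [t01|t01] := boolP (t \in `[0, 1[%classic); last first.
    rewrite (@le_trans _ _ 1)//.
      by have := h01 t; have := g01 t; rewrite ler_norml; lra.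
    rewrite [X in _ <= _ + X]indicE in_setC t01 lerDr sumr_ge0// => i _.
    by rewrite mulr_ge0// indicE.
  rewrite [X in _ <= _ + X]indicE in_setC t01 addr0.
  move: t01; rewrite inE/= in_itv/= => /andP[t0 t1].
  pose i := Num.truncn (t * M).
  have /andP[it ti] : i%:R <= t * M < i.+1%:R.
    by apply: truncn_itv; rewrite mulr_ge0// ltW.
  have iN : (i < N.+1)%N.
    rewrite -(ltr_nat R) (le_lt_trans it)// -/M -[ltRHS]mul1r.
    by rewrite ltr_pM2r.
  rewrite (bigD1 (Ordinal iN))//= indicE mem_set; last first.
    by rewrite /I/= in_itv/= ler_pdivrMr// it/= ltr_pdivlMr.
  rewrite mulr1 (@le_trans _ _ (c i))//; last first.
    by rewrite lerDl sumr_ge0// => j _; rewrite mulr_ge0// indicE.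
  have le1 : i%:R / M <= t by rewrite ler_pdivrMr.
  have le2 : t <= i.+1%:R / M by rewrite ler_pdivlMr// ltW.
  exact: (squeeze_dist (gnd _ _ le1) (gnd _ _ le2) (hnd _ _ le1) (hnd _ _ le2)
    (hg i (ltnW iN)) (hg i.+1 iN)).
rewrite bintD// bint_sum//.
rewrite (eq_bigr (fun i : 'I_N.+1 => c i * M^-1)); last first.
  move=> i _; rewrite bintZ; last exact: bmeas_indic.
  by rewrite bint_indic// /I unif01_step.
rewrite bint_indic// unif01E// (_ : _ `&` _ = [set 1]); last first.
  apply/seteqP; split => t /=; rewrite !in_itv/=.
    move=> [/negP + /andP[t0 t1]]; rewrite t0 -leNgt => t1'.
    by apply/eqP; rewrite eq_le t1.
  by move=> ->; rewrite ltxx ler01 lexx; split => //; rewrite andbF.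
rewrite lebesgue_measure_set1 addr0.
rewrite /= -mulr_suml ler_pM2r ?invr_gt0//.
rewrite big_split/= -(big_mkord xpredT (fun i => g (i.+1%:R / M) - g (i%:R / M))).
rewrite telescope_sumr// sumr_const card_ord -[X in _ + X]mulr_natr.
rewrite mulVf ?gt_eqF//.
have := g01 (N.+1%:R / M); have := g01 (0%:R / M); lra.
Qed.

(** The rate is explicit and uniform over Lipschitz functions, so later passages to the limit are
    plain estimates. The selection [phi] is only known to satisfy [k <= phi k]. *)
Lemma prokhorov01 (mu : nat -> prob R) :
  (forall n, mu n (~` `[0, 1]%classic) = 0%E) ->
  exists (nu : prob R) (phi : nat -> nat), (forall k, (k <= phi k)%N) /\
    forall f L, bounded_abs f ->
      lip L f -> 0 <= L ->
      forall k, `|\int[mu (phi k)]_x f x - \int[nu]_x f x| <= L * (2 / k.+1%:R).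
Proof.
move=> mu01.
have /choice[h hP] := fun n => quantile (mu01 n).
have [G [Gnd G01 hG]] := monotone_cluster
  (fun n => let: And3 H _ _ := hP n in H) (fun n => let: And3 _ H _ := hP n in H).
have bG : bmeas G by exact: bmeas_homo01.
have mG : measurable_fun setT G by case: bG.
pose pts k : seq R := [seq i%:R / k.+1%:R | i <- iota 0 k.+2].
have pos k : 0 < k.+1%:R^-1 :> R by rewrite invr_gt0.
have /choice[phi phiP] k : exists n, (k <= n)%N /\
    forall t, t \in pts k -> `|h n t - G t| < (k.+1%:R^-1 : R).
  by have [n kn H] := hG (pts k) _ k (pos k); exists n.
exists (pushprob (unif01 R) mG), phi; split => [k|f L bf fL L0 k].
  by case: (phiP k).
have [kphi hGk] := phiP k.
have bmf := bmeas_lip bf fL.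
have [hnd h01 hI] := hP (phi k).
have bh := bmeas_homo01 hnd h01.
rewrite hI// bint_push//.
have bfh : bmeas (fun x => f (h (phi k) x)) by apply: (bmeas_comp bmf); case: bh.
have bfG : bmeas (fun x => f (G x)) by exact: (bmeas_comp bmf).
rewrite -bintB//.
apply: le_trans (bint_norm _ (bmeasB bfh bfG)) _.
have bhG := bmeas_norm (bmeasB bh bG).
apply: (@le_trans _ _ (\int[unif01 R]_x (L * `|h (phi k) x - G x|))).
  by apply: ler_bint => //; [exact/bmeas_norm/bmeasB|exact: bmeasZ].
rewrite bintZ// ler_wpM2l//; apply: homo01_dist => // i ik.
apply: hGk; apply/mapP; exists i => //; by rewrite mem_iota add0n ltnS.
Qed.

End prokhorov.

(** * Supports, and closed sets under weak limits *)

Section closed_supports.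
Variable R : realType.
Implicit Types (P : prob R) (A C : set R).

(** Lindelof argument: null balls with rational centre and radius 1/(n+1) cover the complement, and
    there are countably many of them. *)
Lemma prob_locally_null P C :
  (forall x, ~ C x -> exists2 r : R, 0 < r & P (ball x r) = 0%E) ->
  measurable C -> P (~` C) = 0%E.
Proof.
move=> loc mC.
pose N (k : nat) : set R := if unpickle k is Some (q, n) then
  (if `[< P (ball (ratr q : R) n.+1%:R^-1) = 0%E >] then
    ball (ratr q : R) n.+1%:R^-1 else set0) else set0.
have mN k : measurable (N k).
  rewrite /N; case: unpickle => [[q n]|//].
  by case: ifP => // _; exact: measurable_ball.
have N0 k : P (N k) = 0%E.
  rewrite /N; case: unpickle => [[q n]|]; last exact: measure0.
  by case: ifPn => [/asboolP//|_]; exact: measure0.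
have UN : P.-negligible (\bigcup_k N k).
  by apply: negligible_bigcup => k; exists (N k); split; [exact: mN|exact: N0|by []].
have [A [mA PA sA]] := UN.
apply/eqP; rewrite eq_le measure_ge0 andbT -PA.
apply: le_measure; rewrite ?inE//; first exact: measurableC.
move=> x Cx; apply: sA; have [r r0 Pr] := loc x Cx.
pose n := Num.truncn (2 / r).
have n0 : 0 < n.+1%:R^-1 :> R by rewrite invr_gt0.
have nr : n.+1%:R^-1 < r / 2.
  by rewrite -[ltRHS]invrK ltf_pV2 ?posrE ?invr_gt0 ?divr_gt0// invf_div
     Num.Theory.truncnS_gt.
have [q] : exists q : rat, ratr q \in `](x - n.+1%:R^-1), (x + n.+1%:R^-1)[.
  by apply: rat_in_itvoo; rewrite ltrD2l; rewrite -subr_gt0 opprK addr_gt0.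
rewrite in_itv/= => /andP[q1 q2].
have [k uk] : exists k, unpickle k = Some (q, n).
  by exists (pickle (q, n)); exact: pickleK.
exists k; [by []|rewrite /N uk].
have Bx : ball (ratr q : R) n.+1%:R^-1 x.
  by rewrite /ball/= ltr_distl q1 q2.
rewrite ifT//; apply/asboolP/eqP; rewrite eq_le measure_ge0 andbT -Pr.
apply: le_measure; rewrite ?inE; [exact: measurable_ball|exact: measurable_ball|].
move=> y qy.
have xq : ball x (r / 2) (ratr q : R) by exact/(le_ball (ltW nr))/ball_sym.
have qy' : ball (ratr q : R) (r / 2) y by exact: (le_ball (ltW nr)).
by have := ball_triangle xq qy'; rewrite -splitr.
Qed.

Lemma support_sub P A : closed A ->
  (measure_support P `<=` A <-> P (~` A) = 0%E).
Proof.
move=> cA; have mA : measurable A by exact: closed_measurable.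
split=> [sA|PA x sx]; last first.
  apply: contrapT => nA.
  have := sx (~` A) (closed_openC cA) nA; rewrite PA ltxx => //.
apply: prob_locally_null => // x nA.
have [U [oU Ux PU]] : exists U : set R, [/\ open U, U x & P U = 0%E].
  apply: contrapT => nU; apply: nA; apply: sA => U oU Ux.
  rewrite lt0e measure_ge0 andbT; apply/eqP => PU; apply: nU; by exists U.
have /nbhs_ballP[r /= r0 rU] : nbhs x U by apply: open_nbhs_nbhs.
exists r => //; apply/eqP; rewrite eq_le measure_ge0 andbT -PU le_measure ?inE//.
- exact: measurable_ball.
- exact: open_measurable.
Qed.

(** Lipschitz substitute for the indicator of a ball: it is positive exactly on the ball of centre a
    and radius r. *)
Definition bump (a r x : R) : R := Num.max 0 (r - `|x - a|).

Lemma bump_bounded a r x : `|bump a r x| <= Num.max 0 r.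
Proof.
rewrite ger0_norm /bump; last by rewrite le_max lexx.
by rewrite ge_max !le_max lexx/= gerBl normr_ge0 orbT.
Qed.


Lemma bump_lip a r : lip 1 (bump a r).
Proof.
move=> x y.
have h1 : `|x - a| <= `|x - y| + `|y - a|.
  by rewrite (le_trans _ (ler_normD _ _))// addrA subrK.
have h2 : `|y - a| <= `|x - y| + `|x - a|.
  by rewrite (distrC x y) (le_trans _ (ler_normD _ _))// addrA subrK.
have h3 := normr_ge0 (x - y); rewrite /bump mul1r.
by case: (leP 0 (r - `|x - a|)); case: (leP 0 (r - `|y - a|)) => *;
  rewrite ler_norml; apply/andP; split; lra.
Qed.

Lemma bump_gt0 a r x : (0 < bump a r x) = (`|x - a| < r).
Proof. by rewrite /bump lt_max ltxx/= subr_gt0. Qed.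

Lemma bump_ge0 a r x : 0 <= bump a r x.
Proof. by rewrite /bump le_max lexx. Qed.

(** Tested on tents living off C: their integrals against [mu k] vanish eventually, hence so does
    the limit integral, and every point off C has a null ball. *)
Lemma closed_weak_limit (mu : nat -> prob R) (nu : prob R) C :
  closed C -> (exists N, forall n, (N <= n)%N -> mu n (~` C) = 0%E) ->
  (forall f L, bounded_abs f ->
      lip L f -> 0 <= L ->
      forall k, `|\int[mu k]_x f x - \int[nu]_x f x| <= L * (2 / k.+1%:R)) ->
  nu (~` C) = 0%E.
Proof.
move=> cC [N muC] cv.
have mC : measurable C by exact: closed_measurable.
apply: prob_locally_null => // a Ca.
have /nbhs_ballP[r /= r0 rC] : nbhs a (~` C).
  by apply: open_nbhs_nbhs; split => //; exact: closed_openC.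
exists r => //.
have bb : bounded_abs (bump a r).
  by exists (Num.max 0 r) => x; exact: bump_bounded.
have bm : bmeas (bump a r) by exact: (bmeas_lip bb (bump_lip a r)).
suff I0 : \int[nu]_x bump a r x = 0.
  have := bint_eq0 bm (@bump_ge0 a r) I0.
  rewrite (_ : [set x | _] = ball a r)//; apply/seteqP; split=> x /=.
    by rewrite bump_gt0 /ball/= distrC.
  by rewrite /ball/= bump_gt0 distrC.
apply/eqP; rewrite -normr_eq0 eq_le normr_ge0 andbT.
apply/ler_addgt0Pr => e e0; rewrite add0r.
pose k := (N + Num.truncn (2 / e))%N.
have -> : \int[nu]_x bump a r x = - (\int[mu k]_x bump a r x - \int[nu]_x bump a r x).
  rewrite (_ : \int[mu k]_x bump a r x = 0) ?sub0r ?opprK//.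
  rewrite (@ae_eq_bint _ _ _ (fun=> 0)) ?bint_cst//; first exact: bmeas_cst.
  exists (~` C); split; [exact: measurableC|by apply: muC; exact: leq_addr|].
  move=> x; rewrite /setC/= => nnC; have {nnC}Cx : C x := contrapT nnC.
  apply/eqP; rewrite eq_le bump_ge0 andbT leNgt bump_gt0; apply/negP => xa.
  have bx : ball a r x by rewrite /ball/= distrC.
  exact: (rC _ bx Cx).
rewrite normrN (le_trans (cv _ _ bb (bump_lip a r) ler01 k))// mul1r.
rewrite ler_pdivrMr// mulrC -ler_pdivrMr// ltW//.
by rewrite (lt_le_trans (Num.Theory.truncnS_gt _))// ler_nat ltnS leq_addl.
Qed.

End closed_supports.

Section uniform_on_points.
Variable R : realType.

Lemma unif_points (n : nat) (x : nat -> R) : exists P : prob R,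
  forall f, bmeas f -> \int[P]_y f y = (\sum_(i < n.+1) f (x i)) / n.+1%:R.
Proof.
pose D (i : nat) : prob R := @dirac _ (measurableTypeR R) (x i) R.
pose m : {measure set (measurableTypeR R) -> \bar R} := msum D n.+1.
pose P : prob R := mnormalize m (D 0%N).
have mT : m setT = n.+1%:R%:E.
  have -> : m setT = (\sum_(i < n.+1) D i setT)%E by [].
  rewrite (eq_bigr (fun=> 1%E)); last first.
    by move=> i _; exact: probability_setT.
  by rewrite sumEFin sumr_const card_ord.
have P_E A : measurable A -> P A = mscale (n.+1%:R^-1)%:nng m A.
  move=> mA; rewrite /P/= /mnormalize/= mT.
  case: ifPn => [/orP[/eqP H|/eqP//]|_]; last by rewrite /mscale/= muleC.
  by case: H => /eqP; rewrite pnatr_eq0.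
have n0 : n.+1%:R != 0 :> R by rewrite pnatr_eq0.
(* The formula for sums of measures is for nonnegative functions; a bounded f is then shifted by its
   bound. *)
have pos (f : R -> R) : bmeas f -> (forall y, 0 <= f y) ->
    \int[P]_y f y = (\sum_(i < n.+1) f (x i)) / n.+1%:R.
  move=> bf f0; have mf : measurable_fun setT (EFin \o f).
    by apply/measurable_EFinP; case: bf.
  rewrite /Rintegral (eq_measure_integral (mscale (n.+1%:R^-1)%:nng m)); last first.
    by move=> A mA _; exact: P_E.
  rewrite ge0_integral_mscale//; last by move=> y _; rewrite lee_fin.
  rewrite ge0_integral_measure_sum//; last by move=> y _; rewrite lee_fin.
  rewrite (eq_bigr (fun i : 'I_n.+1 => (f (x i))%:E)); last first.
    by move=> i _; rewrite integral_dirac// diracT mul1e.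
  by rewrite sumEFin -EFinM/= mulrC.
exists P => f bf; have [C bC] := bf.2.
have bfC : bmeas (fun y => f y + C) by apply: bmeasD => //; exact: bmeas_cst.
have := pos (fun y => f y + C) bfC.
rewrite bintD ?bint_cst//; last exact: bmeas_cst.
rewrite big_split/= sumr_const card_ord mulrDl -[C *+ _]mulr_natr mulfK// => H.
apply: (addIr C); apply: H => y.
by have := bC y; rewrite ler_norml => /andP[+ _]; rewrite -subr_ge0 opprK addrC.
Qed.

End uniform_on_points.

(** * Fourier decay *)

Section fourier_decay.
Variable R : realType.
Implicit Types (P : prob R) (A : set R) (s c : R).

(** The real and imaginary parts are bounded separately to stay within real integrals; compared with
    the modulus this changes c by a factor at most 2, which no dimension sees. *)
Definition decay P s c := forall xi : R, xi != 0 ->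
  `|\int[P]_x cos (xi * x)| <= c * `|xi| `^ (- s / 2) /\
  `|\int[P]_x sin (xi * x)| <= c * `|xi| `^ (- s / 2).

Definition has_decay A s c := exists P, P (~` A) = 0%E /\ decay P s c.

Definition fourier_decay A s := exists2 c : R, 0 < c & has_decay A s c.

Lemma cos_lipZ (xi : R) : lip `|xi| (fun x => cos (xi * x)).
Proof.
by move=> x y; rewrite (le_trans (cos_lip _ _))// -mulrBr normrM.
Qed.

Lemma sin_lipZ (xi : R) : lip `|xi| (fun x => sin (xi * x)).
Proof.
by move=> x y; rewrite (le_trans (sin_lip _ _))// -mulrBr normrM.
Qed.

Lemma bounded_cos (xi : R) : bounded_abs (fun x => cos (xi * x)).
Proof. by exists 1 => x; exact: cos_max. Qed.

Lemma bounded_sin (xi : R) : bounded_abs (fun x => sin (xi * x)).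
Proof. by exists 1 => x; exact: sin_max. Qed.

Lemma bmeas_cosZ (xi : R) : bmeas (fun x => cos (xi * x)).
Proof. exact: bmeas_lip (bounded_cos xi) (cos_lipZ xi). Qed.

Lemma bmeas_sinZ (xi : R) : bmeas (fun x => sin (xi * x)).
Proof. exact: bmeas_lip (bounded_sin xi) (sin_lipZ xi). Qed.

(** For |xi| >= 1 the power is monotone in the exponent; for |xi| < 1 the integral is bounded by 1.
    The constant c + 1 covers both ranges. *)
Lemma fourier_decay_le A s s' : 0 <= s' -> s' <= s ->
  fourier_decay A s -> fourier_decay A s'.
Proof.
move=> s0 ss [c c0 [P [PA Pc]]]; exists (c + 1); first by rewrite addr_gt0.
exists P; split => // xi xi0.
have xi_gt0 : 0 < `|xi| by rewrite normr_gt0.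
have bnd (f : R -> R) : (forall x, `|f x| <= 1) -> bmeas f ->
    `|\int[P]_x f x| <= c * `|xi| `^ (- s / 2) ->
    `|\int[P]_x f x| <= (c + 1) * `|xi| `^ (- s' / 2).
  move=> f1 bf fs.
  have [x1|x1] := leP 1 `|xi|.
    apply: (le_trans fs); apply: ler_pM; rewrite ?powR_ge0 ?(ltW c0) ?lerDl//.
    by apply: ler_powR => //; rewrite ler_pM2r ?invr_gt0// lerN2.
  rewrite (le_trans (bint_bound P bf f1))// (@le_trans _ _ (`|xi| `^ (- s' / 2)))//.
    rewrite -(powRr0 `|xi|); apply: ger_powR; first by rewrite xi_gt0 ltW.
    by rewrite mulNr oppr_le0 divr_ge0.
  by rewrite ler_peMl ?powR_ge0// lerDr ltW.
have [h1 h2] := Pc xi xi0; split; apply: bnd => //.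
- by move=> x; exact: cos_max.
- exact: bmeas_cosZ.
- by move=> x; exact: sin_max.
- exact: bmeas_sinZ.
Qed.

Lemma has_decayW A s c c' : c <= c' -> has_decay A s c -> has_decay A s c'.
Proof.
move=> cc [P [PA Pc]]; exists P; split => // xi xi0.
by have [h1 h2] := Pc xi xi0; split; [apply: le_trans h1 _|apply: le_trans h2 _];
  rewrite ler_wpM2r// powR_ge0.
Qed.

(** Integer constants turn the existence of c into a countable union. *)
Lemma fourier_decayP A s :
  fourier_decay A s <-> exists n : nat, has_decay A s n.+1%:R.
Proof.
split=> [[c c0 Ac]|[n An]]; last by exists n.+1%:R => //; rewrite ltr0n.
exists (Num.truncn c); apply: has_decayW Ac.
exact/ltW/Num.Theory.truncnS_gt.
Qed.

(** The error has to vanish only for each fixed frequency: this admits finitely supported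
    approximations, whose transforms do not decay at infinity. *)
Lemma weak_limit_decay (mu : nat -> prob R) (nu : prob R) (phi : nat -> nat) s c
    (err : nat -> R -> R) :
  (forall f L, bounded_abs f -> lip L f -> 0 <= L ->
    forall k, `|\int[mu (phi k)]_x f x - \int[nu]_x f x| <= L * (2 / k.+1%:R)) ->
  (forall xi e : R, 0 < e -> exists N, forall n, (N <= n)%N -> err n xi <= e) ->
  (forall k, (k <= phi k)%N) ->
  (forall n xi, xi != 0 ->
     `|\int[mu n]_x cos (xi * x)| <= c * `|xi| `^ (- s / 2) + err n xi /\
     `|\int[mu n]_x sin (xi * x)| <= c * `|xi| `^ (- s / 2) + err n xi) ->
  decay nu s c.
Proof.
move=> cv errP phik dec xi xi0.
suff lim (f : R -> R) : bounded_abs f -> lip `|xi| f ->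
    (forall n, `|\int[mu n]_x f x| <= c * `|xi| `^ (- s / 2) + err n xi) ->
    `|\int[nu]_x f x| <= c * `|xi| `^ (- s / 2).
  split; apply: lim.
  - exact: bounded_cos.
  - exact: cos_lipZ.
  - by move=> n; case: (dec n xi xi0).
  - exact: bounded_sin.
  - exact: sin_lipZ.
  - by move=> n; case: (dec n xi xi0).
move=> bf lf fn; apply/ler_addgt0Pr => e e0.
have e2 : 0 < e / 2 by rewrite divr_gt0.
have [N HN] := errP xi (e / 2) e2.
pose k := maxn N (Num.truncn (`|xi| * 2 / (e / 2))).
have h1 := fn (phi k).
have h2 := HN (phi k) (leq_trans (leq_maxl _ _) (phik k)).
have h3 : `|xi| * (2 / k.+1%:R) <= e / 2.
  rewrite mulrA ler_pdivrMr// -ler_pdivrMl// mulrC ltW//.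
  by rewrite (lt_le_trans (Num.Theory.truncnS_gt _))// ler_nat ltnS leq_maxr.
have h4 := cv f `|xi| bf lf (normr_ge0 _) k.
rewrite -[X in `|X|](subrK (\int[mu (phi k)]_x f x)).
rewrite (le_trans (ler_normD _ _))// distrC.
apply: le_trans (lerD h4 h1) _; apply: le_trans (lerD h3 (lerD (lexx _) h2)) _.
by rewrite addrCA -splitr.
Qed.

(** Only one-sided closeness of B to A enters, which matches the Vietoris open sets of all compact
    sets contained in a given open set. *)
Lemma has_decay_closed A s c : closed A ->
  (forall n : nat, exists B, [/\ has_decay B s c, closed B, B `<=` `[0, 1]%classic &
    B `<=` [set x | exists2 a, A a & `|x - a| < (n.+1%:R^-1 : R)]]) ->
  has_decay A s c.
Proof.
move=> cA /choice[B HB].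
have /choice[mu muP] n : exists P, P (~` B n) = 0%E /\ decay P s c.
  by have [[P HP] _ _ _] := HB n; exists P.
have mu0 n (C : set R) : measurable C -> B n `<=` C -> mu n (~` C) = 0%E.
  move=> mC BC; have [mB _] := muP n; have [_ cB _ _] := HB n.
  apply/eqP; rewrite eq_le measure_ge0 andbT -mB le_measure ?inE//.
  - exact: measurableC.
  - by apply: measurableC; exact: closed_measurable.
  - exact: subsetC.
have [|nu [phi [phik cv]]] := @prokhorov01 R mu.
  by move=> n; have [_ _ B01 _] := HB n; exact: mu0.
exists nu; split; last first.
  apply: (weak_limit_decay cv _ phik (err := fun _ _ => 0)).
    by move=> xi e e0; exists 0%N => n _; exact: ltW.
  by move=> n xi xi0; rewrite addr0; exact: (muP n).2.
apply: prob_locally_null; last exact: closed_measurable.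
move=> x nA.
have /nbhs_ballP[r /= r0 rA] : nbhs x (~` A).
  by apply: open_nbhs_nbhs; split => //; exact: closed_openC.
have r2 : 0 < r / 2 by rewrite divr_gt0.
exists (r / 2) => //.
rewrite -[ball _ _]setCK.
apply: (closed_weak_limit (mu := mu \o phi)) cv.
  by apply: open_closedC; exact: ball_open.
exists (Num.truncn (2 / r)) => n Nn; apply: mu0.
  by apply: measurableC; exact: measurable_ball.
move=> y By xy.
have [_ _ _ /(_ y By)[a Aa ya]] := HB (phi n).
apply: (rA a) => //; rewrite (splitr r).
have ya' : ball y (r / 2) a.
  rewrite /ball/= (lt_le_trans ya)// invf_ple ?posrE// invf_div.
  rewrite ltW// (lt_le_trans (Num.Theory.truncnS_gt _))// ler_nat ltnS.
  exact: (leq_trans Nn (phik n)).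
exact: ball_triangle xy ya'.
Qed.

End fourier_decay.

(** * Elementary growth estimates *)

Section growth.
Variable R : realType.

(** By Bernoulli's inequality. It absorbs polynomial losses in the scale number into an arbitrarily
    small change of exponent. *)
Lemma linear_le_geometric (z : R) : 1 < z ->
  exists2 C : R, 0 < C & forall k : nat, k.+1%:R <= C * z ^+ k.
Proof.
move=> z1; have z0 : 0 < z - 1 by rewrite subr_gt0.
have bern k : 1 + k%:R * (z - 1) <= z ^+ k.
  elim: k => [|k ih]; first by rewrite mul0r addr0 expr0.
  rewrite exprS (@le_trans _ _ (z * (1 + k%:R * (z - 1))))//.
    rewrite -subr_ge0.
    have -> : z * (1 + k%:R * (z - 1)) - (1 + k.+1%:R * (z - 1)) =
      k%:R * (z - 1) ^+ 2 by rewrite -natr1; ring.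
    by rewrite mulr_ge0// exprn_ge0// ltW.
  by rewrite ler_pM2l// (lt_trans _ z1).
exists (1 + (z - 1)^-1); first by rewrite addr_gt0// invr_gt0.
move=> k; apply: (@le_trans _ _ ((1 + (z - 1)^-1) * (1 + k%:R * (z - 1)))).
  have -> : (1 + (z - 1)^-1) * (1 + k%:R * (z - 1)) =
      1 + k%:R + k%:R * (z - 1) + (z - 1)^-1 by field; rewrite gt_eqF.
  have : 0 <= (z - 1)^-1 by rewrite invr_ge0 ltW.
  have : 0 <= k%:R * (z - 1) by rewrite mulr_ge0// ltW.
  by rewrite -natr1; lra.
by rewrite ler_pM2l// addr_gt0// invr_gt0.
Qed.

Lemma geometric_sum_le (q : R) n : 0 <= q < 1 ->
  \sum_(i < n) q ^+ i <= (1 - q)^-1.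
Proof.
move=> /andP[q0 q1]; have q1' : 0 < 1 - q by rewrite subr_gt0.
rewrite -[leRHS]mulr1 ler_pdivlMl//.
have -> : (1 - q) * \sum_(i < n) q ^+ i = 1 - q ^+ n.
  elim: n => [|n ih]; first by rewrite big_ord0 mulr0 expr0 subrr.
  by rewrite big_ord_recr/= mulrDr ih exprS; ring.
by rewrite gerBl exprn_ge0.
Qed.

Lemma dyadic_scale (r : R) : 0 < r <= 1 ->
  exists k : nat, r <= 2 ^- k /\ 2 ^- k < r * 2.
Proof.
move=> /andP[r0 r1].
have ex : exists k : nat, 2 ^- k < r * 2.
  exists (Num.truncn r^-1).
  have h : r^-1 < 2 ^+ (Num.truncn r^-1) * 2.
    rewrite -exprSr (lt_le_trans (Num.Theory.truncnS_gt _))// -natrX ler_nat.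
    exact: ltnW (ltn_expl _ _).
  rewrite -[ltLHS]mulr1 ltr_pdivrMl ?exprn_gt0//.
  by move: h; rewrite -[ltLHS]mulr1 ltr_pdivrMl// mulrCA.
case: (ex_minnP ex) => k kr kmin; exists k; split => //.
case: k kr kmin => [|k] kr kmin; first by rewrite expr0 invr1.
rewrite leNgt; apply/negP => rk.
have kr' : 2 ^- k < r * 2 by move: rk; rewrite exprS invfM; lra.
by have := kmin k kr'; rewrite ltnn.
Qed.

End growth.

(** * Fejer kernel and energy of a measure *)

Section frostman.
Variable R : realType.
Implicit Types (P : prob R) (s t c : R).

Lemma prob_bigcup_le P (F : nat -> set R) (e : R) :
  (forall k, measurable (F k)) ->
  (forall n, \sum_(k < n) fine (P (F k)) <= e) -> (P (\bigcup_k F k) <= e%:E)%E.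
Proof.
move=> mF Fe; have mU : measurable (\bigcup_k F k) by exact: bigcup_measurable.
apply: le_trans (generalized_Boole_inequality P mF mU) _.
apply: lime_le; first by apply: is_cvg_nneseries.
apply: nearW => n; rewrite big_mkord.
rewrite (eq_bigr (fun k : 'I_n => (fine (P (F k)))%:E)).
  by rewrite sumEFin lee_fin; exact: Fe.
by move=> k _; rewrite fineK//; apply: fin_num_measure; exact: mF.
Qed.

(* The kernel [fejer N] is N times the Fejer kernel. *)
Definition fejer (N : nat) (u : R) : R :=
  (\sum_(j < N) cos (j%:R * u)) ^+ 2 + (\sum_(j < N) sin (j%:R * u)) ^+ 2.

Lemma fejer_ge0 N u : 0 <= fejer N u.
Proof. by rewrite addr_ge0// sqr_ge0. Qed.

Lemma fejer_sum N u :
  fejer N u = \sum_(j < N) \sum_(l < N) cos ((j%:R - l%:R) * u).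
Proof.
rewrite /fejer !expr2 !mulr_suml -big_split/=; apply: eq_bigr => j _.
rewrite !mulr_sumr -big_split/=; apply: eq_bigr => l _.
by rewrite mulrBl cosB.
Qed.

(** All angles j * u with j < N lie in [-1, 1], so each cosine is at least cos 1 > 0. *)
Lemma fejer_ge N u : (0 < N)%N -> `|u| <= N%:R^-1 -> (N%:R * cos 1) ^+ 2 <= fejer N u.
Proof.
move=> N0 uN; apply: (@le_trans _ _ ((\sum_(j < N) cos (j%:R * u)) ^+ 2)).
  have cos1 := @cos1_gt0 R.
  have le_sum : N%:R * cos 1 <= \sum_(j < N) cos (j%:R * u).
    have -> : N%:R * cos 1 = \sum_(j < N) cos 1 :> R.
      by rewrite sumr_const card_ord mulr_natl.
    apply: ler_sum => j _; rewrite -(cos_norm (j%:R * u)).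
    have ju : `|j%:R * u| <= 1.
      rewrite normrM ger0_norm// (le_trans (ler_wpM2l _ uN))//.
      by rewrite ler_pdivrMr ?ltr0n// mul1r ler_nat ltnW.
    have pi1 : 1 <= pi :> R by rewrite (le_trans _ (pi_ge2 _))// ler1n.
    have [->|ne] := eqVneq `|j%:R * u| 1; first by [].
    rewrite ltW// ltr_cos ?in_itv/= ?normr_ge0 ?ler01 ?pi1//.
      by rewrite lt_neqAle ne ju.
    exact: le_trans pi1.
  by rewrite ler_pXn2r// nnegrE ?(le_trans _ le_sum)// mulr_ge0 ?ler0n// ltW.
by rewrite lerDl sqr_ge0.
Qed.

Definition cosI P xi := \int[P]_x cos (xi * x).
Definition sinI P xi := \int[P]_x sin (xi * x).

Definition fejerI P N (x : R) := \int[P]_y fejer N (x - y).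

(** The convolution with a trigonometric polynomial is a finite combination of waves whose
    coefficients are Fourier coefficients of P; integrating it again needs linearity only. *)
Lemma fejerIE P N x : fejerI P N x = \sum_(j < N) \sum_(l < N)
  (cosI P (j%:R - l%:R) * cos ((j%:R - l%:R) * x) +
   sinI P (j%:R - l%:R) * sin ((j%:R - l%:R) * x)).
Proof.
rewrite /fejerI.
under eq_Rintegral do rewrite fejer_sum.
have bcs (xi : R) : bmeas (fun y => cos (xi * (x - y))).
  have -> : (fun y => cos (xi * (x - y))) =
      (fun y => cos (xi * x) * cos (xi * y) + sin (xi * x) * sin (xi * y)).
    by apply/funext => y; rewrite mulrBr cosB.
  by apply: bmeasD; apply: bmeasZ; [exact: bmeas_cosZ|exact: bmeas_sinZ].
rewrite bint_sum; last by move=> j _; apply: bmeas_sum => l _.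
apply: eq_bigr => j _; rewrite bint_sum//; apply: eq_bigr => l _.
set xi := _ - _.
under eq_Rintegral do rewrite mulrBr cosB.
rewrite bintD; [|exact/bmeasZ/bmeas_cosZ|exact/bmeasZ/bmeas_sinZ].
rewrite bintZ ?bintZ; [|exact: bmeas_sinZ|exact: bmeas_cosZ].
by rewrite mulrC [X in _ + X]mulrC.
Qed.

Lemma bmeas_fejerI P N : bmeas (fejerI P N).
Proof.
have -> : fejerI P N = (fun x => \sum_(j < N) \sum_(l < N)
    (cosI P (j%:R - l%:R) * cos ((j%:R - l%:R) * x) +
     sinI P (j%:R - l%:R) * sin ((j%:R - l%:R) * x))).
  by apply/funext => x; exact: fejerIE.
apply: bmeas_sum => j _; apply: bmeas_sum => l _.
by apply: bmeasD; apply: bmeasZ; [exact: bmeas_cosZ|exact: bmeas_sinZ].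
Qed.

Lemma fejer_energy P N : \int[P]_x fejerI P N x = \sum_(j < N) \sum_(l < N)
  (cosI P (j%:R - l%:R) ^+ 2 + sinI P (j%:R - l%:R) ^+ 2).
Proof.
have bt (xi : R) : bmeas (fun x => cosI P xi * cos (xi * x) + sinI P xi * sin (xi * x)).
  by apply: bmeasD; apply: bmeasZ; [exact: bmeas_cosZ|exact: bmeas_sinZ].
under eq_Rintegral do rewrite fejerIE.
rewrite bint_sum; last by move=> j _; apply: bmeas_sum => l _.
apply: eq_bigr => j _; rewrite bint_sum//; apply: eq_bigr => l _.
rewrite bintD; [|exact/bmeasZ/bmeas_cosZ|exact/bmeasZ/bmeas_sinZ].
rewrite bintZ ?bintZ; [|exact: bmeas_sinZ|exact: bmeas_cosZ].
by rewrite !expr2.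
Qed.

Lemma bmeas_fejer_shift P N x : bmeas (fun y : R => fejer N (x - y)).
Proof.
have -> : (fun y : R => fejer N (x - y)) = (fun y => \sum_(j < N) \sum_(l < N)
    (cos ((j%:R - l%:R) * x) * cos ((j%:R - l%:R) * y) +
     sin ((j%:R - l%:R) * x) * sin ((j%:R - l%:R) * y))).
  apply/funext => y; rewrite fejer_sum; apply: eq_bigr => j _.
  by apply: eq_bigr => l _; rewrite mulrBr cosB.
apply: bmeas_sum => j _; apply: bmeas_sum => l _.
by apply: bmeasD; apply: bmeasZ; [exact: bmeas_cosZ|exact: bmeas_sinZ].
Qed.

Lemma ball_fejerI P N x : (0 < N)%N ->
  (N%:R * cos 1) ^+ 2 * fine (P (ball x N%:R^-1)) <= fejerI P N x.
Proof.
move=> N0.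
have mB : measurable (ball x (N%:R^-1 : R)) by exact: measurable_ball.
rewrite -bint_indic// -bintZ; last exact: bmeas_indic.
apply: ler_bint; [exact/bmeasZ/bmeas_indic|exact: bmeas_fejer_shift|].
move=> y; rewrite indicE; case: (boolP (y \in _)) => [|_]; last first.
  by rewrite mulr0 fejer_ge0.
by rewrite inE mulr1 /ball/= => /ltW; exact: fejer_ge.
Qed.

(** The value 0 at m = 0 makes [corr s (j - l) + corr s (l - j)], with truncated differences, equal
    to |j - l|^(-s) off the diagonal. *)
Definition corr s (m : nat) : R := if m is 0%N then 0 else m%:R `^ (- s).

Lemma corr_ge0 s m : 0 <= corr s m.
Proof. by case: m => //= m; exact: powR_ge0. Qed.

Lemma corr_row s N (j : nat) : (j < N)%N ->
  \sum_(0 <= l < N) (corr s (j - l) + corr s (l - j)) <=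
    2 * \sum_(0 <= m < N) corr s m.
Proof.
move=> jN; rewrite big_split/= mulr_natl mulr2n; apply: lerD.
  rewrite (big_cat_nat (leq0n j) (ltnW jN))/=.
  rewrite [X in _ + X]big_nat [X in _ + X]big1 ?addr0; last first.
    move=> i /andP[ji _].
    by have /eqP -> : (j - i == 0)%N by rewrite subn_eq0.
  rewrite big_nat_rev/= add0n big_nat.
  rewrite (eq_bigr (fun i => corr s i.+1)); last first.
    by move=> i /andP[_ ij]; rewrite subKn.
  rewrite -big_nat.
  have -> : \sum_(0 <= i < j) corr s i.+1 = \sum_(0 <= m < j.+1) corr s m.
    by rewrite big_nat_recl//= add0r.
  rewrite [leRHS](big_cat_nat (leq0n j.+1) jN)/= lerDl sumr_ge0// => i _.
  exact: corr_ge0.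
rewrite (big_cat_nat (leq0n j) (ltnW jN))/=.
rewrite [X in X + _]big_nat [X in X + _]big1 ?add0r; last first.
  move=> i /andP[_ ij].
  by have /eqP -> : (i - j == 0)%N by rewrite subn_eq0 ltnW.
rewrite -{1}[j]add0n big_addn.
rewrite (eq_bigr (corr s)) => [|i _]; last by rewrite addnK.
rewrite [leRHS](big_cat_nat (leq0n (N - j)) (leq_subr _ _))/= lerDl.
by apply: sumr_ge0 => i _; exact: corr_ge0.
Qed.

(** The block from 2^i to 2^(i+1) has 2^i terms of size at most 2^(-is); the factor k counts the
    blocks and is unavoidable at s = 1. *)
Lemma corr_sum s k : 0 <= s <= 1 ->
  \sum_(0 <= m < 2 ^ k) corr s m <= k%:R * (2 ^+ k) `^ (1 - s).
Proof.
move=> /andP[s0 s1]; elim: k => [|k ih].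
  by rewrite expn0 big_nat1 mul0r.
rewrite (big_cat_nat (leq0n (2 ^ k)))/=; last first.
  by rewrite leq_exp2l.
rewrite -natr1 mulrDl mul1r.
have mono : (2 ^+ k : R) `^ (1 - s) <= (2 ^+ k.+1) `^ (1 - s).
  apply: ge0_ler_powR; rewrite ?subr_ge0 ?nnegrE ?exprn_ge0//.
  by rewrite ler_eXn2l// ltr1n.
apply: lerD.
  rewrite (le_trans ih)// ler_wpM2l//.
apply: (@le_trans _ _ ((2 ^+ k) `^ (1 - s))) => //.
rewrite big_nat (@le_trans _ _ (\sum_(2 ^ k <= i < 2 ^ k.+1) (2 ^+ k : R) `^ (- s)))//.
  rewrite [leRHS]big_nat; apply: ler_sum => i /andP[ki _].
  have i0 : (0 < i)%N by rewrite (leq_trans _ ki)// expn_gt0.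
  rewrite /corr; case: i i0 ki => // i _ ki.
  rewrite !powRN lef_pV2 ?posrE ?powR_gt0 ?exprn_gt0//.
  apply: ge0_ler_powR; rewrite ?nnegrE ?exprn_ge0//.
  by rewrite -natrX ler_nat.
rewrite sumr_const_nat expnS mul2n -addnn addnK -[leLHS]mulr_natl natrX.
rewrite powRD ?powRr1 ?exprn_ge0//.
by apply/implyP => _; rewrite gt_eqF// exprn_gt0.
Qed.

End frostman.

(** * Fourier decay prevents sets from being null *)

Section mass_distribution.
Variable R : realType.
Implicit Types (P : prob R) (A : set R) (s t c : R).

Lemma powR_exp (x a : R) k : 0 <= x -> (x `^ a) ^+ k = (x ^+ k) `^ a.
Proof.
move=> x0; elim: k => [|k ih]; first by rewrite !expr0 powR1.
by rewrite !exprS ih powRM// exprn_ge0.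
Qed.

Lemma fine_prob_le P (A B : set R) : measurable A -> measurable B ->
  A `<=` B -> fine (P A) <= fine (P B).
Proof.
move=> mA mB AB; apply: fine_le; [exact: fin_num_measure|exact: fin_num_measure|].
by apply: le_measure; rewrite ?inE.
Qed.

Lemma markov_bint P (f : R -> R) (l : R) : bmeas f -> (forall x, 0 <= f x) ->
  0 <= l -> measurable [set x | l < f x] /\
  l * fine (P [set x | l < f x]) <= \int[P]_x f x.
Proof.
move=> bf f0 l0.
have mB : measurable [set x | l < f x].
  rewrite (_ : [set x | l < f x] = f @^-1` `]l, +oo[).
    by rewrite -[X in measurable X]setTI; case: bf => + _; apply.
  by apply/seteqP; split => x /=; rewrite in_itv/= andbT.
split => //; rewrite -bint_indic// -bintZ; last exact: bmeas_indic.
apply: ler_bint => //; first exact/bmeasZ/bmeas_indic.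
move=> x; rewrite indicE; case: (boolP (x \in _)) => [|_]; last by rewrite mulr0.
by rewrite inE/= mulr1 => /ltW.
Qed.

Lemma cos_sin_decay P s c (xi : R) : decay P s c -> xi != 0 ->
  cosI P xi ^+ 2 + sinI P xi ^+ 2 <= 2 * c ^+ 2 * `|xi| `^ (- s).
Proof.
move=> Pc xi0; have [h1 h2] := Pc xi xi0.
have -> : `|xi| `^ (- s) = (`|xi| `^ (- s / 2)) ^+ 2.
  by rewrite -powR_mulrn ?powR_ge0// -powRrM -mulrA mulVf ?mulr1.
set w := `|xi| `^ _ in h1 h2 *.
rewrite -(real_normK (num_real (cosI P xi))) -(real_normK (num_real (sinI P xi))).
have sq (a : R) : 0 <= a -> a <= c * w -> a ^+ 2 <= (c * w) ^+ 2.
  by move=> a0 ac; rewrite ler_pXn2r// nnegrE (le_trans a0).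
have := sq _ (normr_ge0 _) h1; have := sq _ (normr_ge0 _) h2.
by rewrite -/(cosI P xi) -/(sinI P xi) exprMn; lra.
Qed.

(** With N = 2^k, each of the N rows has diagonal term 1 and off-diagonal terms bounded by the
    decay, so its sum is of order (k+1) N^(1-s). *)
Lemma energy_bound P s c k : decay P s c -> 0 <= s <= 1 ->
  \int[P]_x fejerI P (2 ^ k) x <=
  (1 + 4 * c ^+ 2) * k.+1%:R * (2 ^+ k) `^ (2 - s).
Proof.
move=> Pc s01; rewrite fejer_energy.
set u : R := 2 ^+ k; have u1 : 1 <= u by rewrite exprn_ege1// ler1n.
have u0 : 0 < u by rewrite (lt_le_trans ltr01).
have c20 : 0 <= c ^+ 2 by exact: sqr_ge0.
have row (j : 'I_(2 ^ k)) : \sum_(l < 2 ^ k)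
    (cosI P (j%:R - l%:R) ^+ 2 + sinI P (j%:R - l%:R) ^+ 2) <=
    (1 + 4 * c ^+ 2) * k.+1%:R * u `^ (1 - s).
  apply: (@le_trans _ _ (\sum_(l < 2 ^ k) ((j == l)%:R +
      2 * c ^+ 2 * (corr s (j - l) + corr s (l - j))))).
    apply: ler_sum => l _; have [->|jl] := eqVneq j l.
      rewrite subrr /cosI /sinI.
      under eq_Rintegral do rewrite mul0r cos0.
      under [X in _ + X ^+ 2]eq_Rintegral do rewrite mul0r sin0.
      rewrite !bint_cst expr1n expr0n/= addr0 lerDl.
      apply: mulr_ge0; last by rewrite addr_ge0 ?corr_ge0.
      exact: mulr_ge0.
    have xi0 : (j%:R - l%:R : R) != 0.
      by rewrite subr_eq0 eqr_nat; apply: contra_neq jl => /val_inj.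
    apply: le_trans (cos_sin_decay Pc xi0) _.
    rewrite add0r; apply: (ler_wpM2l (mulr_ge0 (ler0n R 2) c20)).
    move: jl; rewrite -val_eqE/= neq_ltn => /orP[jl|lj].
      rewrite distrC -natrB ?(ltnW jl)// ger0_norm//.
      rewrite (_ : (j - l)%N = 0%N) ?add0r; last by apply/eqP; rewrite subn_eq0 ltnW.
      by case: (l - j)%N (subn_gt0 j l) => //; rewrite jl.
    rewrite -natrB ?(ltnW lj)// ger0_norm//.
    rewrite (_ : (l - j)%N = 0%N) ?addr0; last by apply/eqP; rewrite subn_eq0 ltnW.
    by case: (j - l)%N (subn_gt0 l j) => //; rewrite lj.
  rewrite big_split/= -mulr_sumr (bigD1 j)//= eqxx big1 ?addr0; last first.
    by move=> l; rewrite eq_sym => /negbTE ->.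
  rewrite -(big_mkord xpredT (fun l => corr s (j - l) + corr s (l - j))).
  have h1 := corr_row s (ltn_ord j).
  have h2 := corr_sum k s01.
  have h3 : 1 <= u `^ (1 - s).
    have : u `^ 0 <= u `^ (1 - s) by apply: ler_powR => //; case/andP: s01; lra.
    by rewrite powRr0.
  have h4 : \sum_(0 <= l < 2 ^ k) (corr s (j - l) + corr s (l - j)) <=
      2 * (k%:R * u `^ (1 - s)).
    by apply: le_trans h1 _; rewrite ler_pM2l.
  have := ler_wpM2l (mulr_ge0 (ler0n R 2) c20) h4.
  move=> h5; apply: (le_trans (lerD (lexx 1) h5)).
  rewrite -[k.+1%:R]natr1; have k0 : 0 <= k%:R :> R by [].
  have h6 : 0 <= k%:R * u `^ (1 - s) by rewrite mulr_ge0// powR_ge0.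
  have h7 : 0 <= c ^+ 2 * u `^ (1 - s) by rewrite mulr_ge0// powR_ge0.
  rewrite -subr_ge0.
  have -> : (1 + 4 * c ^+ 2) * (k%:R + 1) * u `^ (1 - s) -
      (1 + 2 * c ^+ 2 * (2 * (k%:R * u `^ (1 - s)))) =
      k%:R * u `^ (1 - s) + 4 * (c ^+ 2 * u `^ (1 - s)) + (u `^ (1 - s) - 1) by ring.
  by apply: addr_ge0; [apply: addr_ge0; [|exact: mulr_ge0]|rewrite subr_ge0].
apply: le_trans (ler_sum _ (fun j _ => row j)) _.
rewrite sumr_const card_ord -[leLHS]mulr_natr natrX -/u.
rewrite -[leLHS]mulrA.
have -> : u `^ (1 - s) * u = u `^ (2 - s).
  rewrite -[X in _ * X]powRr1 ?(ltW u0)// -powRD; last first.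
    by apply/implyP => _; rewrite gt_eqF.
  by congr (_ `^ _); ring.
by [].
Qed.

(* Markov's inequality at every dyadic scale: outside a set of mass 1/2 the
   measure is t-regular. *)
Lemma frostman P s t c : decay P s c -> 0 < t -> t < s -> s <= 1 ->
  exists (B : set R) (C : R), [/\ measurable B, fine (P B) <= 2^-1, 0 < C &
    forall x, ~ B x -> forall k : nat,
      fine (P (ball x (2 ^- k))) <= C * (2 ^- k) `^ t].
Proof.
move=> Pc t0 ts s1.
have s01 : 0 <= s <= 1 by rewrite s1 ltW// (lt_trans t0).
pose sg := s - t; have sg0 : 0 < sg by rewrite subr_gt0.
(* The gap s - t is spent in two halves: one factor z^k absorbs k+1, the other makes the masses of
   the exceptional sets geometrically summable. W normalizes their total to 1/2. *)
pose z : R := 2 `^ (sg / 2).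
have z1 : 1 < z.
  have : 1 `^ (sg / 2) < z; last by rewrite powR1.
  by apply: gt0_ltr_powR; rewrite ?divr_gt0// ?nnegrE ?ler01 ?ler0n ?ltr1n.
have z0 : 0 < z by exact: lt_trans z1.
have [C1 C10 linC1] := linear_le_geometric z1.
pose D := 1 + 4 * c ^+ 2.
have D0 : 0 < D by rewrite ltr_pwDl// mulr_ge0// sqr_ge0.
pose q := z^-1; have q01 : 0 <= q < 1.
  by rewrite invr_ge0 ltW//= invf_lt1.
have q1' : 0 < 1 - q by case/andP: q01; rewrite subr_gt0.
pose W := 2 * (1 - q)^-1.
have W0 : 0 < W by rewrite mulr_gt0// invr_gt0.
pose K := W * D * C1; have K0 : 0 < K := mulr_gt0 (mulr_gt0 W0 D0) C10.
pose u k : R := 2 ^+ k.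
have u0 k : 0 < u k by rewrite exprn_gt0.
pose L k := K * u k `^ (2 - t).
pose Bad k := [set x | L k < fejerI P (2 ^ k) x].
have L0 k : 0 < L k by rewrite mulr_gt0// powR_gt0.
have E0 k x : 0 <= fejerI P (2 ^ k) x.
  by apply: Rintegral_ge0 => y _; exact: fejer_ge0.
have mark k := markov_bint P (bmeas_fejerI P (2 ^ k)) (E0 k) (ltW (L0 k)).
have mBad k : measurable (Bad k) by case: (mark k).
have split_u k : u k `^ (2 - t) = z ^+ k * z ^+ k * u k `^ (2 - s).
  rewrite powR_exp// -/(u k) -!powRD; last 2 first.
    by apply/implyP => _; rewrite gt_eqF.
    by apply/implyP => _; rewrite gt_eqF.
  by congr (_ `^ _); rewrite -splitr /sg; ring.
have PBad k : fine (P (Bad k)) <= W^-1 * q ^+ k.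
  have [_ h1] := mark k; have h2 := energy_bound k Pc s01.
  have h3 := le_trans h1 h2.
  have zk0 : 0 < z ^+ k by rewrite exprn_gt0.
  have h4 : D * k.+1%:R * u k `^ (2 - s) <= L k * (W^-1 * q ^+ k).
    have -> : L k * (W^-1 * q ^+ k) = D * (C1 * z ^+ k) * u k `^ (2 - s).
      rewrite /L split_u /q exprVn /K.
      by field; rewrite !gt_eqF.
    by rewrite ler_pM2r ?powR_gt0// ler_pM2l.
  by have := le_trans h3 h4; rewrite ler_pM2l.
exists (\bigcup_k Bad k), (K / cos 1 ^+ 2); split.
- by apply: bigcup_measurable => k _; exact: mBad.
- have : (P (\bigcup_k Bad k) <= (2^-1)%:E)%E.
    apply: prob_bigcup_le => // n.
    apply: (@le_trans _ _ (\sum_(k < n) W^-1 * q ^+ k)).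
      by apply: ler_sum => k _.
    rewrite -mulr_sumr (le_trans (ler_wpM2l _ (geometric_sum_le n q01)))//.
      by rewrite invr_ge0 ltW.
    by rewrite /W invfM invrK mulfK ?gt_eqF.
  move=> h; rewrite -lee_fin fineK//; apply: fin_num_measure.
  by apply: bigcup_measurable => k _; exact: mBad.
- by rewrite divr_gt0// exprn_gt0// cos1_gt0.
move=> x nB k.
have cos1 := @cos1_gt0 R.
have : fejerI P (2 ^ k) x <= L k.
  by rewrite leNgt; apply/negP => h; apply: nB; exists k.
have N0 : (0 < 2 ^ k)%N by rewrite expn_gt0.
move=> /(le_trans (ball_fejerI P x N0)); rewrite natrX -/(u k) => h.
have uc0 : 0 < (u k * cos 1) ^+ 2 by rewrite exprn_gt0// mulr_gt0.
rewrite -(ler_pM2l uc0); apply: le_trans h _.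
rewrite le_eqVlt; apply/orP; left; apply/eqP.
have -> : (2 ^- k) `^ t = u k `^ (- t).
  by rewrite powRN -[LHS]invrK; congr (_^-1); rewrite -powR_inv1 ?powR_ge0// powRAC powR_inv1
    ?invr_ge0 ?exprn_ge0// invrK.
rewrite /L.
have -> : u k `^ (2 - t) = u k ^+ 2 * u k `^ (- t).
  rewrite -powR_mulrn ?(ltW (u0 k))// -powRD//.
  by apply/implyP => _; rewrite gt_eqF.
by field; rewrite gt_eqF.
Qed.

Lemma decay_not_null A P s t c : P (~` A) = 0%E -> measurable A -> decay P s c ->
  0 < t -> t < s -> s <= 1 -> ~ null t A.
Proof.
move=> PA mA Pc t0 ts s1 nA.
have [B [C [mB PB C0 BC]]] := frostman Pc t0 ts s1.
pose C' := C * 4 `^ t; have C'0 : 0 < C' by rewrite mulr_gt0// powR_gt0.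
(* The first bound leaves the cover at most mass 1/4 outside B, which itself has mass at most 1/2;
   the second keeps radii at most 1/8, so that a dyadic scale above twice a radius exists. *)
pose e := Num.min (C'^-1 / 4) (8^-1 `^ t).
have e0 : 0 < e by rewrite lt_min divr_gt0 ?invr_gt0//= powR_gt0// invr_gt0.
have [a [r [r0 Aa sr]]] := nA e e0.
have r2 i : r i <= 8^-1.
  rewrite leNgt; apply/negP => ri.
  have : r i `^ t <= 8^-1 `^ t.
    rewrite (@le_trans _ _ e) ?ge_min ?lexx ?orbT//.
    by apply: (@term_le_sum _ (fun j => r j `^ t)) => // j; exact: powR_ge0.
  by rewrite leNgt gt0_ltr_powR// nnegrE ?r0// invr_ge0.
pose F i := ball (a i) (r i) `\` B.
have mF i : measurable (F i) by apply: measurableD => //; exact: measurable_ball.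
have PF i : fine (P (F i)) <= C' * r i `^ t.
  (* The centre of a ball may lie in B, so the ball is recentred at a point x outside B. Doubling
     the radius and rounding up to a dyadic scale costs the factor 4^t in [C']. *)
  have [[x [ax Bx]]|F0] := pselect (F i !=set0); last first.
    have -> : F i = set0 by apply: contrapT => Fn; apply: F0; apply/set0P/eqP.
    by rewrite measure0; exact: mulr_ge0 (ltW C'0) (powR_ge0 _ _).
  have ri0 : 0 < r i.
    by move: ax; rewrite /ball/=; apply: le_lt_trans.
  have [k [rk kr]] : exists k : nat, r i * 2 <= 2 ^- k /\ 2 ^- k < r i * 2 * 2.
    apply: dyadic_scale; rewrite mulr_gt0//=.
    by have := r2 i; lra.
  have sub : F i `<=` ball x (2 ^- k).
    move=> y [ay _]; apply: le_ball rk _ _.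
    by rewrite mulr_natr mulr2n; apply: ball_triangle ay; exact: ball_sym.
  apply: (@le_trans _ _ (fine (P (ball x (2 ^- k))))).
    by apply: fine_prob_le => //; exact: measurable_ball.
  apply: le_trans (BC x Bx k) _.
  rewrite /C' -mulrA ler_pM2l// -powRM// ; apply: ge0_ler_powR.
  - exact: ltW.
  - by rewrite nnegrE invr_ge0 exprn_ge0.
  - by rewrite nnegrE mulr_ge0.
  - by rewrite ltW//; apply: lt_le_trans kr _; lra.
have PU : (P (\bigcup_i F i) <= (4^-1)%:E)%E.
  apply: prob_bigcup_le => // n.
  apply: (@le_trans _ _ (\sum_(i < n) C' * r i `^ t)); first exact: ler_sum.
  rewrite -mulr_sumr -ler_pdivlMl// (le_trans (sr n))//.
  by rewrite ge_min lexx.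
have : (P setT <= (2^-1)%:E + (4^-1)%:E)%E.
  apply: (@le_trans _ _ (P B + P (\bigcup_i F i))%E); last first.
    apply: leeD => //; rewrite -lee_fin in PB; apply: le_trans PB.
    by rewrite fineK// fin_num_measure.
  have mU : measurable (\bigcup_i F i) by by apply: bigcup_measurable => k _; exact: mF.
  have mC : measurable (~` A) by exact: measurableC.
  apply: (@le_trans _ _ (P (~` A `|` (B `|` \bigcup_i F i)))).
    apply: le_measure; rewrite ?inE//.
      by apply: measurableU => //; exact: measurableU.
    move=> x _; have [Ax|] := pselect (A x); last by left.
    right; have [Bx|nBx] := pselect (B x); first by left.
    by right; have [i _ xi] := Aa x Ax; exists i.
  apply: le_trans (measureU2 P mC (measurableU _ _ mB mU)) _.
  rewrite [X in (X + _)%E](_ : _ = 0%E) ?add0e//; exact: measureU2.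
have -> : P setT = 1%E by exact: probability_setT.
by rewrite -EFinD lee_fin; lra.
Qed.

Lemma fourier_decay_not_null A s t : measurable A -> fourier_decay A s ->
  0 < t -> t < s -> s <= 1 -> ~ null t A.
Proof.
by move=> mA [c _ [P [PA Pc]]] t0 ts s1; exact: (decay_not_null PA mA Pc t0 ts s1).
Qed.

End mass_distribution.

(** * Salem sets of rational dimension *)

Section balancing.
Variable R : realType.

Lemma expR_le_quad (y : R) : y <= 2^-1 -> expR y <= 1 + y + 2 * y ^+ 2.
Proof.
move=> y2; have y1 : 0 < 1 - y by lra.
have h : 1 - y <= expR (- y) by exact: expR_ge1Dx.
have : expR y <= (1 - y)^-1.
  by rewrite -[expR y]invrK -expRN lef_pV2 ?posrE ?expR_gt0.
move=> /le_trans; apply.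
rewrite -[leLHS]mul1r ler_pdivrMr// -subr_ge0.
have -> : (1 + y + 2 * y ^+ 2) * (1 - y) - 1 = y ^+ 2 * (1 - 2 * y) by ring.
by rewrite mulr_ge0 ?sqr_ge0//; lra.
Qed.

Lemma exists_le_avg (M : nat) (F : nat -> R) (B : R) : (0 < M)%N ->
  \sum_(j < M) F j <= M%:R * B -> exists2 j, (j < M)%N & F j <= B.
Proof.
move=> M0 FB; apply: contrapT => nj.
have : \sum_(j < M) B < \sum_(j < M) F j.
  have H (j : 'I_M) : B < F j.
    by rewrite ltNge; apply/negP => Fj; apply: nj; exists (nat_of_ord j).
  apply: ltr_sum => [|j _]; last exact: H.
  by apply/hasP; exists (Ordinal M0) => //; rewrite mem_index_enum.
by rewrite sumr_const card_ord -[ltLHS]mulr_natl ltNge FB.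
Qed.

(* Derandomization: the potential is the expected exponential moment, and some
   choice at each step does not increase it. *)
Lemma potential_choice (Om : finType) (M n : nat) (l : R)
    (a : nat -> nat -> Om -> R) : (0 < M)%N -> 0 <= l <= 4^-1 ->
  (forall v o, \sum_(j < M) a v j o = 0) -> (forall v j o, `|a v j o| <= 2) ->
  exists c : nat -> nat, (forall v, (c v < M)%N) /\
    \sum_(o : Om) (expR (l * \sum_(v < n) a v (c v) o) +
                   expR (- (l * \sum_(v < n) a v (c v) o))) <=
    (#|Om|%:R *+ 2) * (1 + 8 * l ^+ 2) ^+ n.
Proof.
move=> M0 /andP[l0 l4] a0 a2; elim: n => [|n [c [cM ih]]].
  exists (fun=> 0%N); split => //.
  rewrite expr0 mulr1 (eq_bigr (fun=> 1 *+ 2)) => [|o _].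
    by rewrite sumr_const mulrnAC.
  by rewrite big_ord0 mulr0 oppr0 expR0.
pose S o := \sum_(v < n) a v (c v) o.
pose F j := \sum_(o : Om) (expR (l * (S o + a n j o)) + expR (- (l * (S o + a n j o)))).
set Phi := \sum_(o : Om) _ in ih.
(* Averaging over j cancels the linear term because the deviations sum to 0; l <= 1/4 keeps the
   exponent in the range of [expR_le_quad]. *)
have quad (o : Om) (e : R) : `|e| <= l ->
    \sum_(j < M) expR (e * a n j o) <= M%:R * (1 + 8 * l ^+ 2).
  move=> el.
  apply: (@le_trans _ _ (\sum_(j < M) (1 + e * a n j o + 8 * l ^+ 2))).
    apply: ler_sum => j _.
    have ea : `|e * a n j o| <= 2 * l.
      by rewrite normrM mulrC ler_pM.
    have ea2 : e * a n j o <= 2^-1.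
      by rewrite (le_trans (ler_norm _))// (le_trans ea)//; lra.
    apply: (le_trans (expR_le_quad ea2)); rewrite lerD2l.
    rewrite -(real_normK (num_real (e * a n j o))).
    have : `|e * a n j o| ^+ 2 <= (2 * l) ^+ 2.
      by rewrite ler_pXn2r// nnegrE mulr_ge0.
    by rewrite exprMn; lra.
  rewrite !big_split/= -mulr_sumr a0 mulr0 addr0 !sumr_const card_ord.
  by rewrite -[X in _ + X]mulr_natl mulrDr mulr1.
have [j jM Fj] : exists2 j, (j < M)%N & F j <= Phi * (1 + 8 * l ^+ 2).
  apply: exists_le_avg => //; rewrite /F exchange_big/= /Phi mulrCA mulr_suml.
  apply: ler_sum => o _; rewrite big_split/= mulrDl.
  have sgn (e : R) : `|e| <= l -> \sum_(i < M) expR (e * (S o + a n i o)) <=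
      expR (e * S o) * (M%:R * (1 + 8 * l ^+ 2)).
    move=> el; under eq_bigr do rewrite mulrDr expRD.
    by rewrite -mulr_sumr ler_wpM2l ?expR_ge0// quad.
  apply: lerD; first by apply: sgn; rewrite ger0_norm.
  under eq_bigr do rewrite -mulNr.
  by rewrite -mulNr; apply: sgn; rewrite normrN ger0_norm.
exists (fun v => if v == n then j else c v); split.
  by move=> v; case: ifP.
have E o : \sum_(v < n.+1) a v (if v == n :> nat then j else c v) o = S o + a n j o.
  rewrite big_ord_recr/= eqxx; congr (_ + _); apply: eq_bigr => v _.
  by rewrite ltn_eqF.
under eq_bigr do rewrite E.
apply: (le_trans Fj); rewrite [(_ + _) ^+ n.+1]exprSr [leRHS]mulrA ler_wpM2r//.
by rewrite addr_ge0// mulr_ge0// sqr_ge0.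
Qed.

(** With r^2 choices, l = 1/(4r) keeps (1 + 8 l^2)^(r^2) below e, while the initial potential is at
    most e^h. Comparing exponents gives l |S| <= h + 1: square-root cancellation up to the factor h
    + 1. *)
Lemma balancing (Om : finType) (M r : nat) (h : nat)
    (a : nat -> nat -> Om -> R) : (0 < M)%N -> (0 < r)%N ->
  (forall v o, \sum_(j < M) a v j o = 0) -> (forall v j o, `|a v j o| <= 2) ->
  (#|Om| * 2 <= 2 ^ h)%N ->
  exists c : nat -> nat, (forall v, (c v < M)%N) /\
    forall o, `|\sum_(v < r * r) a v (c v) o| <= 4 * r%:R * h.+1%:R.
Proof.
move=> M0 r0 a0 a2 hOm.
have r0' : 0 < r%:R :> R by rewrite ltr0n.
pose l : R := (4 * r%:R)^-1.
have l0 : 0 < l by rewrite invr_gt0 mulr_gt0.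
have l4 : l <= 4^-1 by rewrite lef_pV2 ?posrE ?mulr_gt0// ler_peMr// ler1n.
have l04 : 0 <= l <= 4^-1 by rewrite ltW.
have [c [cM H]] := potential_choice (r * r) M0 l04 a0 a2.
exists c; split => // o; set S := \sum_(v < _) _.
have e1 : (1 + 8 * l ^+ 2) ^+ (r * r) <= expR 1.
  have : (1 + 8 * l ^+ 2) ^+ (r * r) <= expR (8 * l ^+ 2) ^+ (r * r).
    have p1 : 0 <= 1 + 8 * l ^+ 2 by rewrite addr_ge0// mulr_ge0// sqr_ge0.
    by rewrite lerXn2r ?nnegrE ?expR_ge0// expR_ge1Dx.
  move=> /le_trans; apply; rewrite -expRM_natl ler_expR.
  rewrite /l natrM expr2 invfM.
  have -> : r%:R * r%:R * (8 * (4^-1 * r%:R^-1 * (4^-1 * r%:R^-1))) = 2^-1 :> R.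
    by field; rewrite gt_eqF.
  by rewrite invf_le1// ler1n.
have e2 : (#|Om|%:R *+ 2 : R) <= expR h%:R.
  apply: (@le_trans _ _ (2 ^+ h)).
    by rewrite -natrX -mulrnA ler_nat.
  rewrite -[h%:R]mulr1 expRM_natl lerXn2r ?nnegrE ?expR_ge0//.
  by have := @expR_ge1Dx R 1; rewrite -[1 + 1]/(2%:R).
have e3 : expR (l * `|S|) <= expR h.+1%:R.
  apply: (@le_trans _ _ (expR h%:R * expR 1)); last by rewrite -expRD natr1.
  apply: le_trans (ler_pM _ _ e2 e1); rewrite ?mulrn_wge0 ?exprn_ge0//; last first.
    by rewrite addr_ge0// mulr_ge0// sqr_ge0.
  apply: le_trans H; rewrite (bigD1 o)//= -/S.
  apply: (@le_trans _ _ (expR (l * S) + expR (- (l * S)))); last first.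
    by rewrite lerDl sumr_ge0// => i _; rewrite addr_ge0 ?expR_ge0.
  have [S0|S0] := leP 0 S; first by rewrite ger0_norm// lerDl expR_ge0.
  by rewrite ltr0_norm// mulrN lerDr expR_ge0.
move: e3; rewrite ler_expR /l -ler_pdivlMl ?invr_gt0 ?mulr_gt0// invrK.
by [].
Qed.

End balancing.

(** * Averages of waves over intervals *)

Section phases.
Variable R : realType.
Implicit Types (xi th x L : R).

(* The mean of [cos (xi y + th)] over the interval [x, x + L]. *)
Definition mean_cos xi th x L : R :=
  (sin (xi * (x + L) + th) - sin (xi * x + th)) / (xi * L).

Definition sinc (u : R) : R := sin u / u.

Lemma sin_subE (u v : R) : sin u - sin v = 2 * (cos ((u + v) / 2) * sin ((u - v) / 2)).
Proof.
have -> : sin u = sin ((u + v) / 2 + (u - v) / 2) by congr sin; field.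
have -> : sin v = sin ((u + v) / 2 - (u - v) / 2) by congr sin; field.
by rewrite sinD sinB; ring.
Qed.

Lemma mean_cosE xi th x L : xi * L != 0 ->
  mean_cos xi th x L = sinc (xi * L / 2) * cos (xi * (x + L / 2) + th).
Proof.
move=> xiL; rewrite /mean_cos sin_subE /sinc.
have -> : (xi * (x + L) + th + (xi * x + th)) / 2 = xi * (x + L / 2) + th by field.
have -> : (xi * (x + L) + th - (xi * x + th)) / 2 = xi * L / 2 by field.
have xi0 : xi != 0 by apply: contra_neq xiL => ->; rewrite mul0r.
have L0 : L != 0 by apply: contra_neq xiL => ->; rewrite mulr0.
by field; rewrite xi0 L0.
Qed.

Lemma mean_cos_split xi th x L (M : nat) : xi * L != 0 -> (0 < M)%N ->
  mean_cos xi th x (M%:R * L) =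
  (\sum_(j < M) mean_cos xi th (x + j%:R * L) L) / M%:R.
Proof.
move=> xiL M0; have M0' : M%:R != 0 :> R by rewrite pnatr_eq0 -lt0n.
have xi0 : xi != 0 by apply: contra_neq xiL => ->; rewrite mul0r.
have L0 : L != 0 by apply: contra_neq xiL => ->; rewrite mulr0.
rewrite /mean_cos -mulr_suml.
have -> : \sum_(j < M) (sin (xi * (x + j%:R * L + L) + th) -
     sin (xi * (x + j%:R * L) + th)) =
   sin (xi * (x + M%:R * L) + th) - sin (xi * x + th).
  have := telescope_sumr (fun j : nat => sin (xi * (x + j%:R * L) + th)) (leq0n M).
  rewrite /= mul0r addr0 => <-; rewrite big_mkord; apply: eq_bigr => j _.
  by rewrite -[j.+1%:R]natr1 mulrDl mul1r addrA.
by field; rewrite xi0 L0 M0'.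
Qed.

Lemma mean_cos_approx xi th x L : 0 < xi -> 0 < L ->
  `|mean_cos xi th x L - cos (xi * x + th)| <= xi * L.
Proof.
move=> xi0 L0; have xiL : 0 < xi * L by rewrite mulr_gt0.
pose u := xi * x + th; pose v := xi * (x + L) + th.
have vu : v - u = xi * L by rewrite /u /v; ring.
have uv : u < v by rewrite -subr_gt0 vu.
have [w] := @MVT R sin cos u v uv (fun y _ => is_derive_sin y)
  (continuous_subspaceT (@continuous_sin R)).
rewrite in_itv/= => /andP[uw wv] e.
rewrite /mean_cos -/u -/v e vu mulfK ?gt_eqF//.
rewrite (le_trans (cos_lip _ _))// ger0_norm; last by rewrite subr_ge0 ltW.
by rewrite -vu lerD2r ltW.
Qed.

Lemma sinc_le1 u : `|sinc u| <= 1.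
Proof.
have [->|u0] := eqVneq u 0; first by rewrite /sinc invr0 mulr0 normr0.
rewrite normrM normfV ler_pdivrMr ?normr_gt0// mul1r.
by have := sin_lip u 0; rewrite sin0 !subr0.
Qed.

Lemma sinc_le u : 0 < u -> `|sinc u| <= u^-1.
Proof.
move=> u0; rewrite normrM normfV (gtr0_norm u0) ler_piMl ?invr_ge0 ?(ltW u0)//.
exact: sin_max.
Qed.

(** Interpolation between the bounds 1 and 1/u. *)
Lemma sinc_powR u (al : R) : 0 < u -> 0 <= al <= 1 -> `|sinc u| <= u `^ (- al).
Proof.
move=> u0 /andP[al0 al1]; have [u1|u1] := leP 1 u.
  rewrite (le_trans (sinc_le u0))// -powR_inv1 ?(ltW u0)//.
  by apply: ler_powR => //; rewrite lerN2.
rewrite (le_trans (sinc_le1 u))// powRN -[leLHS]invr1 lef_pV2 ?posrE ?powR_gt0//.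
have : u `^ al <= 1 `^ al.
  by apply: ge0_ler_powR; rewrite ?nnegrE ?(ltW u0) ?(ltW u1) ?ler01.
by rewrite powR1.
Qed.

End phases.

(** * Choice of the cells *)

Section salem_positions.
Variable R : realType.
Variables a b : nat.
Hypothesis ab : (0 < a < b)%N.

Let T := (4 ^ a)%N.
Let M := (4 ^ b)%N.

Let T0 : (0 < T)%N. Proof. by rewrite expn_gt0. Qed.
Let M0 : (0 < M)%N. Proof. by rewrite expn_gt0. Qed.

Definition phase (f : bool) : R := if f then - (pi / 2) else 0.

Definition cell k : R := (M%:R ^+ k)^-1.

Lemma cell_gt0 k : 0 < cell k.
Proof. by rewrite invr_gt0 exprn_gt0// ltr0n. Qed.

Lemma cellS k : M%:R * cell k.+1 = cell k.
Proof. by rewrite /cell exprS invfM mulrA mulfV ?mul1r// pnatr_eq0 -lt0n. Qed.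

(* The cosine (sine for [f = true]) wave at the centre of the cell [Z]. *)
Definition wave (xi : R) f k (Z : nat) : R :=
  cos (xi * ((Z%:R + 2^-1) * cell k) + phase f).

(** Cell centres lie in [0,1]; hence a finite net of frequencies controls all of them. *)
Lemma wave_lip xi xi' f k Z : (Z < M ^ k)%N ->
  `|wave xi f k Z - wave xi' f k Z| <= `|xi - xi'|.
Proof.
move=> Zk; rewrite (le_trans (cos_lip _ _))//.
rewrite opprD addrACA subrr addr0 -mulrBl normrM ler_piMr//.
rewrite ger0_norm ?mulr_ge0 ?addr_ge0 ?invr_ge0 ?exprn_ge0//.
rewrite ler_pdivrMr ?exprn_gt0 ?ltr0n// mul1r -natrX.
have : (Z.+1%:R : R) <= (M ^ k)%:R by rewrite ler_nat.
by rewrite -natr1; lra.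
Qed.

(** Here v numbers the cells kept at level k+1, [v %/ T] their parents, and j the subinterval of the
    parent that is kept. Several v may keep the same cell: cells are counted with multiplicity. *)
Definition deviation xi f k (X : nat -> nat) (v j : nat) : R :=
  wave xi f k.+1 (X (v %/ T)%N * M + j) -
  (\sum_(i < M) wave xi f k.+1 (X (v %/ T)%N * M + i)) / M%:R.

(** Parameters for [balancing]: 2^h bounds twice the size of the frequency net, and the square of
    [r k] is the number of choices. *)
Let h k := ((8 * b + a + 3) * k.+1)%N.
Let r k := (2 ^ (a * k.+1))%N.

Let rr k : (r k * r k = T ^ k.+1)%N.
Proof. by rewrite /r /T -expnM -[4%N]/(2 ^ 2)%N -expnM -expnD addnn -mul2n. Qed.

(** The bound on X is a premise inside the conclusion, so that choice applies to every pair (k, X)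
    before the recursively built positions are known to satisfy it. *)
Lemma salem_stage k (X : nat -> nat) : exists c : nat -> nat,
  (forall v, (c v < M)%N) /\
  ((forall w, (X w < M ^ k)%N) -> forall (xi : R) f,
    0 < xi <= (M ^ (4 * k.+1))%:R ->
    `|\sum_(v < T ^ k.+1) deviation xi f k X v (c v)| <=
      (4 * (h k).+1 + 2)%:R * (r k)%:R).
Proof.
have r0 : (0 < r k)%N by rewrite expn_gt0.
have r0' : 0 < (r k)%:R :> R by rewrite ltr0n.
(* Frequencies are sampled at multiples of 1/r. Rounding changes each of the r^2 deviations by at
   most 2/r, hence their sum by at most 2r, within the order of the main bound. *)
pose G := (M ^ (4 * k.+1) * r k).+1.
pose A v j (o : 'I_G * bool) := deviation (o.1%:R / (r k)%:R) o.2 k X v j.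
have M0' : M%:R != 0 :> R by rewrite pnatr_eq0 -lt0n.
have w1 xi f Z : `|wave xi f k.+1 Z| <= 1 by exact: cos_max.
have avg (F : nat -> R) (B : R) : (forall i, (i < M)%N -> `|F i| <= B) ->
    `|(\sum_(i < M) F i) / M%:R| <= B.
  move=> FB; rewrite normrM normfV (ger0_norm (ler0n _ M)) ler_pdivrMr ?ltr0n//.
  apply: (le_trans (ler_norm_sum _ _ _)).
  apply: (@le_trans _ _ (\sum_(i < M) B)); first by apply: ler_sum => i _; exact: FB.
  by rewrite sumr_const card_ord mulr_natr.
have A0 v o : \sum_(j < M) A v j o = 0.
  rewrite /A /deviation sumrB sumr_const card_ord -[X in _ - X]mulr_natr.
  by rewrite divfK// subrr.
have A2 v j o : `|A v j o| <= 2.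
  rewrite (le_trans (ler_normB _ _))// -[2]/(1 + 1) lerD//.
  by apply: (avg (fun i => wave (o.1%:R / (r k)%:R) o.2 k.+1
    (X (v %/ T)%N * M + i))) => i _.
have hOm : (#|{: 'I_G * bool}| * 2 <= 2 ^ h k)%N.
  rewrite card_prod card_ord card_bool -mulnA.
  apply: (@leq_trans (M ^ (4 * k.+1) * r k * 2 * 4)).
    have : (0 < M ^ (4 * k.+1) * r k)%N by rewrite muln_gt0 r0 expn_gt0 M0.
    by rewrite /G; move: (M ^ (4 * k.+1) * r k)%N => Y; lia.
  have -> : (M ^ (4 * k.+1) * r k * 2 * 4 = 2 ^ (8 * b * k.+1 + a * k.+1 + 3))%N.
    have -> : (M ^ (4 * k.+1) = 2 ^ (8 * b * k.+1))%N.
      by rewrite /M (_ : 4 ^ b = 2 ^ (2 * b))%N ?expnM// -!expnM; congr (2 ^ _)%N; lia.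
    by rewrite /r !expnD -mulnA.
  by rewrite leq_exp2l// /h; lia.
have [c [cM cb]] := balancing M0 r0 A0 A2 hOm.
exists c; split => // XM xi f /andP[xi0 xiM].
pose g := Num.truncn (xi * (r k)%:R).
have /andP[g1 g2] : g%:R <= xi * (r k)%:R < g.+1%:R.
  by apply: truncn_itv; rewrite mulr_ge0// ltW.
have gG : (g < G)%N.
  rewrite ltnS -(ler_nat R) (le_trans g1)// natrM ler_pM2r//.
have /= := cb (Ordinal gG, f); rewrite rr => cbg.
pose xg : R := g%:R / (r k)%:R.
have xd : `|xi - xg| <= (r k)%:R^-1.
  rewrite ger0_norm ?subr_ge0 ?ler_pdivrMr// lerBlDr.
  rewrite -[X in X + _]mul1r -mulrDl ler_pdivlMr// addrC natr1 ltW//.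
have lipd v j : (j < M)%N ->
    `|deviation xi f k X v j - deviation xg f k X v j| <= (r k)%:R^-1 *+ 2.
  move=> jM; have ZM i : (i < M)%N -> (X (v %/ T)%N * M + i < M ^ k.+1)%N.
    move=> iM; rewrite expnSr (@leq_trans ((X (v %/ T)%N).+1 * M))//.
      by rewrite mulSn addnC ltn_add2r.
    by rewrite leq_mul2r XM orbT.
  have -> : deviation xi f k X v j - deviation xg f k X v j =
    (wave xi f k.+1 (X (v %/ T)%N * M + j) - wave xg f k.+1 (X (v %/ T)%N * M + j)) -
    (\sum_(i < M) (wave xi f k.+1 (X (v %/ T)%N * M + i) -
                  wave xg f k.+1 (X (v %/ T)%N * M + i))) / M%:R.
    by rewrite /deviation sumrB mulrBl; ring.
  rewrite (le_trans (ler_normB _ _))// mulr2n lerD//.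
    by rewrite (le_trans (wave_lip _ _ _ (ZM j jM))).
  apply: (avg (fun i => wave xi f k.+1 (X (v %/ T)%N * M + i) -
                  wave xg f k.+1 (X (v %/ T)%N * M + i))) => i iM.
  by rewrite (le_trans (wave_lip _ _ _ (ZM i iM))).
rewrite natrD mulrDl.
have -> : \sum_(v < T ^ k.+1) deviation xi f k X v (c v) =
   \sum_(v < T ^ k.+1) deviation xg f k X v (c v) +
   \sum_(v < T ^ k.+1) (deviation xi f k X v (c v) - deviation xg f k X v (c v)).
  by rewrite -big_split; apply: eq_bigr => v _; rewrite /= addrC subrK.
rewrite (le_trans (ler_normD _ _))// lerD//.
  by rewrite (le_trans cbg)// natrM mulrAC.
apply: (le_trans (ler_norm_sum _ _ _)).
apply: (@le_trans _ _ (\sum_(v < T ^ k.+1) (r k)%:R^-1 *+ 2)).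
  by apply: ler_sum => v _; exact: lipd.
rewrite sumr_const card_ord -rr -mulrnA -[leLHS]mulr_natr !natrM.
by rewrite mulrCA mulKf ?gt_eqF.
Qed.

Lemma salem_positions : exists X : nat -> nat -> nat,
  [/\ forall k w, (X k w < M ^ k)%N,
      forall k v, (X k.+1 v %/ M)%N = X k (v %/ T)%N &
      forall k (xi : R) f, 0 < xi <= (M ^ (4 * k.+1))%:R ->
        `|\sum_(v < T ^ k.+1) (wave xi f k.+1 (X k.+1 v) -
          (\sum_(i < M) wave xi f k.+1 (X k (v %/ T)%N * M + i)) / M%:R)| <=
        ((4 * (8 * b + a + 3) + 6) * k.+1)%:R * 2 ^+ (a * k.+1)].
Proof.
have /choice[C CP] (kX : nat * (nat -> nat)) := salem_stage kX.1 kX.2.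
pose fix X k : nat -> nat := if k is k'.+1 then
  fun v => (X k' (v %/ T) * M + C (k', X k') v)%N else fun=> 0%N.
have XM k w : (X k w < M ^ k)%N.
  elim: k w => [|k ih] w; first by rewrite expn0.
  have [cM _] := CP (k, X k).
  rewrite /= expnSr (@leq_trans ((X k (w %/ T)%N).+1 * M))//.
    by rewrite mulSn addnC ltn_add2r.
  by rewrite leq_mul2r ih orbT.
exists X; split => // [k v|k xi f xiM].
  have [cM _] := CP (k, X k).
  by rewrite /= divnMDl// (divn_small (cM v)) addn0.
have [cM /= /(_ (XM k) xi f xiM)] := CP (k, X k).
move=> /le_trans; apply; rewrite /r natrX ler_wpM2r ?exprn_ge0// ler_nat /h; lia.
Qed.


(** * Fourier transforms of the level measures *)

Section fourier.
Variable X : nat -> nat -> nat.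
Hypothesis XM : forall k w, (X k w < M ^ k)%N.
Hypothesis Xdiv : forall k v, (X k.+1 v %/ M)%N = X k (v %/ T)%N.
Let C0 := (4 * (8 * b + a + 3) + 6)%N.
Hypothesis Xb : forall k (xi : R) f, 0 < xi <= (M ^ (4 * k.+1))%:R ->
  `|\sum_(v < T ^ k.+1) (wave xi f k.+1 (X k.+1 v) -
    (\sum_(i < M) wave xi f k.+1 (X k (v %/ T)%N * M + i)) / M%:R)| <=
  (C0 * k.+1)%:R * 2 ^+ (a * k.+1).

(** The cosine or sine transform of the uniform measure on the cells of level k. *)
Definition level_mean k xi f : R :=
  (\sum_(w < T ^ k) mean_cos xi (phase f) ((X k w)%:R * cell k) (cell k)) /
  (T ^ k)%:R.

Lemma mean_wave xi f k (Z : nat) : 0 < xi ->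
  mean_cos xi (phase f) (Z%:R * cell k) (cell k) =
  sinc (xi * cell k / 2) * wave xi f k Z.
Proof.
move=> xi0; rewrite mean_cosE; last by rewrite gt_eqF// mulr_gt0// cell_gt0.
by rewrite /wave [cell k / 2]mulrC mulrDl.
Qed.

Lemma sum_blocks (n : nat) (F : nat -> R) :
  \sum_(v < n * T) F (v %/ T)%N = (\sum_(w < n) F w) * T%:R.
Proof.
rewrite -(big_mkord xpredT (fun v => F (v %/ T)%N)) -(big_mkord xpredT F).
elim: n => [|n ih]; first by rewrite mul0n !big_nil mul0r.
rewrite (@big_cat_nat _ _ _ (n * T))//=; last by rewrite leq_mul2r leqnSn orbT.
rewrite ih big_nat_recr//= mulrDl; congr (_ + _).
rewrite big_nat (eq_bigr (fun=> F n)); last first.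
  move=> v /andP[nv vn]; congr F; apply/eqP; rewrite eqn_leq.
  by rewrite -ltnS ltn_divLR// vn leq_divRL.
by rewrite -big_nat sumr_const_nat mulSn addnK mulr_natr.
Qed.

(** Cutting parents into M subcells does not change the measure of level k. Both levels are then
    averages over cells of one length, which share the sinc factor. *)
Lemma level_meanS k xi f : 0 < xi ->
  level_mean k.+1 xi f - level_mean k xi f = sinc (xi * cell k.+1 / 2) *
   (\sum_(v < T ^ k.+1) (wave xi f k.+1 (X k.+1 v) -
    (\sum_(i < M) wave xi f k.+1 (X k (v %/ T)%N * M + i)) / M%:R)) /
   (T ^ k.+1)%:R.
Proof.
move=> xi0; have xiL : xi * cell k.+1 != 0 by rewrite gt_eqF// mulr_gt0// cell_gt0.
have -> : level_mean k xi f = (\sum_(v < T ^ k.+1)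
    mean_cos xi (phase f) ((X k (v %/ T)%N)%:R * cell k) (cell k)) / (T ^ k.+1)%:R.
  rewrite expnSr (sum_blocks _ (fun w => mean_cos xi (phase f) ((X k w)%:R * cell k) (cell k))).
  rewrite /level_mean natrM; field.
  by rewrite !pnatr_eq0 -!lt0n T0 expn_gt0 T0.
rewrite /level_mean -mulrBl -sumrB; congr (_ / _).
rewrite mulr_sumr; apply: eq_bigr => v _.
rewrite mean_wave// mulrBr; congr (_ - _).
rewrite -cellS mean_cos_split// [RHS]mulrA mulr_sumr; congr (_ / _).
apply: eq_bigr => i _; rewrite -mean_wave//; congr mean_cos.
by rewrite natrD natrM mulrDl mulrA.
Qed.

(** Factor per level in the bound for consecutive differences: the cell length 4^(-b) contributes
    2^(bq) and the cancellation among 4^a choices 2^(-a). It is below 1 exactly for q < a/b. *)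
Definition ratio (q : R) : R := 2 `^ (b%:R * q - a%:R).

Lemma ratio_exp q k : ratio q ^+ k = 2 `^ ((b%:R * q - a%:R) * k%:R).
Proof. by rewrite /ratio powRrM powR_mulrn// powR_ge0. Qed.

Lemma pow2E n : 2 ^+ n = 2 `^ n%:R :> R.
Proof. by rewrite powR_mulrn. Qed.

Lemma cellE k : cell k = 2 `^ (- (2 * b%:R * k%:R)).
Proof.
rewrite /cell powRN; congr (_^-1).
have -> : M%:R = 2 ^+ (2 * b) :> R by rewrite /M -natrX expnM.
by rewrite -exprM pow2E !natrM.
Qed.

Lemma TE k : (T ^ k)%:R = 2 `^ (2 * a%:R * k%:R) :> R.
Proof.
have -> : (T ^ k)%:R = 2 ^+ (2 * a * k) :> R.
  by rewrite /T -[4%N]/(2 ^ 2)%N -!expnM natrX ?mulnA.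
by rewrite pow2E !natrM.
Qed.

Lemma level_diff_le k xi f q : 0 < xi -> 0 <= q <= 1 ->
  `|level_mean k.+1 xi f - level_mean k xi f| <=
  2 * C0%:R * (k.+1%:R * ratio q ^+ k.+1) * xi `^ (- q / 2).
Proof.
move=> xi0 /andP[q0 q1]; rewrite level_meanS// 2!normrM.
set D := \sum_(v < _) _.
have two0 : 0 < 2 :> R by [].
have two_ne (x y : R) : (x + y == 0) ==> (2 != 0 :> R) by apply/implyP.
have xi_ne (x y : R) : (x + y == 0) ==> (xi != 0) by apply/implyP => _; rewrite gt_eqF.
have q2 : 0 <= q / 2 <= 1 by lra.
have c0 : 0 < xi * cell k.+1 / 2 by rewrite divr_gt0// mulr_gt0// cell_gt0.
have TT : `|((T ^ k.+1)%:R : R)^-1| = 2 `^ (- (2 * a%:R * k.+1%:R)).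
  by rewrite TE ger0_norm ?invr_ge0 ?powR_ge0// powRN.
(* Up to the cutoff the balanced choice applies. Beyond it the average deviation is just bounded by
   2, and sinc alone provides the decay. *)
have [xiM|xiM] := leP xi (M ^ (4 * k.+1))%:R.
  have h1 : `|D| <= (C0 * k.+1)%:R * 2 ^+ (a * k.+1) by apply: Xb; rewrite xi0.
  have h2 := sinc_powR c0 q2.
  have e2 : (xi * cell k.+1 / 2) `^ (- (q / 2)) <=
      2 * (2 `^ (b%:R * q * k.+1%:R) * xi `^ (- q / 2)).
    have -> : - (q / 2) = - q / 2 by rewrite mulNr.
    have cge := ltW (cell_gt0 k.+1).
    rewrite powRM ?invr_ge0 ?mulr_ge0 ?(ltW xi0)// powRM ?(ltW xi0)//.
    have -> : cell k.+1 `^ (- q / 2) = 2 `^ (b%:R * q * k.+1%:R).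
      by rewrite cellE -powRrM; congr (_ `^ _); field.
    set A := xi `^ _; set B := 2 `^ _.
    have -> : 2 * (B * A) = A * B * 2 by ring.
    rewrite ler_wpM2l ?mulr_ge0 ?powR_ge0//.
    rewrite -[X in X `^ _](powR_inv1 (ltW two0)) -powRrM.
    have -> : -1 * (- q / 2) = q / 2 by field.
    by apply: ler1_powR; [rewrite ler1n|case/andP: q2].
  have := ler_pM (normr_ge0 _) (normr_ge0 _) (le_trans h2 e2) h1.
  move=> /(ler_wpM2r (powR_ge0 2 (- (2 * a%:R * k.+1%:R)))).
  rewrite TT => /le_trans; apply.
  rewrite le_eqVlt; apply/orP; left; apply/eqP.
  rewrite pow2E ratio_exp.
  have -> : (b%:R * q - a%:R) * k.+1%:R = b%:R * q * k.+1%:R + ((a * k.+1)%:R +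
     - (2 * a%:R * k.+1%:R)) by rewrite natrM; ring.
  by rewrite !powRD// natrM; ring.
have hD : `|D| <= 2 * (T ^ k.+1)%:R.
  apply: (le_trans (ler_norm_sum _ _ _)).
  apply: (@le_trans _ _ (\sum_(v < T ^ k.+1) 2)); last first.
    by rewrite sumr_const card_ord -[leLHS]mulr_natr.
  apply: ler_sum => v _; rewrite (le_trans (ler_normB _ _))// -[2]/(1 + 1) lerD//.
    exact: cos_max.
  rewrite normrM normfV (ger0_norm (ler0n _ M)) ler_pdivrMr ?ltr0n//.
  apply: (le_trans (ler_norm_sum _ _ _)).
  apply: (@le_trans _ _ (\sum_(j < M) 1)); first by apply: ler_sum => i _; exact: cos_max.
  by rewrite sumr_const card_ord mul1r.
have Tk0 : 0 < (T ^ k.+1)%:R :> R by rewrite ltr0n expn_gt0 T0.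
have hDT : `|D| * `|((T ^ k.+1)%:R : R)^-1| <= 2.
  by rewrite [X in _ * X]ger0_norm ?invr_ge0 ?(ltW Tk0)// ler_pdivrMr.
rewrite -mulrA.
have h2 := sinc_le c0.
have := ler_pM (normr_ge0 _) (mulr_ge0 (normr_ge0 _) (normr_ge0 _)) h2 hDT.
move=> /le_trans; apply.
have -> : (xi * cell k.+1 / 2)^-1 * 2 = 4 * ((cell k.+1)^-1 * xi^-1).
  by field; rewrite !gt_eqF ?cell_gt0.
have C4 : 4 <= 2 * C0%:R :> R.
  have : 6%:R <= C0%:R :> R by rewrite ler_nat leq_addl.
  by lra.
rewrite -[leRHS]mulrA; apply: ler_pM => //.
  by rewrite mulr_ge0// invr_ge0 ltW// cell_gt0.
have M4 : (M ^ (4 * k.+1))%:R = (cell k.+1) `^ (-4) :> R.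
  rewrite powRN -[4]/(4%:R) powR_mulrn ?(ltW (cell_gt0 _))//.
  by rewrite /cell exprVn invrK -exprM natrX mulnC.
have xi1 : 1 <= xi.
  by rewrite (le_trans _ (ltW xiM))// ler1n expn_gt0 M0.
(* Here xi > cell^(-4) and q <= 1, so half of the power xi^(-1) gives xi^(-q/2) and the other half
   cell^2: one factor cell cancels 1/cell, the other is the geometric gain. *)
have x1 : xi^-1 <= xi `^ (- q / 2) * (cell k.+1) ^+ 2.
  apply: (@le_trans _ _ (xi `^ (- q / 2) * xi `^ (- 2^-1))).
    rewrite -powRD// -[leLHS]powR_inv1 ?(ltW xi0)//; apply: ler_powR => //; lra.
  rewrite ler_wpM2l ?powR_ge0//.
  have -> : cell k.+1 ^+ 2 = ((M ^ (4 * k.+1))%:R) `^ (- 2^-1).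
    by rewrite M4 -powRrM -powR_mulrn ?(ltW (cell_gt0 _))//; congr (_ `^ _); field.
  rewrite !powRN lef_pV2 ?posrE ?powR_gt0 ?ltr0n ?expn_gt0 ?M0//.
  by apply: ge0_ler_powR; rewrite ?nnegrE ?invr_ge0 ?(ltW xi0) ?(ltW xiM) ?ler0n.
apply: (@le_trans _ _ ((cell k.+1)^-1 * (xi `^ (- q / 2) * cell k.+1 ^+ 2))).
  by rewrite ler_wpM2l// invr_ge0 ltW// cell_gt0.
have -> : (cell k.+1)^-1 * (xi `^ (- q / 2) * cell k.+1 ^+ 2) =
    cell k.+1 * xi `^ (- q / 2).
  by field; rewrite gt_eqF// cell_gt0.
rewrite ler_wpM2r ?powR_ge0// (@le_trans _ _ (ratio q ^+ k.+1))//.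
  rewrite cellE ratio_exp; apply: ler_powR; first by rewrite ler1n.
  rewrite -mulNr ler_wpM2r//.
  have /andP[_ /ltnW aleb] := ab; have : a%:R <= b%:R :> R by rewrite ler_nat.
  have : 0 <= b%:R * q by rewrite mulr_ge0.
  have : 0 <= b%:R :> R by []. lra.
by rewrite ler_peMl ?exprn_ge0 ?powR_ge0// ler1n.
Qed.

Lemma ratio_lt1 q : 0 <= q -> q < a%:R / b%:R -> 0 < ratio q < 1.
Proof.
move=> q0 qab; rewrite powR_gt0//=.
have b0 : 0 < b%:R :> R by rewrite ltr0n; case/andP: ab => _; apply: leq_trans.
have : 0 < a%:R - b%:R * q by rewrite subr_gt0 mulrC -ltr_pdivlMr.
move=> d0; rewrite /ratio -opprB powRN invf_lt1 ?powR_gt0//.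
have : 1 `^ (a%:R - b%:R * q) < 2 `^ (a%:R - b%:R * q).
  by apply: gt0_ltr_powR; rewrite ?nnegrE ?ler01 ?ler0n ?ltr1n.
by rewrite powR1.
Qed.

Lemma level_mean_le q : 0 <= q -> q < a%:R / b%:R ->
  exists2 C : R, 0 < C & forall K xi f, 0 < xi ->
    `|level_mean K xi f| <= C * xi `^ (- q / 2).
Proof.
move=> q0 qab; have /andP[r0 r1] := ratio_lt1 q0 qab.
have q1 : q <= 1.
  rewrite ltW// (lt_le_trans qab)// ler_pdivrMr ?mul1r ?ler_nat ?ltr0n.
    by apply: ltnW; case/andP: ab.
  by case/andP: ab => _; apply: leq_trans.
(* Lies strictly between 1 and 1/ratio: powers of z absorb k+1 while z * ratio stays below 1. *)
pose z := 2 / (1 + ratio q).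
have z1 : 1 < z by rewrite ltr_pdivlMr ?mul1r; lra.
have [C1 C10 HC1] := linear_le_geometric z1.
have zr : 0 <= z * ratio q < 1.
  rewrite mulr_ge0 ?(ltW r0)//=; last by rewrite divr_ge0//; lra.
  by rewrite /z mulrAC ltr_pdivrMr; lra.
pose C2 := C1 * ratio q * (1 - z * ratio q)^-1.
have zr1 : 0 < 1 - z * ratio q by case/andP: zr; rewrite subr_gt0.
have C20 : 0 < C2 by apply: mulr_gt0; [exact: mulr_gt0|rewrite invr_gt0].
have sumC2 K : \sum_(k < K) k.+1%:R * ratio q ^+ k.+1 <= C2.
  apply: (@le_trans _ _ (\sum_(k < K) C1 * ratio q * (z * ratio q) ^+ k)).
    apply: ler_sum => k _; rewrite exprS mulrCA exprMn.
    have -> : C1 * ratio q * (z ^+ k * ratio q ^+ k) =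
      ratio q * (C1 * z ^+ k * ratio q ^+ k) by ring.
    by rewrite ler_pM2l// ler_wpM2r// exprn_ge0// ltW.
  rewrite -mulr_sumr ler_wpM2l ?mulr_ge0 ?(ltW r0) ?(ltW C10)//.
  exact: geometric_sum_le.
have C00 : 0 <= 2 * C0%:R :> R by rewrite mulr_ge0.
exists (2 + 2 * C0%:R * C2).
  by rewrite ltr_pwDl// mulr_ge0// ltW.
move=> K xi f xi0.
have -> : level_mean K xi f = level_mean 0 xi f +
    \sum_(k < K) (level_mean k.+1 xi f - level_mean k xi f).
  rewrite -(big_mkord xpredT (fun k => level_mean k.+1 xi f - level_mean k xi f)).
  by rewrite (telescope_sumr (fun k => level_mean k xi f))// addrC subrK.
rewrite (le_trans (ler_normD _ _))// mulrDl lerD//.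
  rewrite /level_mean expn0 big_ord_recl big_ord0 addr0 divr1 mean_wave// normrM.
  rewrite (@le_trans _ _ `|sinc (xi * cell 0 / 2)|)//.
    by rewrite ler_piMr//; exact: cos_max.
  rewrite /cell expr0 invr1 mulr1.
  have q2 : 0 <= q / 2 <= 1 by lra.
  rewrite (le_trans (sinc_powR _ q2)) ?divr_gt0// powRM ?invr_ge0 ?(ltW xi0)//.
  rewrite mulrC -mulNr ler_wpM2r ?powR_ge0//.
  rewrite -[X in X `^ _](powR_inv1 (ler0n _ 2)) -powRrM.
  have -> : -1 * (- q / 2) = q / 2 by field.
  by apply: ler1_powR; [rewrite ler1n|case/andP: q2].
apply: (le_trans (ler_norm_sum _ _ _)).
apply: (@le_trans _ _ (\sum_(k < K) 2 * C0%:R * (k.+1%:R * ratio q ^+ k.+1) *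
   xi `^ (- q / 2))).
  by apply: ler_sum => k _; apply: level_diff_le => //; rewrite q0.
by rewrite -mulr_suml ler_wpM2r ?powR_ge0// -mulr_sumr ler_wpM2l.
Qed.

End fourier.

(** Replaces cells by point masses at their left end points; the error tends to 0 for each fixed
    frequency, as [weak_limit_decay] asks. *)
Lemma mean_approx X k xi f : 0 < xi ->
  `|level_mean X k xi f - (\sum_(w < T ^ k) cos (xi * ((X k w)%:R * cell k) + phase f)) /
    (T ^ k)%:R| <= xi * cell k.
Proof.
move=> xi0; rewrite /level_mean -mulrBl -sumrB normrM normfV.
rewrite (ger0_norm (ler0n _ (T ^ k))).
have Tk0 : 0 < (T ^ k)%:R :> R by rewrite ltr0n expn_gt0 T0.
rewrite ler_pdivrMr//; apply: (le_trans (ler_norm_sum _ _ _)).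
apply: (@le_trans _ _ (\sum_(w < T ^ k) xi * cell k)).
  by apply: ler_sum => w _; apply: mean_cos_approx => //; exact: cell_gt0.
by rewrite sumr_const card_ord mulr_natr.
Qed.

Lemma cell_le k : cell k <= k.+1%:R^-1.
Proof.
have M1 : (1 < M)%N by rewrite -{1}(expn0 4) ltn_exp2l//; case/andP: ab => _; apply: leq_trans.
rewrite /cell lef_pV2 ?posrE ?ltr0n ?exprn_gt0 ?ltr0n//.
by rewrite -natrX ler_nat ltn_expl.
Qed.

(** * The limit set and its dimension *)

Section limit_set.
Variable X : nat -> nat -> nat.
Hypothesis XM : forall k w, (X k w < M ^ k)%N.
Hypothesis Xdiv : forall k v, (X k.+1 v %/ M)%N = X k (v %/ T)%N.

Definition level_set k : set R := [set x | exists2 w, (w < T ^ k)%N &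
  (X k w)%:R * cell k <= x <= (X k w).+1%:R * cell k].

Lemma level_set_closed k : closed (level_set k).
Proof.
rewrite (_ : level_set k = \bigcup_(w in `I_(T ^ k))
    [set` `[((X k w)%:R * cell k), ((X k w).+1%:R * cell k)]]).
  by apply: closed_bigcup => // w _; exact: interval_closed.
apply/seteqP; split => x.
  by move=> [w wT xw]; exists w => //=; rewrite in_itv.
by move=> [w /= wT]; rewrite in_itv/= => xw; exists w.
Qed.

Lemma level_setS k : level_set k.+1 `<=` level_set k.
Proof.
move=> x [v vT /andP[x1 x2]]; exists (v %/ T)%N.
  by rewrite ltn_divLR// -expnSr.
rewrite -Xdiv -cellS !mulrA -!natrM; set Z := X k.+1 v in x1 x2 *.
have c0 := cell_gt0 k.+1.
apply/andP; split.
  by apply: le_trans x1; rewrite ler_pM2r// ler_nat leq_divM.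
by apply: (le_trans x2); rewrite ler_pM2r// ler_nat ltn_ceil.
Qed.

Lemma level_set_le k l : (k <= l)%N -> level_set l `<=` level_set k.
Proof.
move=> /subnK <-; elim: (l - k)%N => // i ih; rewrite addSn.
exact: subset_trans (@level_setS _) ih.
Qed.

Definition limit_set : set R := \bigcap_k level_set k.

Lemma limit_set_closed : closed limit_set.
Proof. by apply: closed_bigI => k _; exact: level_set_closed. Qed.

Lemma level_set01 k : level_set k `<=` `[0, 1]%classic.
Proof.
move=> x /(level_set_le (leq0n k)) [w].
rewrite expn0 ltnS leqn0 => /eqP ->.
have := XM 0 0; rewrite expn0 ltnS leqn0 => /eqP ->.
by rewrite /= in_itv/= /cell expr0 invr1 mul0r mul1r.
Qed.

Lemma limit_set_null s : a%:R / b%:R < s -> null s limit_set.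
Proof.
move=> abs.
have b0 : 0 < b%:R :> R by rewrite ltr0n; case/andP: ab => _; apply: leq_trans.
have s0 : 0 < s by apply: le_lt_trans abs; rewrite divr_ge0// ltW.
apply: null_finite_covers => // e e0.
(* y = 4^(bs - a), so that T^k cells of length [cell k] have s-weight y^(-k). Below, balls are
   centred at left end points and open, hence the radius 2 * [cell k]. *)
pose y : R := 2 `^ (2 * (b%:R * s - a%:R)).
have y1 : 1 < y.
  have d0 : 0 < 2 * (b%:R * s - a%:R).
    by rewrite mulr_gt0// subr_gt0 mulrC -ltr_pdivrMr.
  have : 1 `^ (2 * (b%:R * s - a%:R)) < y.
    by apply: gt0_ltr_powR; rewrite ?nnegrE ?ler01 ?ler0n ?ltr1n.
  by rewrite powR1.
have [C C0 HC] := linear_le_geometric y1.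
pose k := Num.truncn (2 `^ s * C / e).
exists [seq (X k w)%:R * cell k | w <- iota 0 (T ^ k)], (2 * cell k); split.
- by rewrite mulr_ge0// ltW// cell_gt0.
- rewrite size_map size_iota powRM ?(ltW (cell_gt0 _))// mulrCA.
  have -> : (T ^ k)%:R * cell k `^ s = (y ^+ k)^-1.
    rewrite TE cellE -powRrM -powRD; last by apply/implyP.
    rewrite /y powR_exp// -powR_mulrn// -powRrM -powRN; congr (_ `^ _); ring.
  rewrite ler_pdivrMr ?exprn_gt0 ?powR_gt0// -(ler_pM2l C0).
  have kt : 2 `^ s * C / e < k.+1%:R by exact: Num.Theory.truncnS_gt.
  have := lt_le_trans kt (HC k); rewrite ltr_pdivrMr// => /ltW ke.
  by rewrite mulrC (le_trans ke)// mulrAC mulrA.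
- move=> x /(_ k I) [w wT /andP[x1 x2]]; exists ((X k w)%:R * cell k).
    by apply/mapP; exists w => //; rewrite mem_iota add0n.
  rewrite distrC ger0_norm ?subr_ge0//.
  move: x2; rewrite -natr1 mulrDl mul1r => x2; have := cell_gt0 k; lra.
Qed.

End limit_set.

Lemma salem_set : exists S : set R, [/\ closed S, S `<=` `[0, 1]%classic,
  forall s, a%:R / b%:R < s -> null s S & exists P : prob R, P (~` S) = 0%E /\
    forall q, 0 <= q -> q < a%:R / b%:R -> exists2 c, 0 < c & decay P q c].
Proof.
have [X [XM Xdiv Xb]] := salem_positions.
exists (limit_set X); split.
- exact: limit_set_closed.
- by move=> x /(_ 0%N I); exact: level_set01.
- exact: limit_set_null.
have TN k : (T ^ k = (T ^ k).-1.+1)%N by rewrite prednK// expn_gt0 T0.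
have /choice[mu muP] k := unif_points (T ^ k).-1 (fun w => (X k w)%:R * cell k).
have muE k g : bmeas g -> \int[mu k]_x g x =
    (\sum_(w < T ^ k) g ((X k w)%:R * cell k)) / (T ^ k)%:R.
  by move=> bg; rewrite muP// -TN.
have mu0 k l : (k <= l)%N -> mu l (~` level_set X k) = 0%E.
  move=> kl; have mL : measurable (~` level_set X k).
    by apply: measurableC; apply: closed_measurable; exact: level_set_closed.
  have : \int[mu l]_x \1_(~` level_set X k) x = 0.
    rewrite muE; last exact: bmeas_indic.
    rewrite big1 ?mul0r// => w _; rewrite indicE memNset// => nL; apply: nL.
    apply: (level_set_le Xdiv kl); exists w => //; rewrite lexx/=.
    by rewrite ler_pM2r ?cell_gt0// ler_nat.
  rewrite bint_indic// => m0; rewrite -[LHS]fineK ?m0//; exact: fin_num_measure.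
have [|nu [phi [phik cv]]] := @prokhorov01 R mu.
  move=> n; have mL : measurable (level_set X 0).
    by apply: closed_measurable; exact: level_set_closed.
  apply/eqP; rewrite eq_le measure_ge0 andbT -(mu0 0 n (leq0n n)) le_measure ?inE//.
  - exact: measurableC.
  - exact: measurableC.
  - by apply: subsetC; exact: level_set01.
exists nu; split.
  have -> : ~` limit_set X = \bigcup_k ~` level_set X k by rewrite /limit_set setC_bigcap.
  have nuk k : nu (~` level_set X k) = 0%E.
    apply: (closed_weak_limit (mu := mu \o phi)) cv; first exact: level_set_closed.
    by exists k => n kn; apply: mu0; exact: leq_trans (phik n).
  apply/eqP; rewrite eq_le measure_ge0 andbT.
  apply: prob_bigcup_le => [k|n].
    by apply: measurableC; apply: closed_measurable; exact: level_set_closed.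
  by rewrite big1// => k _; rewrite nuk.
move=> q q0 qab; have [C C0 HC] := level_mean_le Xb q0 qab.
exists C => //.
apply: (weak_limit_decay (mu := mu) (phi := phi) (err := fun n xi => `|xi| * cell n)) => //.
  move=> xi e e0; exists (Num.truncn (`|xi| / e)) => n Nn.
  rewrite (le_trans (ler_wpM2l _ (cell_le n)))// ler_pdivrMr// mulrC -ler_pdivrMr//.
  by rewrite ltW// (lt_le_trans (Num.Theory.truncnS_gt _))// ler_nat ltnS.
move=> n xi xi0; have nxi0 : 0 < `|xi| by rewrite normr_gt0.
(* [level_mean_le] is about positive frequencies; evenness of cosine and oddness of sine reduce xi
   to |xi|. *)
have bound f : `|(\sum_(w < T ^ n) cos (`|xi| * ((X n w)%:R * cell n) + phase f)) /
    (T ^ n)%:R| <= C * `|xi| `^ (- q / 2) + `|xi| * cell n.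
  rewrite -[X in `|X|](subrK (level_mean X n `|xi| f)) addrC.
  rewrite (le_trans (ler_normD _ _))// lerD//; first exact: HC.
  by rewrite distrC; exact: mean_approx.
split.
  rewrite muE; last exact: bmeas_cosZ.
  have := bound false; rewrite /phase; under eq_bigr do rewrite addr0.
  move=> /(le_trans _); apply; rewrite le_eqVlt; apply/orP; left; apply/eqP.
  congr (`|_ / _|); apply: eq_bigr => w _.
  have xw0 : 0 <= (X n w)%:R * cell n by rewrite mulr_ge0// ltW// cell_gt0.
  by rewrite -[LHS]cos_norm normrM (ger0_norm xw0).
rewrite muE; last exact: bmeas_sinZ.
have := bound true; rewrite /phase; under eq_bigr do rewrite cosBpihalf.
move=> /(le_trans _); apply; rewrite le_eqVlt; apply/orP; left; apply/eqP.
have [x0|x0] := leP 0 xi; first by rewrite (ger0_norm x0).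
rewrite (ltr0_norm x0); under [in RHS]eq_bigr do rewrite mulNr sinN.
by rewrite sumrN mulNr normrN.
Qed.

End salem_positions.

(** * Cantor schemes *)

Section nested.
Variable R : realType.

Lemma nested_compact (F : nat -> set R) : compact (F 0%N) ->
  (forall n, closed (F n)) -> (forall n, F n.+1 `<=` F n) ->
  (forall n, F n !=set0) -> \bigcap_n F n !=set0.
Proof.
move=> cF clF FS /choice[y yF].
have Fle m n : (m <= n)%N -> F n `<=` F m.
  move=> /subnK <-; elim: (n - m)%N => // i ih; rewrite addSn.
  exact: subset_trans (FS _) ih.
have F0 : (y @ \oo) (F 0%N) by exists 0%N => // n _; exact: (Fle 0%N n) (yF n).
have [p [_ clp]] := cF (y @ \oo) (fmap_proper_filter y _) F0.
exists p => m _; apply: contrapT => np.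
have yFm : (y @ \oo) (F m) by exists m => // n /= mn; exact: (Fle m n) (yF n).
have np' : nbhs p (~` F m).
  by apply: open_nbhs_nbhs; split => //; exact: closed_openC.
by have [z []] := clp _ _ yFm np'.
Qed.

Lemma closed01_compact (A : set R) (a b : R) : closed A -> A `<=` `[a, b]%classic ->
  compact A.
Proof. by move=> cA; apply: subclosed_compact => //; exact: segment_compact. Qed.

Lemma closed_affine (A : set R) (a r : R) : compact A ->
  closed [set a + r * z | z in A].
Proof.
move=> cA; apply: compact_closed; first exact: norm_hausdorff.
apply: continuous_compact => //; apply: continuous_subspaceT => z.
by apply: cvgD; [exact: cvg_cst|apply: cvgM; [exact: cvg_cst|exact: cvg_id]].
Qed.

Lemma closed_seqU (T : topologicalType) (I : eqType) (l : seq I) (F : I -> set T) :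
  (forall i, closed (F i)) -> closed [set y | exists2 i, i \in l & F i y].
Proof.
move=> cF; elim: l => [|i l ih].
  rewrite (_ : mkset _ = set0); first exact: closed0.
  by apply/seteqP; split => // y [].
rewrite (_ : mkset _ = F i `|` [set y | exists2 j, j \in l & F j y]).
  exact: closedU.
apply/seteqP; split => y.
  by move=> [j]; rewrite inE => /predU1P[->|jl] Fy; [left|right; exists j].
by move=> [Fy|[j jl Fy]]; [exists i; rewrite ?mem_head|exists j; rewrite // inE jl orbT].
Qed.

End nested.

(** * The scheme driven by a bit sequence *)

Section cantor_family.
Variables (R : realType) (S : set R).
Hypotheses (cS : closed S) (S01 : S `<=` `[0, 1]%classic) (S0 : S !=set0).

(** One point of S per dyadic interval meeting S, and a default point of S for the others, so that
    the size is exactly 2^n. *)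
Lemma dyadic_net n : exists N : seq R, [/\ size N = (2 ^ n)%N,
  forall s, s \in N -> S s & forall t, S t -> exists2 s, s \in N & `|t - s| <= 2 ^- n].
Proof.
have [s0 Ss0] := S0.
have /choice[p pP] (j : nat) : exists p, S p /\
    ((exists2 t, S t & j%:R <= t * 2 ^+ n <= j.+1%:R) ->
     j%:R <= p * 2 ^+ n <= j.+1%:R).
  have [[t St jt]|nt] := pselect (exists2 t, S t & j%:R <= t * 2 ^+ n <= j.+1%:R).
    by exists t.
  by exists s0.
have n0 : 0 < 2 ^+ n :> R by rewrite exprn_gt0.
exists [seq p j | j <- iota 0 (2 ^ n)]; split.
- by rewrite size_map size_iota.
- by move=> _ /mapP[j _ ->]; case: (pP j).
move=> t St; have := S01 St; rewrite /= in_itv/= => /andP[t0 t1].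
have [j jn jt] : exists2 j, (j < 2 ^ n)%N & j%:R <= t * 2 ^+ n <= j.+1%:R.
  have tn0 : 0 <= t * 2 ^+ n by rewrite mulr_ge0// ltW.
  have /andP[k1 k2] := truncn_itv tn0; set k := Num.truncn _ in k1 k2.
  have [kn|nk] := ltnP k (2 ^ n); first by exists k => //; rewrite k1 ltW.
  exists (2 ^ n).-1; first by rewrite prednK ?expn_gt0.
  rewrite prednK ?expn_gt0// natrX ler_piMl ?(ltW n0)// andbT.
  by apply: le_trans k1; rewrite ler_nat (leq_trans _ nk)// leq_pred.
exists (p j); first by apply/mapP; exists j => //; rewrite mem_iota.
have [_ /(_ (ex_intro2 _ _ t St jt))] := pP j.
case/andP: jt => j1 j2 /andP[p1 p2].
have : `|(t - p j) * 2 ^+ n| <= 1.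
  by rewrite mulrBl ler_norml; move: j2 p2; rewrite -natr1; lra.
by rewrite normrM (gtr0_norm n0) -ler_pdivlMr// mul1r.
Qed.

Let N n : seq R := projT1 (cid (dyadic_net n)).
Let size_N n : size (N n) = (2 ^ n)%N.
Proof. by rewrite /N; case: cid => ? []. Qed.
Let N_S n s : s \in N n -> S s.
Proof. by rewrite /N; case: cid => l [h1 h2 h3] /=; exact: h2. Qed.
Let N_net n t : S t -> exists2 s, s \in N n & `|t - s| <= 2 ^- n.
Proof. by rewrite /N; case: cid => l [h1 h2 h3] /=; exact: h3. Qed.

(** The cubic exponent beats the number of base points: 2^((n+1)^2) * delta^s tends to 0 for every s
    > 0. *)
Let delta (n : nat) : R := 2 ^- (n.+1 ^ 3).

Let delta_gt0 n : 0 < delta n.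
Proof. by rewrite invr_gt0 exprn_gt0. Qed.

Let delta_le n : delta n <= 2 ^- n.+1.
Proof.
rewrite lef_pV2 ?posrE ?exprn_gt0// ler_eXn2l ?ltr1n//.
by rewrite expnS leq_pmulr// expn_gt0.
Qed.

(* The state after reading [n] bits: base points and a scale.  While zeros are
   read the current approximation [base + scale * S] is kept; a one replaces S by
   tiny copies of itself at the points of a finite net. *)
Fixpoint state (x : nat -> bool) (n : nat) : seq R * R :=
  if n is k.+1 then
    let: (A, r) := state x k in
    if x k then ([seq a + r * s | a <- A, s <- N k], r * delta k) else (A, r)
  else ([:: 0], 1).

(** The margin 2^-n leaves room around each net point for the copy that a one may put there. It
    makes the stages nested, although the unthickened copies of S are not. *)
Let thick n : set R := [set z | exists2 s, S s & s <= z <= s + 2 ^- n].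

Definition stage_set x n : set R := [set y | exists2 a, a \in (state x n).1 &
  [set a + (state x n).2 * z | z in thick n] y].

Definition family x : set R := \bigcap_n stage_set x n.

Let scale_gt0 x n : 0 < (state x n).2.
Proof.
elim: n => //= n; case: (state x n) => A r /= r0.
by case: ifP => //= _; rewrite mulr_gt0.
Qed.

Let scale_le1 x n : (state x n).2 <= 1.
Proof.
elim: n => //= n; have := scale_gt0 x n; case: (state x n) => A r /= r0 r1.
case: ifP => //= _; rewrite mulr_ile1 ?(ltW r0) ?(ltW (delta_gt0 n))//.
by rewrite (le_trans (delta_le n))// invf_le1 ?exprn_gt0// exprn_ege1// ler1n.
Qed.

Let size_base x n : (size (state x n).1 <= 2 ^ (n * n))%N.
Proof.
elim: n => //= n; case: (state x n) => A r /= sA; case: ifP => _ /=.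
  rewrite size_allpairs size_N (leq_trans (leq_mul sA (leqnn _)))//.
  by rewrite -expnD leq_exp2l//; lia.
by rewrite (leq_trans sA)// leq_exp2l//; lia.
Qed.

Let thick02 n z : thick n z -> 0 <= z <= 2.
Proof.
move=> [s /S01 + /andP[z1 z2]]; rewrite /= in_itv/= => /andP[s0 s1].
have : 2 ^- n <= 1 :> R by rewrite invf_le1 ?exprn_gt0// exprn_ege1// ler1n.
by move=> ?; apply/andP; split; lra.
Qed.

Let thick_closed n : closed (thick n).
Proof.
have cI : compact (`[0, 1]%classic : set R) by exact: segment_compact.
have cT := compact_setX (closed01_compact cS S01) cI.
rewrite (_ : thick n = (fun p : R * R => p.1 + 2 ^- n * p.2) @` (S `*` `[0, 1]%classic)).
  apply: compact_closed; first exact: norm_hausdorff.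
  apply: continuous_compact => //; apply: continuous_subspaceT => p.
  apply: cvgD; first exact: cvg_fst.
  by apply: cvgM; [exact: cvg_cst|exact: cvg_snd].
have n0 : 0 < 2 ^- n :> R by rewrite invr_gt0 exprn_gt0.
apply/seteqP; split => z.
  move=> [s Ss /andP[z1 z2]]; exists (s, (z - s) / 2 ^- n) => /=.
    split => //=; rewrite in_itv/= divr_ge0 ?subr_ge0 ?(ltW n0)//=.
    by rewrite ler_pdivrMr// mul1r lerBlDl.
  by rewrite mulrC divfK ?gt_eqF// addrC subrK.
move=> [[s u] /= [Ss]]; rewrite in_itv/= => /andP[u0 u1] <-; exists s => //.
by rewrite lerDl mulr_ge0 ?(ltW n0)//= lerD2l ler_piMr// ltW.
Qed.

Let thick_compact n : compact (thick n).
Proof.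
apply: (@closed01_compact _ _ 0 2) => // z /thick02.
by rewrite /= in_itv.
Qed.

Let stage_closed x n : closed (stage_set x n).
Proof. by apply: closed_seqU => a; apply: closed_affine. Qed.

Let stageS x n : stage_set x n.+1 `<=` stage_set x n.
Proof.
have hp : 2 ^- n.+1 <= 2 ^- n :> R.
  by rewrite lef_pV2 ?posrE ?exprn_gt0// ler_eXn2l ?ltr1n.
have h2 : 2 ^- n = 2 * 2 ^- n.+1 :> R by rewrite exprS invfM mulrA mulfV ?mul1r.
move=> y [/=]; have := scale_gt0 x n; rewrite /stage_set /=.
case: (state x n) => A r /= r0; case: ifP => _ /= a aA [z Tz <-].
  case/allpairsP: aA => -[a0 s] /= [a0A sN ->].
  exists a0 => //; exists (s + delta n * z); last by ring.
  exists s; first exact: N_S sN.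
  have /andP[z0 z2] := thick02 Tz.
  rewrite lerDl mulr_ge0 ?(ltW (delta_gt0 n))//= lerD2l.
  rewrite h2 mulrC; apply: ler_pM => //; exact: ltW.
exists a => //; exists z => //; case: Tz => s Ss /andP[z1 z2]; exists s => //.
by rewrite z1 (le_trans z2)// lerD2l.
Qed.

Let stage_le x m n : (m <= n)%N -> stage_set x n `<=` stage_set x m.
Proof.
move=> /subnK <-; elim: (n - m)%N => // i ih; rewrite addSn.
exact: subset_trans (@stageS _ _) ih.
Qed.

Let stage02 x n : stage_set x n `<=` `[0, 2]%classic.
Proof.
apply: subset_trans (stage_le (leq0n n)) _ => y [a /=].
rewrite inE => /eqP -> [z /thick02 z02 <-].
by rewrite in_itv/= add0r mul1r.
Qed.

Let stage_local x x' n : (forall k, (k < n)%N -> x' k = x k) ->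
  state x' n = state x n.
Proof.
elim: n => //= n ih xx; rewrite ih => [|k kn]; last by rewrite xx// (leq_trans kn).
by rewrite xx.
Qed.

Let core x n : set R := [set y | exists2 a, a \in (state x n).1 &
  [set a + (state x n).2 * s | s in S] y].

Let core_stage x n : core x n `<=` stage_set x n.
Proof.
move=> y [a aA [s Ss <-]]; exists a => //; exists s => //; exists s => //.
by rewrite lexx/= lerDl invr_ge0 exprn_ge0.
Qed.

Let core_step x n y : core x n y ->
  exists2 y', core x n.+1 y' & `|y - y'| <= 2 * (2 ^- n).
Proof.
have hn : 0 < 2 ^- n :> R by rewrite invr_gt0 exprn_gt0.
move=> [a + [s Ss]]; have := scale_gt0 x n; have := scale_le1 x n.
rewrite /core /=; case: (state x n) => A r /= r1 r0 aA <-.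
case: ifP => _ /=; last first.
  exists (a + r * s); first by exists a => //; exists s.
  by rewrite subrr normr0 mulr_ge0// (ltW hn).
have [s' sN ss'] := N_net n Ss.
exists (a + r * s' + r * delta n * s).
  exists (a + r * s'); last by exists s.
  by apply/allpairsP; exists (a, s').
have -> : a + r * s - (a + r * s' + r * delta n * s) =
  r * ((s - s') - delta n * s) by ring.
have /andP[s0 s1] : 0 <= s <= 1 by have := S01 Ss; rewrite /= in_itv.
rewrite normrM (gtr0_norm r0) (@le_trans _ _ `|s - s' - delta n * s|)//.
  by rewrite ler_piMl.
rewrite (le_trans (ler_normB _ _))// mulr_natl mulr2n lerD//.
rewrite normrM (gtr0_norm (delta_gt0 n)) (ger0_norm s0).
rewrite (@le_trans _ _ (delta n))//; first by rewrite ler_piMr// (ltW (delta_gt0 n)).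
rewrite (le_trans (delta_le n))// lef_pV2 ?posrE ?exprn_gt0//.
by rewrite ler_eXn2l ?ltr1n.
Qed.

(** The point is followed through nearby points of later cores; the displacements 2 * 2^-k for k >=
    n add up to at most 4 * 2^-n, and compactness yields a point of the family that close. *)
Let core_family x n y : core x n y ->
  exists2 z, family x z & `|y - z| <= 4 * 2 ^- n.
Proof.
move=> ny.
have near m : exists2 y', core x (n + m) y' &
    `|y - y'| <= 4 * (2 ^- n) - 4 * (2 ^- (n + m)).
  elim: m => [|m [y' cy' yy']].
    by exists y; rewrite ?addn0// !subrr normr0.
  have [y'' cy'' y'y''] := core_step cy'; rewrite -addnS in cy''.
  exists y'' => //; have -> : y - y'' = (y - y') + (y' - y'') by ring.
  rewrite (le_trans (ler_normD _ _))// (le_trans (lerD yy' y'y''))//.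
  rewrite addnS exprS invfM; lra.
pose F m := stage_set x (n + m) `&` [set z | `|y - z| <= 4 * 2 ^- n].
have clB : closed [set z : R | `|y - z| <= 4 * 2 ^- n].
  rewrite (_ : mkset _ = closed_ball y (4 * 2 ^- n)).
    exact: closed_ball_closed.
  by rewrite closed_ballE// mulr_gt0// invr_gt0 exprn_gt0.
have [|||m|z Fz] := @nested_compact R F.
- apply: (@closed01_compact _ _ 0 2); first by apply: closedI.
  by move=> z [/stage02].
- by move=> m; apply: closedI.
- by move=> m z [sz yz]; split => //; apply: stageS; rewrite -addnS.
- have [y' cy' yy'] := near m; exists y'; split; first exact: core_stage.
  by rewrite /= (le_trans yy')// gerBl mulr_ge0// invr_ge0 exprn_ge0.
exists z; last by case: (Fz 0%N I).
move=> m _; apply: (stage_le (leq_addl n m)).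
by case: (Fz m I).
Qed.

Let family_closed x : closed (family x).
Proof. by apply: closed_bigI => n _; exact: stage_closed. Qed.

Let family_stage x n : family x `<=` stage_set x n.
Proof. by move=> y; apply. Qed.

(** By compactness some stage already misses C, and a stage depends on finitely many bits. *)
Let family_upper x (C : set R) : closed C -> family x `&` C = set0 ->
  exists n, forall x', (forall k, (k < n)%N -> x' k = x k) -> family x' `&` C = set0.
Proof.
move=> cC fC; apply: contrapT => nn.
pose F n := stage_set x n `&` C.
have [|||n|z Fz] := @nested_compact R F.
- apply: (@closed01_compact _ _ 0 2); first by apply: closedI.
  by move=> z [/stage02].
- by move=> n; apply: closedI.
- by move=> n z [sz Cz]; split => //; exact: stageS.
- apply: contrapT => Fn; apply: nn; exists n => x' xx'.
  apply/seteqP; split => // z [fz Cz]; apply: Fn; exists z; split => //.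
  by have := family_stage n fz; rewrite /stage_set (stage_local xx').
have : (family x `&` C) z.
  by split => [n _|]; [case: (Fz n I)|case: (Fz 0%N I)].
by rewrite fC.
Qed.

Let family_lower x (U : set R) : open U -> family x `&` U !=set0 ->
  exists n, forall x', (forall k, (k < n)%N -> x' k = x k) -> family x' `&` U !=set0.
Proof.
move=> oU [y [fy Uy]].
have /nbhs_ballP[e /= e0 eU] : nbhs y U by apply: open_nbhs_nbhs.
(* One 2^-n from the stage to the core and four from the core to the family stay below 6 * 2^-n <
   e. *)
pose n := Num.truncn (6 / e).
have ne : 6 * 2 ^- n < e.
  rewrite ltr_pdivrMr ?exprn_gt0// mulrC -ltr_pdivrMr//.
  rewrite (lt_le_trans (Num.Theory.truncnS_gt _))// -natrX ler_nat.
  exact: ltn_expl.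
exists n => x' xx'.
have := family_stage n fy; rewrite /stage_set -(stage_local xx').
move=> [a aA [z [s Ss /andP[sz zs]] yE]].
have cx' : core x' n (a + (state x' n).2 * s) by exists a => //; exists s.
have [w fw ww] := core_family cx'.
exists w; split => //; apply: eU; rewrite /ball/= -yE.
have r0 := scale_gt0 x' n; have r1 := scale_le1 x' n.
set r := (state x' n).2 in ww r0 r1 *.
have -> : a + r * z - w = r * (z - s) + (a + r * s - w) by ring.
apply: le_lt_trans (ler_normD _ _) _.
have h1 : `|r * (z - s)| <= 2 ^- n.
  rewrite normrM (gtr0_norm r0) ger0_norm ?subr_ge0//.
  by rewrite (@le_trans _ _ (z - s)) ?ler_piMl ?subr_ge0// lerBlDl.
have hn : 0 < 2 ^- n :> R by rewrite invr_gt0 exprn_gt0.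
lra.
Qed.

Let state_const x n m : (forall k, (n <= k)%N -> x k = false) -> (n <= m)%N ->
  state x m = state x n.
Proof.
move=> x0 /subnK <-; elim: (m - n)%N => // i ih.
by rewrite addSn /= ih x0 ?leq_addl//; case: (state x n).
Qed.

Let family_zero x n : (forall k, (n <= k)%N -> x k = false) ->
  (exists a r : R, 0 < r /\ [set a + r * s | s in S] `<=` family x) /\
  forall s, 0 < s -> null s S -> null s (family x).
Proof.
move=> x0; have base_ne m : exists a, a \in (state x m).1.
  elim: m => [|m [a aA]]; first by exists 0; rewrite inE.
  rewrite /=; case: (state x m) aA => A r /= aA; case: ifP => _; last by exists a.
  have [t St] := S0; have [s sN _] := N_net m St.
  by exists (a + r * s); apply/allpairsP; exists (a, s).
have core_const m : (n <= m)%N -> core x m = core x n.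
  by move=> nm; rewrite /core (state_const x0 nm).
split.
  have [a aA] := base_ne n; exists a, (state x n).2; split => // y [s Ss <-] m _.
  apply: (stage_le (leq_maxr n m)); apply: core_stage.
  by rewrite (core_const _ (leq_maxl n m)); exists a => //; exists s.
move=> s s0 nS.
(* Once the state is frozen, the stages are thickenings of one closed core and shrink to it. *)
have sub : family x `<=` core x n.
  move=> y fy; apply: contrapT => ny.
  have cl : closed (core x n).
    by apply: closed_seqU => a; apply: closed_affine; exact: closed01_compact cS S01.
  have /nbhs_ballP[e /= e0 eC] : nbhs y (~` core x n).
    by apply: open_nbhs_nbhs; split => //; exact: closed_openC.
  pose k := maxn n (Num.truncn (1 / e)).
  have [a aA [z [t St /andP[tz zt]] yE]] := family_stage k fy.
  apply: (eC (a + (state x k).2 * t)); last first.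
    by rewrite -(core_const k (leq_maxl _ _)); exists a => //; exists t.
  have r0 := scale_gt0 x k; have r1 := scale_le1 x k.
  rewrite /ball/= -yE; set r := (state x k).2 in r0 r1 *.
  have -> : a + r * z - (a + r * t) = r * (z - t) by ring.
  rewrite normrM (gtr0_norm r0) ger0_norm ?subr_ge0//.
  apply: (@le_lt_trans _ _ (2 ^- k)).
    by rewrite (@le_trans _ _ (z - t)) ?ler_piMl ?subr_ge0// lerBlDl.
  rewrite -[ltLHS]mul1r ltr_pdivrMr ?exprn_gt0// mulrC -ltr_pdivrMr//.
  rewrite (lt_le_trans (Num.Theory.truncnS_gt _))// -natrX ler_nat.
  by rewrite (leq_ltn_trans (leq_maxr n _))// ltn_expl.
apply: (nullS (B := \bigcup_i [set nth 0 (state x n).1 i + (state x n).2 * t | t in S])).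
  move=> y /sub [a aA ya]; exists (index a (state x n).1) => //.
  by rewrite nth_index.
by apply: null_bigcup => // i; apply: null_affine.
Qed.

Let family_ones (x : nat -> bool) (s : R) : (forall n, exists2 k, (n <= k)%N & x k) -> 0 < s ->
  null s (family x).
Proof.
move=> x1 s0; apply: null_finite_covers => // e e0.
(* For k >= n, s(k+1) >= 2 gives (k+1)^2 - s(k+1)^3 <= -(k+1), and 3^s / e < k+1 <= 2^(k+1) then
   brings the total weight below e. *)
pose n := (Num.truncn (3 `^ s / e) + Num.truncn (2 / s))%N.
have [k nk xk] := x1 n.
exists (state x k.+1).1, (3 * delta k); split.
- by rewrite mulr_ge0// ltW.
- have k1 : 2 / s < k.+1%:R.
    rewrite (lt_le_trans (Num.Theory.truncnS_gt _))// ler_nat ltnS.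
    by rewrite (leq_trans _ nk)// leq_addl.
  have k2 : 3 `^ s / e < k.+1%:R.
    rewrite (lt_le_trans (Num.Theory.truncnS_gt _))// ler_nat ltnS.
    by rewrite (leq_trans _ nk)// leq_addr.
  have sz : ((size (state x k.+1).1)%:R : R) <= 2 `^ (k.+1 * k.+1)%:R.
    by rewrite powR_mulrn// -natrX ler_nat size_base.
  have dE : delta k `^ s = 2 `^ (- (k.+1 ^ 3)%:R * s).
    by rewrite /delta -powR_mulrn// -powRN powRrM.
  apply: (@le_trans _ _ (2 `^ (k.+1 * k.+1)%:R * (3 * delta k) `^ s)).
    by rewrite ler_wpM2r// powR_ge0.
  rewrite powRM ?(ltW (delta_gt0 k))// dE mulrCA -powRD; last by apply/implyP.
  apply: (@le_trans _ _ (3 `^ s * 2 `^ (- k.+1%:R))).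
    rewrite ler_wpM2l ?powR_ge0//; apply: ler_powR; first by rewrite ler1n.
    have K1 : 1 <= k.+1%:R :> R by rewrite ler1n.
    rewrite natrM natrX; set K : R := k.+1%:R in k1 k2 K1 *.
    have sK : 2 <= s * K by move: k1; rewrite ltr_pdivrMr// mulrC => /ltW.
    have -> : K * K + - K ^+ 3 * s = - (K * K * (s * K - 1)) by ring.
    rewrite lerN2 -mulrA -[leLHS]mulr1 ler_pM2l ?(lt_le_trans ltr01)//.
    rewrite -[leLHS]mulr1; apply: ler_pM => //; lra.
  rewrite powRN ler_pdivrMr ?powR_gt0// mulrC -ler_pdivrMr// powR_mulrn//.
  by rewrite (le_trans (ltW k2))// -natrX ler_nat ltnW// ltn_expl.
move=> y /(family_stage k.+1) [a aA [z /thick02 /andP[z0 z2] <-]].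
exists a => //; rewrite opprD addrA subrr add0r normrN.
have r0 := scale_gt0 x k.+1; rewrite normrM (gtr0_norm r0) (ger0_norm z0).
have rd : (state x k.+1).2 <= delta k.
  rewrite /=; have := scale_le1 x k; case: (state x k) => A r /= r1.
  by rewrite xk /= ler_piMl// ltW.
apply: (@le_lt_trans _ _ (delta k * 2)); first by apply: ler_pM => //; exact: ltW.
by rewrite mulrC ltr_pM2r// ltr_nat.
Qed.

Lemma cantor_family : exists f : (nat -> bool) -> set R,
  [/\ forall x, closed (f x) /\ f x `<=` `[0, 2]%classic,
    forall x C, closed C -> f x `&` C = set0 -> exists n, forall x',
      (forall k, (k < n)%N -> x' k = x k) -> f x' `&` C = set0,
    forall x U, open U -> f x `&` U !=set0 -> exists n, forall x',
      (forall k, (k < n)%N -> x' k = x k) -> f x' `&` U !=set0,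
    forall x n, (forall k, (n <= k)%N -> x k = false) ->
      (exists a r : R, 0 < r /\ [set a + r * s | s in S] `<=` f x) /\
      forall s, 0 < s -> null s S -> null s (f x) &
    forall (x : nat -> bool) (s : R),
      (forall n, exists2 k, (n <= k)%N & x k) -> 0 < s -> null s (f x)].
Proof.
exists family; split.
- move=> x; split; first exact: family_closed.
  exact: subset_trans (@family_stage x 0%N) (@stage02 x 0%N).
- exact: family_upper.
- exact: family_lower.
- exact: family_zero.
- exact: family_ones.
Qed.

End cantor_family.

(** * The reduction *)

Section fourier_dimension.
Variable R : realType.
Implicit Types (P : prob R) (A B : set R) (s c : R).

Lemma sup_ge0_ge0 (S : set R) : (0 <= sup_ge0 S)%E.
Proof. by rewrite /sup_ge0 le_max lexx. Qed.

Lemma fourier_decay_affine A B (a r s : R) : 0 < r -> 0 <= s -> closed A -> closed B ->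
  [set a + r * x | x in A] `<=` B -> fourier_decay A s -> fourier_decay B s.
Proof.
move=> r0 s0 cA cB AB [c c0 [P [PA Pc]]].
have ch : continuous (fun x : R => a + r * x).
  by move=> z; apply: cvgD; [exact: cvg_cst|apply: cvgM; [exact: cvg_cst|exact: cvg_id]].
have mh : measurable_fun [set: measurableTypeR R] (fun x : R => a + r * x : measurableTypeR R).
  exact: continuous_measurable_fun.
(* The factor 2 comes from the two terms of the addition formulas, the power of r from the frequency
   xi * r. *)
exists (2 * c * r `^ (- s / 2)); first by rewrite mulr_gt0 ?powR_gt0// mulr_gt0.
exists (pushprob P mh); split.
  rewrite pushprobE; apply/eqP; rewrite eq_le measure_ge0 andbT -PA.
  have mA : measurable A by exact: closed_measurable.
  have mB : measurable B by exact: closed_measurable.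
  apply: le_measure; rewrite ?inE.
  - rewrite -[X in measurable X]setTI; apply: mh => //; exact: measurableC.
  - exact: measurableC.
  - by move=> x nB xA; apply: nB; apply: AB; exists x.
move=> xi xi0; have rxi0 : xi * r != 0 by rewrite mulf_neq0// gt_eqF.
have [pc ps] := Pc _ rxi0; set T := c * _ in pc ps.
have -> : 2 * c * r `^ (- s / 2) * `|xi| `^ (- s / 2) = T + T.
  by rewrite /T normrM powRM// (gtr0_norm r0); ring.
have small (u v X Y : R) : `|u| <= 1 -> `|v| <= 1 -> `|X| <= T -> `|Y| <= T ->
    `|u * X + v * Y| <= T + T.
  move=> u1 v1 XT YT; rewrite (le_trans (ler_normD _ _))// !normrM lerD//.
    by rewrite (le_trans (ler_piMl _ u1)).
  by rewrite (le_trans (ler_piMl _ v1)).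
have bc := bmeas_cosZ (xi * r); have bs := bmeas_sinZ (xi * r).
split; rewrite bint_push; try exact: bmeas_cosZ; try exact: bmeas_sinZ.
- have -> : (fun x => cos (xi * (a + r * x))) =
      (fun x => cos (xi * a) * cos (xi * r * x) + - sin (xi * a) * sin (xi * r * x)).
    by apply/funext => x; rewrite mulrDr mulrA cosD mulNr.
  rewrite bintD ?bintZ//; try exact: bmeasZ.
  by apply: small => //; [exact: cos_max|rewrite normrN; exact: sin_max].
- have -> : (fun x => sin (xi * (a + r * x))) =
      (fun x => sin (xi * a) * cos (xi * r * x) + cos (xi * a) * sin (xi * r * x)).
    by apply/funext => x; rewrite mulrDr mulrA sinD.
  rewrite bintD ?bintZ//; try exact: bmeasZ.
  by apply: small => //; [exact: sin_max|exact: cos_max].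
Qed.

Lemma fourier_decay_transform A s : closed A ->
  fourier_decay A s <->
  exists P, measure_support P `<=` A /\ exists c : R, 0 < c /\
    forall x : R, x != 0 ->
      (`|fourier_transform P x| <= (c * `|x| `^ (- s / 2))%:C)%C.
Proof.
move=> cA; split=> [[c c0 [P [PA Pc]]]|[P [PA [c [c0 Pc]]]]].
  exists P; split; first exact/support_sub.
  exists (c + c); split; first by rewrite addr_gt0.
  move=> x x0; have [hc hs] := Pc x x0.
  rewrite normc_def lecR /fourier_transform/= sqrrN.
  set u := (\int[P]_x0 cos _) in hc *; set v := (\int[P]_x0 sin _) in hs *.
  set T := `|x| `^ _ in hc hs *.
  have uv : u ^+ 2 + v ^+ 2 <= ((c + c) * T) ^+ 2.
    have u2 : u ^+ 2 <= (c * T) ^+ 2.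
      by rewrite -(real_normK (num_real u)) ler_pXn2r// nnegrE (le_trans _ hc).
    have v2 : v ^+ 2 <= (c * T) ^+ 2.
      by rewrite -(real_normK (num_real v)) ler_pXn2r// nnegrE (le_trans _ hs).
    have cT : 0 <= (c * T) ^+ 2 by exact: sqr_ge0.
    have -> : ((c + c) * T) ^+ 2 = 4 * (c * T) ^+ 2 by ring.
    lra.
  rewrite (le_trans (ler_wsqrtr uv))// sqrtr_sqr ger0_norm// mulr_ge0 ?powR_ge0//.
  by rewrite ltW// addr_gt0.
exists c => //; exists P; split; first exact/support_sub.
move=> x x0; have := Pc x x0; rewrite normc_def lecR /fourier_transform/= sqrrN.
set u := \int[P]_x0 cos _; set v := \int[P]_x0 sin _ => h.
split; apply: le_trans h; rewrite -sqrtr_sqr; apply: ler_wsqrtr.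
  by rewrite lerDl sqr_ge0.
by rewrite lerDr sqr_ge0.
Qed.

Lemma fourier_dim_ge A s : closed A -> 0 <= s <= 1 -> fourier_decay A s ->
  (s%:E <= fourier_dim A)%E.
Proof.
by move=> cA s01 As; apply: sup_ge0_ge; split => //; exact/fourier_decay_transform.
Qed.

Lemma fourier_dim_le_hausdorff A : closed A -> (fourier_dim A <= hausdorff_dim A)%E.
Proof.
move=> cA; apply: sup_ge0_le; first exact: sup_ge0_ge0.
move=> s [/andP[s0 s1] /(fourier_decay_transform s cA) As].
have [s_gt0|] := ltP 0 s; last first.
  by move=> s_le0; rewrite (@le_trans _ _ 0%E) ?lee_fin//; exact: sup_ge0_ge0.
apply: lim_from_below => // k; have /andP[k0 k1] := frac_lt1 R k.
have t0 : 0 < s * (k.+1%:R / k.+2%:R) by rewrite mulr_gt0.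
apply: hausdorff_dim_ge => //; apply: (fourier_decay_not_null _ As) => //.
  exact: closed_measurable.
by rewrite gtr_pMr.
Qed.

Lemma fourier_dim_geP (p : R) A : closed A -> 0 < p <= 1 ->
  ((p%:E <= fourier_dim A)%E <->
  forall k : nat, fourier_decay A (p * (k.+1%:R / k.+2%:R))).
Proof.
move=> cA /andP[p0 p1]; split=> [pA k|pA]; last first.
  apply: lim_from_below => // k; apply: fourier_dim_ge => //.
  have /andP[k0 k1] := frac_lt1 R k.
  by rewrite mulr_ge0 ?(ltW p0) ?(ltW k0)//= mulr_ile1 ?(ltW p0) ?(ltW k0) ?(ltW k1).
have /andP[k0 k1] := frac_lt1 R k.
set q := p * _; have q0 : 0 <= q by rewrite mulr_ge0 ?(ltW p0) ?(ltW k0).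
apply: contrapT => nq.
have : (fourier_dim A <= q%:E)%E.
  apply: sup_ge0_le; first by rewrite lee_fin.
  move=> s [/andP[s0 s1] /(fourier_decay_transform s cA) As].
  rewrite lee_fin leNgt; apply/negP => qs; apply: nq.
  by apply: (fourier_decay_le q0 _ As); exact: ltW.
by move/(le_trans pA); rewrite lee_fin leNgt /q gtr_pMr ?k1.
Qed.

End fourier_dimension.

(** * Continuity into the hyperspace *)

Section vietoris.
Variable R : realType.

Lemma vietoris_open (V : set (K01 R)) : @vietoris_subbase R [set` `[0%R, 1%R]] V ->
  open V.
Proof.
move=> bV; exists [set V]; last first.
  by rewrite predeqE => A; split=> [[_ ->]|]//; exists V.
move=> _ ->; exists (finmap.fset1 V).
  by move=> W; rewrite finmap.in_fset1 => /eqP->; exact/mem_set.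
rewrite predeqE => A; split=> [|VA W]; first by apply; rewrite /= finmap.in_fset1.
by rewrite /= finmap.in_fset1 => /eqP->.
Qed.

Lemma open_miss (C : set R) : closed C -> open [set A : K01 R | A `&` C = set0].
Proof. by move=> cC; apply: vietoris_open; left; exists C. Qed.

Lemma vietoris_continuous (T : topologicalType) (f : T -> K01 R) :
  (forall x (C : set R), closed C -> f x `&` C = set0 ->
    \forall y \near x, f y `&` C = set0) ->
  (forall x (U : set R), open U -> f x `&` U !=set0 ->
    \forall y \near x, f y `&` U !=set0) -> continuous f.
Proof.
move=> fC fU x V; rewrite (@nbhsE (K01 R)) => -[B [[C sC <-] [D CD Dx]] sB].
rewrite nbhs_filterE; apply: filterS sB _; apply: (@filterS _ _ _ D).
  by move=> y Dy; exists D.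
have /sC [E sE EE] := CD; rewrite -EE; apply: filter_bigI => W WE.
have Wx : W (f x) by move: Dx; rewrite -EE => /(_ W WE).
have /sE := WE; move=> /set_mem -[[C0 cC0 WC]|[U oU WU]].
  by move: Wx; rewrite -WC => /fC; apply.
by move: Wx; rewrite -WU => /fU; apply.
Qed.

End vietoris.

Lemma cantor2_near (x : cantor2) (M N : nat) :
  \forall y \near x, forall i k, (i < M)%N -> (k < N)%N -> y (i, k) = x (i, k).
Proof.
have H (j : 'I_M * 'I_N) : \forall y \near x, y (val j.1, val j.2) = x (val j.1, val j.2).
  have c := @proj_continuous _ (fun _ : nat * nat => bool) (val j.1, val j.2) x.
  by apply: (c [set b | b = x (val j.1, val j.2)]); exact: discrete_set1.
apply: (@filterS _ _ _ [set y : cantor2 | forall j : 'I_M * 'I_N,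
    y (val j.1, val j.2) = x (val j.1, val j.2)]).
  by move=> y h i k iM kN; exact: (h (Ordinal iM, Ordinal kN)).
exact: (@filter_forall cantor2 _ _ (nbhs x) _ H).
Qed.

Lemma approx_ratio (R : realType) (p : R) (m : nat) : 0 < p <= 1 ->
  exists a b : nat, (0 < a < b)%N /\ p - m.+1%:R^-1 < a%:R / b%:R < p.
Proof.
move=> /andP[p0 p1]; pose b := (Num.truncn (2 / p) + 2 * m.+1).+1.
have b0 : 0 < b%:R :> R by rewrite ltr0n.
have pb2 : 2 < p * b%:R.
  rewrite mulrC -ltr_pdivrMr//; apply: (lt_le_trans (Num.Theory.truncnS_gt _)).
  by rewrite ler_nat ltnS leq_addr.
have /andP[k1 k2] := @truncn_itv R (p * b%:R) (mulr_ge0 (ltW p0) (ltW b0)).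
set k := Num.truncn (p * b%:R) in k1 k2.
have k_gt1 : (1 < k)%N.
  by rewrite -ltnS -(ltr_nat R) (le_lt_trans _ k2)// ltW.
exists k.-1, b.
have kE : (k.-1)%:R = k%:R - 1 :> R by rewrite -subn1 natrB// ltnW.
have ab : (k.-1)%:R < p * b%:R by rewrite kE; lra.
split.
  apply/andP; split; first by rewrite -subn1 subn_gt0.
  rewrite -(ltr_nat R) (lt_le_trans ab)//.
  by rewrite ler_piMl// ltW.
rewrite ltr_pdivrMr// ab andbT ltr_pdivlMr// kE mulrBl.
have mb : 2 <= m.+1%:R^-1 * b%:R :> R.
  rewrite mulrC ler_pdivlMr ?ltr0n// -natrM ler_nat.
  by rewrite /b; lia.
have k2' : p * b%:R < k%:R + 1 by rewrite natr1.
rewrite ltrBlDr (lt_le_trans k2')//.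
by move: mb; set X := m.+1%:R^-1 * _; lra.
Qed.

Lemma salem_cantor_family (R : realType) (a b : nat) : (0 < a < b)%N ->
  exists f : (nat -> bool) -> set R,
  [/\ forall x, closed (f x) /\ f x `<=` `[0, 2]%classic,
    forall x C, closed C -> f x `&` C = set0 -> exists n, forall x',
      (forall k, (k < n)%N -> x' k = x k) -> f x' `&` C = set0,
    forall x U, open U -> f x `&` U !=set0 -> exists n, forall x',
      (forall k, (k < n)%N -> x' k = x k) -> f x' `&` U !=set0,
    forall x n, (forall k, (n <= k)%N -> x k = false) ->
      (forall s : R, 0 <= s -> s < a%:R / b%:R -> fourier_decay (f x) s) /\
      forall s : R, a%:R / b%:R < s -> null s (f x) &
    forall (x : nat -> bool) (s : R),
      (forall n, exists2 k, (n <= k)%N & x k) -> 0 < s -> null s (f x)].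
Proof.
move=> ab; have [S [cS S01 nS [P [PS dP]]]] := salem_set R ab.
have S0 : S !=set0.
  apply: contrapT => S0; have : P (~` S) = 1%E.
    rewrite (_ : ~` S = setT) ?probability_setT//.
    by apply/seteqP; split => // x _ Sx; apply: S0; exists x.
  by rewrite PS => /eqP; rewrite eqe eq_sym oner_eq0.
have [f [f1 f2 f3 f4 f5]] := cantor_family cS S01 S0.
exists f; split => // x n x0; have [[u [r [r0 ur]]] nf] := f4 x n x0; split.
  move=> s s0 sab; have [cf _] := f1 x.
  apply: (fourier_decay_affine r0 s0 cS cf ur).
  by have [c c0 dc] := dP s s0 sab; exists c => //; exists P.
move=> s sab; apply: nf; last exact: nS.
by apply: le_lt_trans sab; rewrite divr_ge0.
Qed.

(** * Gluing the families into one reduction *)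

Section reduction.
Variables (R : realType) (p : R) (q : nat -> R) (f : nat -> (nat -> bool) -> set R).
Hypotheses (p01 : 0 < p <= 1) (qp : forall m, 0 < q m < p)
  (qlim : forall m, p - m.+1%:R^-1 < q m)
  (f_closed : forall m x, closed (f m x))
  (f02 : forall m x, f m x `<=` `[0, 2]%classic)
  (f_upper : forall m x C, closed C -> f m x `&` C = set0 -> exists n, forall x',
      (forall k, (k < n)%N -> x' k = x k) -> f m x' `&` C = set0)
  (f_lower : forall m x U, open U -> f m x `&` U !=set0 -> exists n, forall x',
      (forall k, (k < n)%N -> x' k = x k) -> f m x' `&` U !=set0)
  (f_decay : forall m x n, (forall k, (n <= k)%N -> x k = false) ->
      forall s : R, 0 <= s -> s < q m -> fourier_decay (f m x) s)
  (f_null : forall m x n, (forall k, (n <= k)%N -> x k = false) ->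
      forall s : R, q m < s -> null s (f m x))
  (f_null0 : forall m (x : nat -> bool) (s : R),
      (forall n, exists2 k, (n <= k)%N & x k) -> 0 < s -> null s (f m x)).

(** A row of x with infinitely many ones thus spoils all later pieces and not only its own.
    Otherwise the remaining q_m could still have supremum p. *)
Let row (x : cantor2) m k : bool := [exists i : 'I_m.+1, x (val i, k)].

(** The map sends [0,2], which contains [f m], onto [2^-(m+1), 2^-m]. *)
Let piece x m : set R := [set 2 ^- m.+1 + 2 ^- m.+2 * y | y in f m (row x m)].

Let Fset x : set R := [set 0] `|` \bigcup_m piece x m.

Let rowP x : P3 x -> forall m, exists n, forall k, (n <= k)%N -> row x m k = false.
Proof.
move=> /choice[N NP] m; exists (\max_(i < m.+1) N i) => k Nk.
apply/negbTE/existsPn => i; rewrite (NP i)//.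
by apply: leq_trans Nk; apply: (@leq_bigmax _ (fun i : 'I_m.+1 => N i)).
Qed.

Let row_notP x : ~ P3 x -> exists m0, forall m, (m0 <= m)%N ->
  forall n, exists2 k, (n <= k)%N & row x m k.
Proof.
move=> nx; apply: contrapT => H; apply: nx => m0; apply: contrapT => Hm.
apply: H; exists m0 => m m0m n; apply: contrapT => nk; apply: Hm; exists n => k nk'.
apply/negP => xk; apply: nk; exists k => //; apply/existsP.
have m0m' : (m0 < m.+1)%N by rewrite ltnS.
by exists (Ordinal m0m').
Qed.

Let h_itv m : (fun y : R => 2 ^- m.+1 + 2 ^- m.+2 * y) @` `[0, 2]%classic `<=`
  `[0, 2 ^- m]%classic.
Proof.
move=> _ [y /= + <-]; rewrite !in_itv/= => /andP[y0 y2].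
have e1 : 2 ^- m = 4 * 2 ^- m.+2 :> R by rewrite !exprS !invfM !mulrA; field.
have e2 : 2 ^- m.+1 = 2 * 2 ^- m.+2 :> R by rewrite [in RHS]exprS !invfM !mulrA mulfV ?mul1r.
have t0 : 0 < 2 ^- m.+2 :> R by rewrite invr_gt0 exprn_gt0.
by rewrite e1 e2; set t := 2 ^- m.+2 in t0 *; apply/andP; split; nra.
Qed.

Let piece_itv x m M : (M <= m)%N -> piece x m `<=` `[0, 2 ^- M]%classic.
Proof.
move=> Mm _ [y /f02 y02 <-].
have : (`[0, 2 ^- m]%classic : set R) (2 ^- m.+1 + 2 ^- m.+2 * y).
  by apply: h_itv; exists y.
rewrite /= !in_itv/= => /andP[-> /le_trans]; apply.
by rewrite lef_pV2 ?posrE ?exprn_gt0// ler_eXn2l ?ltr1n.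
Qed.

Let Fset01 x : Fset x `<=` `[0, 1]%classic.
Proof.
move=> y [->|[m _ /(piece_itv (leq0n m))]]; last by rewrite expr0 invr1.
by rewrite /= in_itv/= lexx ler01.
Qed.

Let piece_closed x m : closed (piece x m).
Proof. by apply: closed_affine; exact: closed01_compact (@f_closed _ _) (@f02 _ _). Qed.

(** An intersection of finite unions, each with a small interval at 0: this gives closedness and
    reduces upper semicontinuity to finitely many pieces. *)
Let Fset_approx x : Fset x = \bigcap_M (`[0, 2 ^- M]%classic `|`
  [set y | exists2 m, m \in iota 0 M & piece x m y]).
Proof.
apply/seteqP; split => y.
  move=> [->|[m _ my]] M _; first by left; rewrite /= in_itv/= lexx invr_ge0 exprn_ge0.
  have [mM|Mm] := ltnP m M; first by right; exists m => //; rewrite mem_iota.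
  by left; exact: (piece_itv Mm my).
move=> H; apply: contrapT => ny.
have itv M : 0 <= y <= 2 ^- M.
  have [|[m _ my]] := H M I; first by rewrite /= in_itv.
  by case: ny; right; exists m.
have y0 : 0 < y.
  rewrite lt_neqAle eq_sym; have /andP[-> _] := itv 0%N; rewrite andbT.
  by apply/eqP => yE; apply: ny; left.
have /andP[_] := itv (Num.truncn y^-1); rewrite leNgt => /negP; apply.
rewrite invf_plt ?posrE ?exprn_gt0//.
rewrite (lt_le_trans (Num.Theory.truncnS_gt _))// -natrX ler_nat.
exact: ltn_expl.
Qed.

Let Fset_closed x : closed (Fset x).
Proof.
rewrite Fset_approx; apply: closed_bigI => M _; apply: closedU.
  exact: itv_closed.
by apply: closed_seqU => m; exact: piece_closed.
Qed.

Let h_preimage (A B : set R) m : [set 2 ^- m.+1 + 2 ^- m.+2 * y | y in A] `&` B !=set0 <->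
  A `&` ((fun y => 2 ^- m.+1 + 2 ^- m.+2 * y) @^-1` B) !=set0.
Proof.
by split=> [[_ [[y Ay <-] By]]|[y [Ay By]]]; [exists y|eexists; split; [exists y|]].
Qed.

Let h_continuous m : continuous (fun y : R => 2 ^- m.+1 + 2 ^- m.+2 * y).
Proof.
by move=> z; apply: cvgD; [exact: cvg_cst|apply: cvgM; [exact: cvg_cst|exact: cvg_id]].
Qed.

Let row_local x m n : \forall y \near x, forall k, (k < n)%N -> row y m k = row x m k.
Proof.
apply: filterS (cantor2_near x m.+1 n) => y yx k kn.
by apply: eq_existsb => i; apply: yx => //; exact: ltn_ord.
Qed.

Let piece_upper x m (C : set R) : closed C -> piece x m `&` C = set0 ->
  \forall y \near x, piece y m `&` C = set0.
Proof.
move=> cC xC.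
have xC' : f m (row x m) `&` ((fun y => 2 ^- m.+1 + 2 ^- m.+2 * y) @^-1` C) = set0.
  apply/eqP/negPn/negP => /set0P /h_preimage; rewrite -/(piece x m) xC.
  by case.
have cC' : closed ((fun y => 2 ^- m.+1 + 2 ^- m.+2 * y) @^-1` C).
  by have /continuous_closedP := @h_continuous m; apply.
have [n nP] := f_upper cC' xC'.
apply: filterS (row_local x m n) => y /nP yC.
apply/eqP/negPn/negP => /set0P /h_preimage; rewrite yC; by case.
Qed.

Let piece_lower x m (U : set R) : open U -> piece x m `&` U !=set0 ->
  \forall y \near x, piece y m `&` U !=set0.
Proof.
move=> oU /h_preimage xU.
have oU' : open ((fun y => 2 ^- m.+1 + 2 ^- m.+2 * y) @^-1` U).
  by have /continuousP := @h_continuous m; apply.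
have [n nP] := f_lower oU' xU.
by apply: filterS (row_local x m n) => y /nP yU; exact/h_preimage.
Qed.

Let Fset_upper x (C : set R) : closed C -> Fset x `&` C = set0 ->
  \forall y \near x, Fset y `&` C = set0.
Proof.
move=> cC xC.
have C0 : ~ C 0.
  move=> C0; suff : (Fset x `&` C) 0 by rewrite xC.
  by split => //; left.
have /nbhs_ballP[e /= e0 eC] : nbhs (0 : R) (~` C).
  by apply: open_nbhs_nbhs; split => //; exact: closed_openC.
pose M := Num.truncn e^-1.
have Me : 2 ^- M < e.
  rewrite invf_plt ?posrE ?exprn_gt0//.
  by rewrite (lt_le_trans (Num.Theory.truncnS_gt _))// -natrX ler_nat ltn_expl.
have : \forall y \near x, forall m : 'I_M, piece y m `&` C = set0.
  apply: (@filter_forall cantor2 _ (fun (m : 'I_M) (y : cantor2) =>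
    piece y m `&` C = set0) (nbhs x) _) => m.
  apply: piece_upper => //; apply/seteqP; split => // y [my Cy]; rewrite -xC.
  by split => //; right; exists m.
apply: filterS => y yC; apply/seteqP; split => // z [Fz Cz].
have := Fz; rewrite Fset_approx => /(_ M I)[|[m]].
  rewrite /= in_itv/= => /andP[z0 zM]; apply: (eC z) => //.
  by rewrite /ball/= sub0r normrN ger0_norm// (le_lt_trans zM).
by rewrite mem_iota => mM mz; rewrite -(yC (Ordinal mM)).
Qed.

Let Fset_lower x (U : set R) : open U -> Fset x `&` U !=set0 ->
  \forall y \near x, Fset y `&` U !=set0.
Proof.
move=> oU [z [[->|[m _ mz]] Uz]].
  by apply: filterE => y; exists 0; split => //; left.
have : piece x m `&` U !=set0 by exists z.
move/(piece_lower oU); apply: filterS => y [w [mw Uw]].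
by exists w; split => //; right; exists m.
Qed.

Let reduction_map x : K01 R :=
  Compacts (closed01_compact (@Fset_closed x) (@Fset01 x)) (@Fset01 x).

Let fourier_dim_piece x m n : (forall k, (n <= k)%N -> row x m k = false) ->
  ((q m)%:E <= fourier_dim (Fset x))%E.
Proof.
move=> x0; have /andP[q0 qm] := qp m; have /andP[p0 p1] := p01.
apply/fourier_dim_geP => // [|k]; first by rewrite q0 (le_trans (ltW qm)).
have /andP[k0 k1] := frac_lt1 R k.
have s0 : 0 <= q m * (k.+1%:R / k.+2%:R) by rewrite mulr_ge0 ?(ltW q0) ?(ltW k0).
have h0 : 0 < 2 ^- m.+2 :> R by rewrite invr_gt0 exprn_gt0.
apply: (@fourier_decay_affine _ (f m (row x m)) _ (2 ^- m.+1) _ _ h0) => //.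
  by move=> y my; right; exists m.
by apply: f_decay x0 _ _ _; rewrite ?gtr_pMr.
Qed.

Let Fset_null x (s : R) : 0 < s -> (forall m, null s (f m (row x m))) -> null s (Fset x).
Proof.
move=> s0 nx; apply: nullU => //; first exact: null1.
by apply: null_bigcup => // m; apply: null_affine => //; rewrite invr_gt0 exprn_gt0.
Qed.

Lemma reduction_exists : exists F : cantor2 -> K01 R,
  continuous F /\ forall x, salem (F x) /\
    ((p%:E <= hausdorff_dim (F x))%E <-> P3 x).
Proof.
have /andP[p0 p1] := p01.
exists reduction_map; split.
  by apply: vietoris_continuous => [x C cC|x U oU]; [exact: Fset_upper|exact: Fset_lower].
move=> x; have sal : salem (reduction_map x).
  apply/eqP; rewrite eq_le fourier_dim_le_hausdorff ?andbT; last exact: Fset_closed.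
  (* Above the Fourier dimension every piece is s-null: if its bits are eventually 0 then q_m is at
     most that dimension, and otherwise it is null for all positive exponents. *)
  apply: hausdorff_dim_le; first exact: sup_ge0_ge0.
  move=> s s0 ds; apply: Fset_null => // m.
  have [[n xn]|nx] := pselect (exists n, forall k, (n <= k)%N -> row x m k = false).
    apply: (f_null xn); rewrite -lte_fin; apply: le_lt_trans ds.
    exact: fourier_dim_piece xn.
  apply: f_null0 => // n; apply: contrapT => nk; apply: nx; exists n => k nk'.
  by case xk: (row x m k) => //; case: nk; exists k.
split => //; split => [px|Px].
  apply: contrapT => /row_notP[m0 m0P].
  (* Finitely many q_m, each strictly below p, have a maximum below p; it bounds the dimension of
     what remains. *)
  have [d [d0 dp qd]] : exists d : R, [/\ 0 <= d, d < p &
      forall m, (m < m0)%N -> q m <= d].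
    clear -p0 qp; elim: m0 => [|m0 [d [d0 dp qd]]]; first by exists 0.
    exists (Num.max d (q m0)); split.
    - by rewrite le_max d0.
    - by rewrite gt_max dp; have /andP[] := qp m0.
    - move=> m; rewrite ltnS leq_eqVlt => /predU1P[->|/qd qmd].
        by rewrite le_max lexx orbT.
      by rewrite le_max qmd.
  have : (hausdorff_dim (reduction_map x) <= d%:E)%E.
    apply: hausdorff_dim_le => // s s0; rewrite lte_fin => ds; apply: Fset_null => // m.
    have [[n xn]|nx] := pselect (exists n, forall k, (n <= k)%N -> row x m k = false).
      apply: (f_null xn); apply: le_lt_trans ds; apply: qd; rewrite ltnNge.
      apply/negP => /m0P /(_ n)[k nk]; by rewrite xn.
    apply: f_null0 => // n; apply: contrapT => nk; apply: nx; exists n => k nk'.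
    by case xk: (row x m k) => //; case: nk; exists k.
  by move/(le_trans px); rewrite lee_fin leNgt dp.
rewrite sal; apply: lim_from_below => // k.
have /andP[k0 k1] := frac_lt1 R k.
set s := p * _; have sp : s < p by rewrite gtr_pMr.
have ps : 0 < p - s by rewrite subr_gt0.
(* 1/(m+1) < p - s, so q_m > s. *)
pose m := Num.truncn (p - s)^-1.
have [n xn] := rowP Px m.
apply: le_trans (fourier_dim_piece xn); rewrite lee_fin ltW//.
apply: lt_trans (qlim m); rewrite ltrBrDr -ltrBrDl.
by rewrite invf_plt ?posrE ?ltr0n// Num.Theory.truncnS_gt.
Qed.

End reduction.

Lemma salem_reduction (R : realType) (p : R) : 0 < p <= 1 ->
  exists F : cantor2 -> K01 R,
  continuous F /\ forall x, salem (F x) /\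
    ((p%:E <= hausdorff_dim (F x))%E <-> P3 x).
Proof.
move=> p01; have /choice[ab abP] (m : nat) : exists ab : nat * nat, (0 < ab.1 < ab.2)%N /\
    p - m.+1%:R^-1 < ab.1%:R / ab.2%:R < p.
  by have [a [b H]] := approx_ratio m p01; exists (a, b).
have /choice[f fP] m := salem_cantor_family R (abP m).1.
apply: (@reduction_exists R p (fun m => (ab m).1%:R / (ab m).2%:R) f) => //
  [m|m|m x|m x|m x|m x|m x n x0|m x n x0|m x].
- have [/andP[a0 b0] /andP[_ ->]] := abP m; rewrite andbT divr_gt0// ltr0n//.
  exact: leq_trans b0.
- by have [_ /andP[]] := abP m.
- by have [+ _ _ _ _] := fP m => /(_ x)[].
- by have [+ _ _ _ _] := fP m => /(_ x)[].
- by have [_ + _ _ _] := fP m; apply.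
- by have [_ _ + _ _] := fP m; apply.
- by have [_ _ _ + _] := fP m => /(_ x n x0)[].
- by have [_ _ _ + _] := fP m => /(_ x n x0)[].
- by have [_ _ _ _ +] := fP m; apply.
Qed.

(** * Borel complexity *)

Lemma Sigma0_2_bigcup (X : topologicalType) (F : nat -> set X) :
  (forall j, closed (F j)) -> Sigma0 2 (\bigcup_j F j).
Proof.
move=> cF; apply: (@Sigma0_bigcup X 2 (fun=> 1%N)) => // j.
by apply: Sigma0_open; rewrite openC.
Qed.

Lemma Pi0_3_bigcap (X : topologicalType) (G : nat -> set X) :
  (forall k, Sigma0 2 (G k)) -> Pi0 3 (\bigcap_k G k).
Proof.
move=> sG; rewrite /Pi0 setC_bigcap.
by apply: (@Sigma0_bigcup X 3 (fun=> 2%N)) => // k; rewrite setCK.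
Qed.

Section complexity.
Variables (R : realType) (p : R).
Hypothesis p01 : 0 < p <= 1.

Lemma K01_closed (A : K01 R) : closed (A : set R).
Proof.
apply: compact_closed; first exact: norm_hausdorff.
exact: cset_compact.
Qed.

Lemma open_subset_of (V : set R) : open V -> open [set A : K01 R | A `<=` V].
Proof.
move=> oV; rewrite (_ : mkset _ = [set A : K01 R | A `&` ~` V = set0]).
  by apply: open_miss; exact: open_closedC.
apply/seteqP; split => A /=; first by move=> /subsets_disjoint.
by move=> /subsets_disjoint.
Qed.

Lemma hausdorff_dim_Pi0_3 : Pi0 3 [set A : K01 R | (p%:E <= hausdorff_dim A)%E].
Proof.
have /andP[p0 _] := p01.
pose q k : R := p * (k.+1%:R / k.+2%:R).
pose covered s e : set (K01 R) := [set A | exists c r : nat -> R,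
  [/\ forall i, 0 <= r i, A `<=` \bigcup_i ball (c i) (r i) &
    forall n, \sum_(i < n) r i `^ s <= e]].
(* The union of the covering balls is open, so one cover of A serves all compact sets in a Vietoris
   neighbourhood of A. *)
have ocov s e : open (covered s e).
  rewrite openE => A [c [r [r0 Ar re]]].
  have oV : open (\bigcup_i ball (c i) (r i)).
    by apply: bigcup_open => i _; exact: ball_open.
  apply: filterS (open_nbhs_nbhs (conj (open_subset_of oV) Ar)) => B BV.
  by exists c, r.
rewrite (_ : mkset _ = \bigcap_k \bigcup_j ~` covered (q k) (j.+1%:R^-1)).
  apply: Pi0_3_bigcap => k; apply: Sigma0_2_bigcup => j.
  exact: open_closedC.
apply/seteqP; split=> A.
  move=> /(hausdorff_dim_geP _ p0) nA k _; apply: contrapT => nj; apply: (nA k) => e e0.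
  have [c [r [r0 Ar re]]] : covered (q k) ((Num.truncn e^-1).+1%:R^-1) A.
    by apply: contrapT => nc; apply: nj; exists (Num.truncn e^-1).
  exists c, r; split => // n; apply: (le_trans (re n)).
  by rewrite invf_ple ?posrE// ltW// Num.Theory.truncnS_gt.
move=> H; apply/hausdorff_dim_geP => // k nk.
have [j _] := H k I; apply; apply: nk.
by rewrite invr_gt0.
Qed.

Lemma fourier_dim_Pi0_3 : Pi0 3 [set A : K01 R | (p%:E <= fourier_dim A)%E].
Proof.
pose q k : R := p * (k.+1%:R / k.+2%:R).
pose C s c : set (K01 R) := [set A | has_decay (A : set R) s c].
have cC s c : closed (C s c).
  rewrite -openC openE => A nA.
  (* By [has_decay_closed], some 1/(n+1)-neighbourhood of A contains no closed subset of [0,1] with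
     this decay; the compact sets inside it form an open set around A. *)
  have [n nn] : exists n : nat, forall B : set R, closed B -> B `<=` `[0, 1]%classic ->
      B `<=` [set x | exists2 a, (A : set R) a & `|x - a| < (n.+1%:R^-1 : R)] ->
      ~ has_decay B s c.
    apply: contrapT => H; apply: nA; apply: has_decay_closed; first exact: K01_closed.
    move=> n; apply: contrapT => nB; apply: H; exists n => B cB B01 BA dB.
    by apply: nB; exists B.
  have oV : open [set x | exists2 a, (A : set R) a & `|x - a| < (n.+1%:R^-1 : R)].
    rewrite (_ : mkset _ = \bigcup_(a in (A : set R)) ball a n.+1%:R^-1).
      by apply: bigcup_open => a _; exact: ball_open.
    by apply/seteqP; split => x [a Aa]; rewrite /ball/= => h; exists a; rewrite // distrC.
  have AV : (A : set R) `<=` [set x | exists2 a, (A : set R) a & `|x - a| < (n.+1%:R^-1 : R)].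
    by move=> a Aa; exists a => //; rewrite subrr normr0 invr_gt0.
  apply: filterS (open_nbhs_nbhs (conj (open_subset_of oV) AV)) => B BV.
  by apply: nn => //; [exact: K01_closed|exact: cset_sub].
rewrite (_ : mkset _ = \bigcap_k \bigcup_n C (q k) n.+1%:R).
  by apply: Pi0_3_bigcap => k; exact: Sigma0_2_bigcup.
apply/seteqP; split=> A.
  move=> /(fourier_dim_geP (@K01_closed A) p01) dA k _.
  by have /fourier_decayP[n dn] := dA k; exists n.
move=> H; apply/(fourier_dim_geP (@K01_closed A) p01) => k; apply/fourier_decayP.
by have [n _ dn] := H k I; exists n.
Qed.

End complexity.

Theorem theorem3p8 (R : realType) (p : R) (hp : 0 < p <= 1) :
  (exists F : cantor2 -> K01 R,
     continuous F /\
     forall x : cantor2,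
       salem (F x) /\ ((p%:E <= hausdorff_dim (F x))%E <-> P3 x)) /\
  let X1 : set (K01 R) := [set A : K01 R | (p%:E <= hausdorff_dim A)%E] in
  let X2 : set (K01 R) := [set A : K01 R | (p%:E <= fourier_dim A)%E] in
  (forall X : set (K01 R), X2 `<=` X -> X `<=` X1 -> Gamma_hard R (Pi0 3) X) /\
  Gamma_complete R (Pi0 3) X1 /\
  Gamma_complete R (Pi0 3) X2.
Proof.
have [F [cF salF]] := salem_reduction hp.
have hard (X : set (K01 R)) : [set A : K01 R | (p%:E <= fourier_dim A)%E] `<=` X ->
    X `<=` [set A : K01 R | (p%:E <= hausdorff_dim A)%E] -> Gamma_hard R (Pi0 3) X.
  move=> X2 X1 T polT zT A hA; have [g [cg gA]] := P3_hard polT zT hA.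
  exists (F \o g); split.
    by move=> t; apply: continuous_comp; [exact: cg|exact: cF].
  (* Values of F are Salem, so [X1] and [X2] have the same preimage under F, and every set in
     between shares it. *)
  move=> t; have [sal FP] := salF (g t); rewrite gA -FP; split=> [FX|/X1//].
  by apply: X2; rewrite /= -sal.
have sub : [set A : K01 R | (p%:E <= fourier_dim A)%E] `<=`
    [set A : K01 R | (p%:E <= hausdorff_dim A)%E].
  by move=> A /le_trans; apply; apply: fourier_dim_le_hausdorff; exact: K01_closed.
split; first by exists F.
move=> X1 X2; split; first exact: hard.
by split; split; [exact: hard|exact: hausdorff_dim_Pi0_3|exact: hard|exact: fourier_dim_Pi0_3].
Qed.
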